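(* There is no algorithm that, given a (non-probabilistic) parity tree automaton $\mathcal{A}$, decides whether $\mathcal{L}^{\forall}_{\mathrm{qual}}(\mathcal{A})=\varnothing$.
   Context: A $\Sigma$-tree is a map $t:\{0,1\}^*\to\Sigma$ ($\Sigma$ a finite alphabet); for a branch $\pi\in\{0,1\}^\omega$, $t(\pi)=t(\epsilon)t(\pi_0)t(\pi_0\pi_1)\cdots$. The coin-flipping measure $\mu$ on $\{0,1\}^\omega$ gives the cone $u\{0,1\}^\omega$ measure $2^{-|u|}$. A tree automaton is $\mathcal{A}=(Q,\Sigma,\Delta,q_\iota,\mathrm{Acc})$ with $Q$ finite, $\Delta\subseteq Q\times\Sigma\times Q\times Q$, $q_\iota\in Q$ and $\mathrm{Acc}\subseteq Q^\omega$; for a parity tree automaton, $\mathrm{Acc}$ is given by $\alpha:Q\to\{0,\dots,k\}$ and $r\in\mathrm{Acc}$ iff the minimum of $\alpha(q)$ over states $q$ occurring infinitely often in $r$ is even. A run on $t$ is a $Q$-tree $\rho$ with $\rho(\epsilon)=q_\iota$ and $(\rho(u),t(u),\rho(u0),\rho(u1))\in\Delta$ for all $u$; it is qualitatively accepting if $\mu(\{\pi\in\{0,1\}^\omega:\rho(\pi)\in\mathrm{Acc}\})=1$. The qualitative universal language is $\mathcal{L}^{\forall}_{\mathrm{qual}}(\mathcal{A})=\{t:\text{every run of }\mathcal{A}\text{ on }t\text{ is qualitatively accepting}\}$ (in particular trees with no run belong to it). *)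

(* Defs.v *)
From Stdlib Require Import Reals List Arith.
Import ListNotations.

Inductive recf : Type :=
| rZero : recf
| rSucc : recf
| rProj : nat -> recf
| rComp : recf -> list recf -> recf
| rPrim : recf -> recf -> recf
| rMu   : recf -> recf.

Inductive reval : recf -> list nat -> nat -> Prop :=
| ev_zero v : reval rZero v 0
| ev_succ x v : reval rSucc (x :: v) (S x)
| ev_proj i v : i < length v -> reval (rProj i) v (nth i v 0)
| ev_comp f gs v ws y :
    revals gs v ws -> reval f ws y -> reval (rComp f gs) v y
| ev_prim0 f g v y : reval f v y -> reval (rPrim f g) (0 :: v) y
| ev_primS f g n v r y :
    reval (rPrim f g) (n :: v) r -> reval g (n :: r :: v) y ->
    reval (rPrim f g) (S n :: v) y
| ev_mu f v n :
    reval f (n :: v) 0 ->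
    (forall m, m < n -> exists k, reval f (m :: v) (S k)) ->
    reval (rMu f) v n
with revals : list recf -> list nat -> list nat -> Prop :=
| evs_nil v : revals [] v []
| evs_cons g gs v y ys :
    reval g v y -> revals gs v ys -> revals (g :: gs) v (y :: ys).

(* States are 0..pta_nstates-1, letters 0..pta_nletters-1; the transition
   relation Delta is the finite list pta_delta of tuples (q, a, q0, q1);
   pta_prio lists the priorities alpha(0), ..., alpha(nstates-1). *)
Record pta : Type := mkPTA {
  pta_nstates : nat;
  pta_nletters : nat;
  pta_init : nat;
  pta_delta : list (nat * nat * nat * nat);
  pta_prio : list nat
}.

Definition pta_wf (A : pta) : Prop :=
  pta_init A < pta_nstates A /\
  length (pta_prio A) = pta_nstates A /\
  (forall q a q0 q1, In (q, a, q0, q1) (pta_delta A) ->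
     q < pta_nstates A /\ a < pta_nletters A /\
     q0 < pta_nstates A /\ q1 < pta_nstates A).

Definition cpair (x y : nat) : nat := (x + y) * (x + y + 1) / 2 + y.

Fixpoint enc_list (l : list nat) : nat :=
  match l with
  | [] => 0
  | x :: l' => S (cpair x (enc_list l'))
  end.

Definition enc_trans (tr : nat * nat * nat * nat) : nat :=
  let '(q, a, q0, q1) := tr in cpair q (cpair a (cpair q0 q1)).

Definition enc_pta (A : pta) : nat :=
  cpair (pta_nstates A)
    (cpair (pta_nletters A)
      (cpair (pta_init A)
        (cpair (enc_list (map enc_trans (pta_delta A)))
               (enc_list (pta_prio A))))).

(* Nodes of the binary tree are words in {0,1}^* (false = 0, true = 1);
   the children of u are u0 and u1. *)
Definition node := list bool.
Definition branch := nat -> bool.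

Definition bprefix (pi : branch) (n : nat) : node := map pi (seq 0 n).

Definition along {X : Type} (t : node -> X) (pi : branch) : nat -> X :=
  fun n => t (bprefix pi n).

Definition is_tree (A : pta) (t : node -> nat) : Prop :=
  forall u, t u < pta_nletters A.

Definition is_run (A : pta) (t : node -> nat) (rho : node -> nat) : Prop :=
  rho [] = pta_init A /\
  forall u, In (rho u, t u, rho (u ++ [false]), rho (u ++ [true])) (pta_delta A).

Definition prio (A : pta) (q : nat) : nat := nth q (pta_prio A) 0.

Definition inf_often (r : nat -> nat) (q : nat) : Prop :=
  forall N, exists n, N <= n /\ r n = q.

Definition parity_acc (A : pta) (r : nat -> nat) : Prop :=
  exists q, inf_often r q /\ Nat.Even (prio A q) /\
    (forall q', inf_often r q' -> prio A q <= prio A q').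

(* mu-null sets of {0,1}^omega for the coin-flipping measure: for every
   eps > 0, S is covered by countably many cones c_i {0,1}^omega whose
   total measure sum_i 2^{-|c_i|} is at most eps. *)
Definition mu_null (S : branch -> Prop) : Prop :=
  forall eps : R, (0 < eps)%R ->
    exists c : nat -> node,
      (forall pi, S pi -> exists i, bprefix pi (length (c i)) = c i) /\
      (forall N, (fold_right Rplus 0%R
                    (map (fun i => (/ 2) ^ length (c i))%R (seq 0 N)) <= eps)%R).

(* rho is qualitatively accepting iff mu({pi | rho(pi) in Acc}) = 1,
   i.e. iff the (Borel) set of rejecting branches is mu-null. *)
Definition qual_accepting (A : pta) (rho : node -> nat) : Prop :=
  mu_null (fun pi => ~ parity_acc A (along rho pi)).

Definition in_Lqual_univ (A : pta) (t : node -> nat) : Prop :=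
  is_tree A t /\ forall rho, is_run A t rho -> qual_accepting A rho.

Definition Lqual_univ_empty (A : pta) : Prop :=
  ~ exists t, in_Lqual_univ A t.

Definition decides_Lqual_univ_emptiness (f : recf) : Prop :=
  forall A : pta, pta_wf A ->
    (reval f [enc_pta A] 1 /\ Lqual_univ_empty A) \/
    (reval f [enc_pta A] 0 /\ ~ Lqual_univ_empty A).

(* Main.v *)
Require Import Defs.
From Stdlib Require Import Reals List Arith Lia Lra ZArith Bool.
From Stdlib Require Import Classical ClassicalEpsilon FunctionalExtensionality Cantor FinFun.
Import ListNotations.

(** Suppose [f] decides emptiness.  For a program [R] over registers we build a list of transitions
    whose code [x] satisfies: the automaton [A], made of these transitions and of [x + 1] states that
    check that a number is equal to [x], accepts some tree iff [R] halts on input [x].  Since the code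
    of [A] is computable from [x], taking for [R] the program that computes it, runs [f] on it and
    halts iff the answer is 1 gives a contradiction.

    Deterministic runs ending in a rejecting sink force every branch to spell copies of a computation
    of [R], separated by letters 4 or 5; the blocks that end with 5 are called iterations.  What such
    runs cannot check is the values of the registers.  These are tracked by counters that must be at
    most 0 at every check, and that are at least [g] at a wrong one.  The opponent, who chooses the run,
    either watches credit, an event that an iteration with [L] coin letters yields with probability
    [2^-L] and that must happen infinitely often, or plays risk, which must happen finitely often.  For
    risk he guesses one counter per copy and follows it: he pays one coin less each time the counter is
    incremented and one more each time it is decremented, and can stop at a check of that counter; each
    letter 4 costs one more coin.  If every copy is a correct computation, then risk has probability
    [2^-(L+k)] in an iteration of [k+1] copies, and repeating each iteration about [2^L] times makes
    the sum of the credits diverge and the sum of the risks converge.  If no correct computation exists,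
    then every copy contains a wrong check, which gains a factor [2^g], at least twice the number of
    counters; so a guess makes risk at least as probable as credit, and credit infinitely often
    implies risk infinitely often with positive probability. *)

(** * Compiling recursive functions to regular programs over registers *)

(** A qualitative condition only tells probability 1 from less, so two quantities can be compared
    only through divergence or convergence of series; hence the shrinking factor [2^-k] between risk
    and credit, and the many repetitions. The automaton has no coins of its own: a coin is a pair of
    transitions that give two states to the children in either order. Whoever chooses the run gets
    at least the average of the two orders, that is, the effect of a coin independent of the branch;
    in the accepted tree the letters depend on depth only, so the choice brings nothing more.
    Self-reference needs no recursion theorem, because only the counting states depend on [x]: the
    other transitions are fixed first, and [x] is defined as their code. The exponent [g] is the
    price of a guess: averaging over [J] counters divides the guaranteed gain by [J], a letter 4
    halves it, and [2 * J <= 2^g] repays both. Credit can be watched from any node, so in an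
    accepted tree it has probability 1 below every node; this is what allows a single run to force
    risk again and again. *)

Inductive prog (A : Type) : Type :=
| Blk (l : list A)
| Seq (p q : prog A)
| Star (p : prog A).
Arguments Blk {A} l.
Arguments Seq {A} p q.
Arguments Star {A} p.

Inductive star {S : Type} (R : S -> S -> Prop) : S -> S -> Prop :=
| star_refl s : star R s s
| star_step s m s' : R s m -> star R m s' -> star R s s'.

Fixpoint exec {A S : Type} (at_ : A -> S -> S -> Prop) (l : list A) (s s' : S) : Prop :=
  match l with
  | [] => s' = s
  | a :: l' => exists m, at_ a s m /\ exec at_ l' m s'
  end.

(** Relational semantics: a loop may stop at any moment and a failed test relates the state to
    nothing, so a program halts when some sequence of guesses survives every test. The letters 0 and
    1 of the tree will spell these guesses. *)
Fixpoint sem {A S : Type} (at_ : A -> S -> S -> Prop) (p : prog A) (s s' : S) : Prop :=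
  match p with
  | Blk l => exec at_ l s s'
  | Seq p q => exists m, sem at_ p s m /\ sem at_ q m s'
  | Star p => star (sem at_ p) s s'
  end.

Inductive rop : Type := Inc (r : nat) | Dec (r : nat) | Zer (r : nat).

Definition store := nat -> nat.

Definition upd {X : Type} (s : nat -> X) (r : nat) (y : X) : nat -> X :=
  fun x => if Nat.eq_dec x r then y else s x.

Definition rstep (o : rop) (s s' : store) : Prop :=
  match o with
  | Inc r => s' = upd s r (S (s r))
  | Dec r => s r <> 0 /\ s' = upd s r (pred (s r))
  | Zer r => s r = 0 /\ s' = s
  end.

Notation rsem := (sem rstep).

Ltac store_eq :=
  apply functional_extensionality; intro; unfold upd;
  repeat match goal with |- context [Nat.eq_dec ?a ?b] => destruct (Nat.eq_dec a b) end;
  subst; try congruence; try lia; auto.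

Lemma upd_same {X : Type} (s : nat -> X) r y : upd s r y r = y.
Proof. unfold upd. destruct (Nat.eq_dec r r); congruence. Qed.

Lemma upd_other {X : Type} (s : nat -> X) r y x : x <> r -> upd s r y x = s x.
Proof. unfold upd. destruct (Nat.eq_dec x r); congruence. Qed.

Lemma map_upd_notin (s : store) r y l : ~ In r l -> map (upd s r y) l = map s l.
Proof.
  intro H. apply map_ext_in. intros a Ha. apply upd_other. intro; subst; auto.
Qed.

(** * Macros that move, copy and clear registers *)

Definition bump (s : store) (ds : list nat) (k : nat) : store :=
  fun r => if in_dec Nat.eq_dec r ds then s r + k else s r.

(** The final [Zer a] discards every exit from the loop taken before [a] is empty. With [ds] empty
    this clears [a]. *)
Definition drain (a : nat) (ds : list nat) : prog rop :=
  Seq (Star (Blk (Dec a :: map Inc ds))) (Blk [Zer a]).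

Lemma exec_incs ds s s' : NoDup ds -> (exec rstep (map Inc ds) s s' <-> s' = bump s ds 1).
Proof.
  revert s. induction ds as [|d ds IH]; intros s Hn; simpl.
  - split; intro H; rewrite H; unfold bump; simpl; auto.
  - inversion Hn as [|? ? Hd Hn']; subst.
    assert (E : bump (upd s d (S (s d))) ds 1 = bump s (d :: ds) 1).
    { apply functional_extensionality; intro r. unfold bump.
      destruct (in_dec Nat.eq_dec r ds) as [i|n]; destruct (in_dec Nat.eq_dec r (d :: ds)) as [i'|n'].
      - rewrite upd_other; auto. intro; subst; auto.
      - exfalso; apply n'; right; auto.
      - destruct i' as [->|i']; [|contradiction]. rewrite upd_same. lia.
      - rewrite upd_other; auto. intro; subst; apply n'; left; auto. }
    split.
    + intros (m & -> & H). apply IH in H; auto. congruence.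
    + intros ->. exists (upd s d (S (s d))). split; auto. apply IH; auto.
Qed.

Lemma drain_loop_sound a ds s s' : NoDup ds -> ~ In a ds ->
  star (sem rstep (Blk (Dec a :: map Inc ds))) s s' ->
  exists k, k <= s a /\ s' = upd (bump s ds k) a (s a - k).
Proof.
  intros Hn Ha H. induction H as [s|s m s' H1 H2 IH].
  - exists 0. split; [lia|]. apply functional_extensionality; intro r. unfold upd, bump.
    destruct (Nat.eq_dec r a); subst; [lia|]. destruct (in_dec _ _ _); lia.
  - simpl in H1. destruct H1 as (m1 & [Hz ->] & H1). apply exec_incs in H1; auto. subst m.
    destruct IH as (k & Hk & ->).
    assert (E : bump (upd s a (pred (s a))) ds 1 a = pred (s a)).
    { unfold bump. destruct (in_dec _ _ _); [contradiction|]. apply upd_same. }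
    rewrite E in *. exists (S k). split; [lia|].
    apply functional_extensionality; intro r. unfold upd, bump.
    destruct (Nat.eq_dec r a); subst; [lia|]. destruct (in_dec _ _ _); lia.
Qed.

Lemma drain_loop_complete a ds k s : NoDup ds -> ~ In a ds -> k <= s a ->
  star (sem rstep (Blk (Dec a :: map Inc ds))) s (upd (bump s ds k) a (s a - k)).
Proof.
  intros Hn Ha. revert s. induction k as [|k IH]; intros s Hk.
  - replace (upd (bump s ds 0) a (s a - 0)) with s; [constructor|].
    apply functional_extensionality; intro r. unfold upd, bump.
    destruct (Nat.eq_dec r a); subst; [lia|]. destruct (in_dec _ _ _); lia.
  - set (m := bump (upd s a (pred (s a))) ds 1).
    assert (E : m a = pred (s a)).
    { unfold m, bump. destruct (in_dec _ _ _); [contradiction|]. apply upd_same. }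
    apply star_step with m.
    + simpl. exists (upd s a (pred (s a))). split; [split; auto; lia|]. apply exec_incs; auto.
    + replace (upd (bump s ds (S k)) a (s a - S k)) with (upd (bump m ds k) a (m a - k)).
      * apply IH. lia.
      * rewrite E. apply functional_extensionality; intro r. unfold m, upd, bump.
        destruct (Nat.eq_dec r a); subst; [lia|]. destruct (in_dec _ _ _); lia.
Qed.

Lemma drain_spec a ds s s' : NoDup ds -> ~ In a ds ->
  (rsem (drain a ds) s s' <-> s' = upd (bump s ds (s a)) a 0).
Proof.
  intros Hn Ha. unfold drain. cbn [sem]. split.
  - intros (m & H1 & H2). apply drain_loop_sound in H1; auto. destruct H1 as (k & Hk & ->).
    simpl in H2. destruct H2 as (m' & [Hz ->] & ->). rewrite upd_same in Hz.
    replace k with (s a) by lia. rewrite Nat.sub_diag. auto.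
  - intros ->. exists (upd (bump s ds (s a)) a 0). split.
    + rewrite <- (Nat.sub_diag (s a)). apply drain_loop_complete; auto.
    + simpl. eexists; split; eauto. split; auto. apply upd_same.
Qed.

Lemma bump_nil s k : bump s [] k = s.
Proof. reflexivity. Qed.

Lemma bump_one s d k : bump s [d] k = upd s d (s d + k).
Proof.
  apply functional_extensionality; intro r. unfold bump, upd.
  destruct (in_dec Nat.eq_dec r [d]) as [[->|[]]|n].
  - destruct (Nat.eq_dec r r); congruence.
  - destruct (Nat.eq_dec r d); auto. subst. exfalso; apply n; left; auto.
Qed.

Lemma clear_spec a s s' : rsem (drain a []) s s' <-> s' = upd s a 0.
Proof. rewrite drain_spec; [|constructor|auto]. rewrite bump_nil. tauto. Qed.

Lemma move_spec a d s s' : a <> d ->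
  (rsem (drain a [d]) s s' <-> s' = upd (upd s d (s d + s a)) a 0).
Proof.
  intro H. rewrite drain_spec; [|repeat constructor; auto|intros [|[]]; congruence].
  rewrite bump_one. tauto.
Qed.

(** Reading a register destroys it, hence the scratch register [t] from which [a] is restored. *)
Definition copy (a d t : nat) : prog rop := Seq (drain a [d; t]) (drain t [a]).

Lemma copy_spec a d t s s' : a <> d -> a <> t -> d <> t -> s d = 0 -> s t = 0 ->
  (rsem (copy a d t) s s' <-> s' = upd s d (s a)).
Proof.
  intros H1 H2 H3 Hd Ht. unfold copy. cbn [sem].
  assert (E : upd (upd (upd (bump s [d; t] (s a)) a 0) a
     (upd (bump s [d; t] (s a)) a 0 a + upd (bump s [d; t] (s a)) a 0 t)) t 0 = upd s d (s a)).
  { apply functional_extensionality; intro r. unfold upd, bump.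
    repeat match goal with |- context [Nat.eq_dec ?x ?y] => destruct (Nat.eq_dec x y) end;
    repeat match goal with |- context [in_dec ?e ?x ?y] => destruct (in_dec e x y) end;
    subst; simpl in *; try congruence; try lia; exfalso; intuition congruence. }
  split.
  - intros (m & Hm & H). apply drain_spec in Hm.
    2: repeat constructor; simpl; intuition congruence. 2: simpl; intuition congruence.
    subst m. apply move_spec in H; auto. rewrite H, E. auto.
  - intros ->. eexists. split.
    + apply drain_spec; [repeat constructor; simpl; intuition congruence | simpl; intuition congruence | reflexivity].
    + apply move_spec; auto.
Qed.

(** A program without outcome, matching the absence of a value in [reval] when the argument list is
    too short. *)
Definition failp (r : nat) : prog rop := Blk [Inc r; Zer r].

Lemma failp_spec r s s' : ~ rsem (failp r) s s'.
Proof. simpl. intros (m & -> & m' & [H _] & _). rewrite upd_same in H. lia. Qed.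

Fixpoint clears (l : list nat) : prog rop :=
  match l with
  | [] => Blk []
  | r :: l' => Seq (drain r []) (clears l')
  end.

Lemma clears_spec l s s' :
  rsem (clears l) s s' <-> s' = (fun r => if in_dec Nat.eq_dec r l then 0 else s r).
Proof.
  revert s. induction l as [|a l IH]; intro s; cbn [clears sem].
  - simpl. tauto.
  - assert (E : (fun r => if in_dec Nat.eq_dec r l then 0 else upd s a 0 r)
              = (fun r => if in_dec Nat.eq_dec r (a :: l) then 0 else s r)).
    { apply functional_extensionality; intro r. unfold upd.
      destruct (in_dec Nat.eq_dec r l), (in_dec Nat.eq_dec r (a :: l)), (Nat.eq_dec r a);
      subst; auto; simpl in *; exfalso; intuition congruence. }
    split.
    + intros (m & H1 & H2). apply clear_spec in H1. subst m. apply IH in H2. congruence.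
    + intros ->. exists (upd s a 0). split; [apply clear_spec; auto|]. apply IH. auto.
Qed.

(** Convention: arguments are read from [ins] and preserved, the result goes to [out], which is 0 on
    entry, and registers from [b] on are scratch, 0 on entry and again on exit. Each loop is
    followed by a [Zer] that forbids leaving it too early. *)
Fixpoint compile (f : recf) (ins : list nat) (out b : nat) {struct f} : prog rop :=
  match f with
  | rZero => Blk []
  | rSucc => match ins with [] => failp b | i :: _ => Seq (copy i out b) (Blk [Inc out]) end
  | rProj i => if i <? length ins then copy (nth i ins 0) out b else failp b
  | rComp f gs =>
      let m := length gs in
      Seq ((fix go (gs : list recf) (k : nat) : prog rop :=
              match gs with
              | [] => Blk []
              | g :: gs' => Seq (compile g ins k (b + m)) (go gs' (S k))
              end) gs b)
          (Seq (compile f (seq b m) out (b + m)) (clears (seq b m)))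
  | rPrim f g =>
      match ins with
      | [] => failp b
      | n :: vs =>
          Seq (copy n b (b + 1))
         (Seq (compile f vs (b + 2) (b + 4))
         (Seq (Star (Seq (Blk [Dec b])
                    (Seq (compile g (b + 1 :: b + 2 :: vs) (b + 3) (b + 4))
                    (Seq (drain (b + 2) [])
                    (Seq (drain (b + 3) [b + 2])
                         (Blk [Inc (b + 1)]))))))
         (Seq (Blk [Zer b])
         (Seq (drain (b + 1) []) (drain (b + 2) [out])))))
      end
  | rMu f =>
      Seq (compile f (b :: ins) (b + 1) (b + 2))
     (Seq (Star (Seq (Blk [Dec (b + 1)])
                (Seq (drain (b + 1) [])
                (Seq (Blk [Inc b])
                     (compile f (b :: ins) (b + 1) (b + 2))))))
     (Seq (Blk [Zer (b + 1)]) (drain b [out])))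
  end.

Section RecfInd.
  Variable P : recf -> Prop.
  Hypothesis HP0 : P rZero.
  Hypothesis HP1 : P rSucc.
  Hypothesis HP2 : forall i, P (rProj i).
  Hypothesis HP3 : forall f gs, P f -> Forall P gs -> P (rComp f gs).
  Hypothesis HP4 : forall f g, P f -> P g -> P (rPrim f g).
  Hypothesis HP5 : forall f, P f -> P (rMu f).
  (** Composition needs an induction hypothesis for every member of the list inside [rComp], hence
      the nested fixpoint. *)
  Fixpoint recf_nested_ind (f : recf) : P f :=
    match f with
    | rZero => HP0
    | rSucc => HP1
    | rProj i => HP2 i
    | rComp f gs => HP3 f gs (recf_nested_ind f)
        ((fix go gs : Forall P gs :=
            match gs with
            | [] => Forall_nil _
            | g :: gs' => Forall_cons _ (recf_nested_ind g) (go gs')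
            end) gs)
    | rPrim f g => HP4 f g (recf_nested_ind f) (recf_nested_ind g)
    | rMu f => HP5 f (recf_nested_ind f)
    end.
End RecfInd.

(** An equivalence, because divergence must be preserved too: a program without outcome is what
    makes the language empty. The form [upd s out y] of the final store also says that arguments
    survive and scratch registers are clean, on which nested calls rely. *)
Definition comp_correct (f : recf) : Prop :=
  forall ins out b (s s' : store),
    (forall r, b <= r -> s r = 0) -> (forall i, In i ins -> i < b) ->
    out < b -> ~ In out ins -> s out = 0 ->
    (rsem (compile f ins out b) s s' <-> exists y, reval f (map s ins) y /\ s' = upd s out y).

Lemma comp_zero : comp_correct rZero.
Proof.
  intros ins out b s s' Hb Hi Ho Hn Hz. simpl. split.
  - intros ->. exists 0. split; [constructor|]. store_eq.
  - intros (y & H & ->). inversion H; subst. store_eq.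
Qed.

Lemma comp_succ : comp_correct rSucc.
Proof.
  intros ins out b s s' Hb Hi Ho Hn Hz. cbn [compile]. destruct ins as [|i ins].
  - split; [intro H; exfalso; eapply failp_spec; eauto|].
    intros (y & H & _). inversion H.
  - assert (i < b) by (apply Hi; left; auto).
    assert (i <> out) by (intro; subst; apply Hn; left; auto).
    assert (s b = 0) by (apply Hb; lia).
    cbn [sem]. split.
    + intros (m & K1 & K2). apply copy_spec in K1; try lia. subst m.
      simpl in K2. destruct K2 as (m & -> & ->).
      exists (S (s i)). split; [constructor|]. rewrite upd_same. store_eq.
    + intros (y & K1 & ->). inversion K1; subst. eexists. split.
      * apply copy_spec; try lia. reflexivity.
      * simpl. eexists; split; [reflexivity|]. rewrite upd_same. store_eq.
Qed.

Lemma comp_proj i : comp_correct (rProj i).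
Proof.
  intros ins out b s s' Hb Hi Ho Hn Hz. cbn [compile].
  destruct (Nat.ltb_spec i (length ins)).
  - assert (I : In (nth i ins 0) ins) by (apply nth_In; auto).
    assert (nth i ins 0 < b) by auto.
    assert (nth i ins 0 <> out) by (intro E; rewrite E in I; auto).
    assert (s b = 0) by (apply Hb; lia).
    assert (E : nth i (map s ins) 0 = s (nth i ins 0)).
    { rewrite nth_indep with (d' := s 0); [apply map_nth|rewrite length_map; auto]. }
    rewrite copy_spec; try lia. rewrite <- E. split.
    + intros ->. exists (nth i (map s ins) 0). split; auto. constructor. rewrite length_map; auto.
    + intros (y & Hr & ->). inversion Hr; subst. auto.
  - split; [intro K; exfalso; eapply failp_spec; eauto|].
    intros (y & K & _). inversion K; subst. rewrite length_map in *. lia.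
Qed.

Definition put (s : store) (k : nat) (ws : list nat) : store :=
  fun r => if k <=? r then if r <? k + length ws then nth (r - k) ws 0 else s r else s r.

Lemma put_cons s k y ws : put (upd s k y) (S k) ws = put s k (y :: ws).
Proof.
  apply functional_extensionality; intro r. unfold put, upd. simpl length.
  destruct (Nat.eq_dec r k).
  - subst. destruct (Nat.leb_spec (S k) k); [lia|]. destruct (Nat.leb_spec k k); [|lia].
    destruct (Nat.ltb_spec k (k + S (length ws))); [|lia]. rewrite Nat.sub_diag. auto.
  - destruct (Nat.leb_spec (S k) r), (Nat.leb_spec k r); try lia.
    destruct (Nat.ltb_spec r (S k + length ws)), (Nat.ltb_spec r (k + S (length ws))); try lia.
    replace (r - k) with (S (r - S k)) by lia. auto.
Qed.

Lemma map_put_seq s k ws : map (put s k ws) (seq k (length ws)) = ws.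
Proof.
  apply nth_ext with (d := 0) (d' := 0); rewrite length_map, length_seq; auto.
  intros n Hn. rewrite nth_indep with (d' := put s k ws 0) by (rewrite length_map, length_seq; auto).
  rewrite map_nth, seq_nth; auto. unfold put.
  destruct (Nat.leb_spec k (k + n)); [|lia].
  destruct (Nat.ltb_spec (k + n) (k + length ws)); [|lia]. f_equal. lia.
Qed.

Lemma put_below s k ws r : r < k -> put s k ws r = s r.
Proof. intro. unfold put. destruct (Nat.leb_spec k r); auto; lia. Qed.

Lemma put_above s k ws r : k + length ws <= r -> put s k ws r = s r.
Proof.
  intro. unfold put. destruct (Nat.leb_spec k r); auto.
  destruct (Nat.ltb_spec r (k + length ws)); auto; lia.
Qed.

(** The local fixpoint is repeated so that it matches the one inside [compile]. Results are stored
    from [k] on, below the scratch boundary [b'], so later arguments do not disturb earlier ones. *)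
Lemma comp_args gs ins b' : Forall comp_correct gs -> forall k (s s' : store),
    k + length gs <= b' -> (forall r, k <= r -> s r = 0) -> (forall i, In i ins -> i < k) ->
    (rsem ((fix go (gs : list recf) (k : nat) : prog rop :=
              match gs with
              | [] => Blk []
              | g :: gs' => Seq (compile g ins k b') (go gs' (S k))
              end) gs k) s s'
     <-> exists ws, revals gs (map s ins) ws /\ s' = put s k ws).
Proof.
  induction 1 as [|g gs Hg Hgs IH]; intros k s s' Hk Hz Hi.
  - simpl. assert (E : put s k [] = s).
    { apply functional_extensionality; intro r. unfold put. simpl.
      destruct (Nat.leb_spec k r); auto. destruct (Nat.ltb_spec r (k + 0)); auto; lia. }
    split.
    + intros ->. exists []. split; [constructor|]. auto.
    + intros (ws & H & ->). inversion H; subst. auto.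
  - cbn [sem]. simpl in Hk.
    assert (Hc : forall m, rsem (compile g ins k b') s m <->
                 exists y, reval g (map s ins) y /\ m = upd s k y).
    { intro m. apply Hg; auto; try lia.
      - intros r Hr. apply Hz; lia.
      - intros i I. apply Hi in I. lia.
      - intro I. apply Hi in I. lia. }
    assert (Hm : forall y, map (upd s k y) ins = map s ins).
    { intro y. apply map_upd_notin. intro I. apply Hi in I. lia. }
    assert (Hz' : forall y r, S k <= r -> upd s k y r = 0).
    { intros y r Hr. rewrite upd_other by lia. apply Hz; lia. }
    assert (Hi' : forall i, In i ins -> i < S k) by (intros i I; apply Hi in I; lia).
    split.
    + intros (m & H1 & H2). apply Hc in H1. destruct H1 as (y & H1 & ->).
      apply IH in H2; try lia; auto.
      destruct H2 as (ws & H2 & ->). rewrite Hm in H2.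
      exists (y :: ws). split; [constructor; auto|]. apply put_cons.
    + intros (ws & H & ->). inversion H; subst.
      exists (upd s k y). split; [apply Hc; eauto|].
      apply IH; try lia; auto. exists ys. rewrite Hm. split; auto. symmetry; apply put_cons.
Qed.

Lemma revals_length gs v ws : revals gs v ws -> length ws = length gs.
Proof. induction 1; simpl; auto. Qed.

Lemma comp_comp f gs : comp_correct f -> Forall comp_correct gs -> comp_correct (rComp f gs).
Proof.
  intros Hf Hgs ins out b s s' Hb Hi Ho Hn Hz. cbn [compile sem].
  assert (Hfin : forall ws, length ws = length gs -> forall m',
    (exists m, rsem (compile f (seq b (length gs)) out (b + length gs)) (put s b ws) m /\
      rsem (clears (seq b (length gs))) m m') <->
    exists y, reval f ws y /\ m' = upd s out y).
  { intros ws Hl m'.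
    assert (Hc : forall m, rsem (compile f (seq b (length gs)) out (b + length gs)) (put s b ws) m <->
                 exists y, reval f ws y /\ m = upd (put s b ws) out y).
    { intro m. assert (Ew : map (put s b ws) (seq b (length gs)) = ws) by (rewrite <- Hl; apply map_put_seq).
      rewrite (Hf (seq b (length gs)) out (b + length gs)); [rewrite Ew; tauto|..].
      - intros r Hr. rewrite put_above by lia. apply Hb; lia.
      - intros i I. apply in_seq in I. lia.
      - lia.
      - rewrite in_seq. lia.
      - rewrite put_below; auto. }
    assert (E : forall y, (fun r => if in_dec Nat.eq_dec r (seq b (length gs)) then 0
                    else upd (put s b ws) out y r) = upd s out y).
    { intro y. apply functional_extensionality; intro r. unfold upd.
      destruct (in_dec Nat.eq_dec r (seq b (length gs))) as [i|n]; rewrite in_seq in *;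
        destruct (Nat.eq_dec r out); try lia.
      - symmetry. apply Hb. lia.
      - destruct (Nat.lt_ge_cases r b); [apply put_below; auto|]. apply put_above. lia. }
    split.
    - intros (m & H1 & H2). apply Hc in H1. destruct H1 as (y & H1 & ->).
      apply clears_spec in H2. rewrite E in H2. eauto.
    - intros (y & H1 & ->). exists (upd (put s b ws) out y). split; [apply Hc; eauto|].
      apply clears_spec. auto. }
  split.
  - intros (m & H1 & H2). apply comp_args in H1; auto.
    destruct H1 as (ws & H1 & ->). apply Hfin in H2; [|eapply revals_length; eauto].
    destruct H2 as (y & H2 & ->). exists y. split; auto. econstructor; eauto.
  - intros (y & H & ->). inversion H; subst. exists (put s b ws). split.
    + apply comp_args; auto. eauto.
    + apply Hfin; [eapply revals_length; eauto|]. eauto.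
Qed.

Lemma star_trans {S : Type} (R : S -> S -> Prop) a b c : star R a b -> star R b c -> star R a c.
Proof. induction 1; auto. intro. econstructor; eauto. Qed.

Lemma star_snoc {S : Type} (R : S -> S -> Prop) a b c : star R a b -> R b c -> star R a c.
Proof. intros. eapply star_trans; eauto. econstructor; eauto. constructor. Qed.

(** Stores at the head of the loop: [b] holds the rounds left, [b + 1] the index, [b + 2] the value
    of the recursion at that index. Register [b + 3] is only used inside a round, for the next
    value. *)
Definition prim_state (s : store) (b c i a : nat) : store :=
  upd (upd (upd s b c) (b + 1) i) (b + 2) a.

Definition prim_body (g : recf) (vs : list nat) (b : nat) : prog rop :=
  Seq (Blk [Dec b])
    (Seq (compile g (b + 1 :: b + 2 :: vs) (b + 3) (b + 4))
    (Seq (drain (b + 2) [])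
    (Seq (drain (b + 3) [b + 2])
         (Blk [Inc (b + 1)])))).

Lemma prim_body_spec g vs b (s m : store) c i a : comp_correct g ->
  (forall r, b <= r -> s r = 0) -> (forall x, In x vs -> x < b) ->
  (rsem (prim_body g vs b) (prim_state s b c i a) m <->
   c <> 0 /\ exists a', reval g (i :: a :: map s vs) a' /\ m = prim_state s b (pred c) (S i) a').
Proof.
  intros Hg Hz Hv. unfold prim_body. cbn [sem].
  set (s1 := prim_state s b (pred c) i a).
  assert (E1 : forall m', exec rstep [Dec b] (prim_state s b c i a) m' <-> c <> 0 /\ m' = s1).
  { intro m'. simpl. assert (Eb : prim_state s b c i a b = c).
    { unfold prim_state. rewrite !upd_other by lia. apply upd_same. }
    rewrite Eb.
    assert (E : upd (prim_state s b c i a) b (pred c) = s1) by (unfold s1, prim_state; store_eq).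
    split.
    - intros (m1 & [H ->] & ->). auto.
    - intros [H ->]. exists s1. rewrite E. auto. }
  assert (Em : map s1 (b + 1 :: b + 2 :: vs) = i :: a :: map s vs).
  { unfold s1, prim_state. simpl. f_equal; [rewrite upd_other by lia; apply upd_same|].
    f_equal; [apply upd_same|]. rewrite !map_upd_notin; auto; intro I; apply Hv in I; lia. }
  assert (E2 : forall m', rsem (compile g (b + 1 :: b + 2 :: vs) (b + 3) (b + 4)) s1 m' <->
     exists a', reval g (i :: a :: map s vs) a' /\ m' = upd s1 (b + 3) a').
  { intro m'. rewrite <- Em. apply Hg.
    - intros r Hr. unfold s1, prim_state. rewrite !upd_other by lia. apply Hz; lia.
    - simpl. intros x [<-|[<-|I]]; try lia. apply Hv in I. lia.
    - lia.
    - simpl. intros [I|[I|I]]; try lia. apply Hv in I. lia.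
    - unfold s1, prim_state. rewrite !upd_other by lia. apply Hz; lia. }
  assert (E3 : forall a', upd (upd (upd (upd s1 (b + 3) a') (b + 2) 0) (b + 2)
      (upd (upd s1 (b + 3) a') (b + 2) 0 (b + 2) + upd (upd s1 (b + 3) a') (b + 2) 0 (b + 3))) (b + 3) 0
      = prim_state s b (pred c) i a').
  { intro a'. rewrite upd_same, upd_other, upd_same by lia. unfold s1, prim_state.
    store_eq. symmetry. apply Hz. lia. }
  assert (E4 : forall a', upd (prim_state s b (pred c) i a') (b + 1) (S (prim_state s b (pred c) i a' (b + 1)))
      = prim_state s b (pred c) (S i) a').
  { intro a'. unfold prim_state. rewrite (upd_other _ (b + 2)), upd_same by lia. store_eq. }
  split.
  - intros (m1 & H1 & m2 & H2 & m3 & H3 & m4 & H4 & H5).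
    apply E1 in H1. destruct H1 as [Hc ->]. apply E2 in H2. destruct H2 as (a' & H2 & ->).
    apply clear_spec in H3. subst m3. apply move_spec in H4; [|lia]. rewrite E3 in H4. subst m4.
    simpl in H5. destruct H5 as (m5 & -> & ->). split; auto. exists a'. split; auto.
  - intros (Hc & a' & H & ->). exists s1. split; [apply E1; auto|].
    exists (upd s1 (b + 3) a'). split; [apply E2; eauto|].
    eexists. split; [apply clear_spec; reflexivity|].
    exists (prim_state s b (pred c) i a'). split; [apply move_spec; [lia|rewrite E3; auto]|].
    simpl. eexists. split; [reflexivity|]. auto.
Qed.

Lemma comp_prim f g : comp_correct f -> comp_correct g -> comp_correct (rPrim f g).
Proof.
  intros Hf Hg ins out b s s' Hz Hi Ho Hn Hout. cbn [compile]. destruct ins as [|n vs].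
  { split; [intro H; exfalso; eapply failp_spec; eauto|]. intros (y & H & _). inversion H. }
  fold (prim_body g vs b). set (v := map s vs).
  assert (Hnb : n < b) by (apply Hi; left; auto).
  assert (Hvs : forall x, In x vs -> x < b) by (intros; apply Hi; right; auto).
  assert (Hbody : forall c i a m, rsem (prim_body g vs b) (prim_state s b c i a) m <->
     c <> 0 /\ exists a', reval g (i :: a :: v) a' /\ m = prim_state s b (pred c) (S i) a').
  { intros. apply prim_body_spec; auto. }
  assert (Hc1 : forall m, rsem (copy n b (b + 1)) s m <-> m = upd s b (s n)).
  { intro m. apply copy_spec; try lia; apply Hz; lia. }
  assert (Hm : map (upd s b (s n)) vs = v).
  { apply map_upd_notin. intro I; apply Hvs in I; lia. }
  assert (Hc2 : forall m, rsem (compile f vs (b + 2) (b + 4)) (upd s b (s n)) m <->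
     exists a, reval f v a /\ m = prim_state s b (s n) 0 a).
  { intro m. rewrite <- Hm. rewrite (Hf vs (b + 2) (b + 4)).
    - assert (E : forall a, upd (upd s b (s n)) (b + 2) a = prim_state s b (s n) 0 a).
      { intro a. unfold prim_state. store_eq. apply Hz; lia. }
      split; intros (a & Ha & ->); exists a; split; auto.
    - intros r Hr. rewrite upd_other by lia. apply Hz; lia.
    - intros x I. apply Hvs in I. lia.
    - lia.
    - intro I; apply Hvs in I; lia.
    - rewrite upd_other by lia. apply Hz; lia. }
  assert (Hend : forall c i a m,
     (exists m1, exec rstep [Zer b] (prim_state s b c i a) m1 /\
      exists m2, rsem (drain (b + 1) []) m1 m2 /\ rsem (drain (b + 2) [out]) m2 m) <->
     c = 0 /\ m = upd s out a).
  { intros c i a m.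
    assert (Eb : prim_state s b c i a b = c).
    { unfold prim_state. rewrite !upd_other by lia. apply upd_same. }
    assert (E : upd (upd (upd (prim_state s b 0 i a) (b + 1) 0) out
        (upd (prim_state s b 0 i a) (b + 1) 0 out + upd (prim_state s b 0 i a) (b + 1) 0 (b + 2))) (b + 2) 0
        = upd s out a).
    { unfold prim_state. rewrite !(upd_other _ (b + 1) 0) by lia. rewrite upd_same.
      rewrite !upd_other with (x := out) by lia. rewrite Hout.
      store_eq; symmetry; apply Hz; lia. }
    split.
    - intros (m1 & (m0 & [H0 ->] & ->) & m2 & H2 & H3). rewrite Eb in H0. subst c.
      apply clear_spec in H2. subst m2. apply move_spec in H3; [|lia]. rewrite E in H3. auto.
    - intros [-> ->]. exists (prim_state s b 0 i a). split.
      + exists (prim_state s b 0 i a). split; [split; auto|]. reflexivity.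
      + eexists. split; [apply clear_spec; reflexivity|]. apply move_spec; [lia|]. auto. }
  cbn [sem]. split.
  - intros (m1 & H1 & m2 & H2 & m3 & H3 & H4).
    apply Hc1 in H1. subst m1. apply Hc2 in H2. destruct H2 as (a0 & H2 & ->).
    (* Index plus rounds left stays constant along the loop; when [Zer b] finally succeeds no round
       is left, so the index is [s n]. *)
    assert (Inv : forall c i a m, star (rsem (prim_body g vs b)) (prim_state s b c i a) m ->
       reval (rPrim f g) (i :: v) a ->
       exists c' i' a', m = prim_state s b c' i' a' /\ i + c = i' + c' /\ reval (rPrim f g) (i' :: v) a').
    { intros c i a m H. remember (prim_state s b c i a) as p eqn:Ep. revert c i a Ep.
      induction H as [p|p q m Hpq Hq IH]; intros c i a -> Hr.
      - exists c, i, a. auto.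
      - apply Hbody in Hpq. destruct Hpq as (Hc & a' & Ha & ->).
        destruct (IH (pred c) (S i) a') as (c' & i' & a'' & E & E' & E'').
        + auto.
        + econstructor; eauto.
        + exists c', i', a''. repeat split; auto. lia. }
    destruct (Inv _ _ _ _ H3) as (c' & i' & a' & -> & E & Hr); [constructor; auto|].
    apply Hend in H4. destruct H4 as [-> ->]. exists a'. split; auto.
    simpl. replace (s n) with i' by lia. auto.
  - intros (y & H & ->).
    assert (Cmp : forall k y, reval (rPrim f g) (k :: v) y -> exists a0, reval f v a0 /\
       forall c, star (rsem (prim_body g vs b)) (prim_state s b (k + c) 0 a0) (prim_state s b c k y)).
    { induction k as [|k IH]; intros y' Hy; inversion Hy; subst.
      - exists y'. split; auto. intro; constructor.
      - match goal with Hr : reval (rPrim f g) _ _ |- _ => destruct (IH _ Hr) as (a0 & Ha0 & Hs) end. exists a0. split; auto. intro c.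
        eapply star_snoc; [replace (S k + c) with (k + S c) by lia; apply Hs|].
        apply Hbody. split; [lia|]. exists y'. split; auto. }
    destruct (Cmp _ _ H) as (a0 & Ha0 & Hs). specialize (Hs 0). rewrite Nat.add_0_r in Hs.
    exists (upd s b (s n)). split; [apply Hc1; auto|].
    exists (prim_state s b (s n) 0 a0). split; [apply Hc2; eauto|].
    exists (prim_state s b 0 (s n) y). split; [exact Hs|]. apply Hend. auto.
Qed.

(** Stores at the head of the search: candidate [i] in [b], and the value of the function at it in
    [b + 1]. *)
Definition mu_state (s : store) (b i x : nat) : store := upd (upd s b i) (b + 1) x.

Definition mu_body (f : recf) (ins : list nat) (b : nat) : prog rop :=
  Seq (Blk [Dec (b + 1)])
    (Seq (drain (b + 1) [])
    (Seq (Blk [Inc b])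
         (compile f (b :: ins) (b + 1) (b + 2)))).

Lemma comp_mu f : comp_correct f -> comp_correct (rMu f).
Proof.
  intros Hf ins out b s s' Hz Hi Ho Hn Hout. cbn [compile].
  fold (mu_body f ins b). set (v := map s ins).
  assert (Hc : forall i m, rsem (compile f (b :: ins) (b + 1) (b + 2)) (mu_state s b i 0) m <->
     exists x, reval f (i :: v) x /\ m = mu_state s b i x).
  { intros i m. replace (i :: v) with (map (mu_state s b i 0) (b :: ins)).
    - rewrite (Hf (b :: ins) (b + 1) (b + 2)).
      + assert (E : forall x, upd (mu_state s b i 0) (b + 1) x = mu_state s b i x).
        { intro x. unfold mu_state. store_eq. }
        split; intros (x & Hx & ->); exists x; split; auto.
      + intros r Hr. unfold mu_state. rewrite !upd_other by lia. apply Hz; lia.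
      + intros x [<-|I]; [lia|]. apply Hi in I. lia.
      + lia.
      + simpl. intros [I|I]; [lia|]. apply Hi in I. lia.
      + apply upd_same.
    - unfold mu_state. simpl. f_equal; [rewrite upd_other by lia; apply upd_same|].
      rewrite !map_upd_notin; auto; intro I; apply Hi in I; lia. }
  assert (Hbody : forall i x m, rsem (mu_body f ins b) (mu_state s b i x) m <->
     x <> 0 /\ exists x', reval f (S i :: v) x' /\ m = mu_state s b (S i) x').
  { intros i x m. unfold mu_body. cbn [sem].
    assert (E0 : mu_state s b i x (b + 1) = x) by apply upd_same.
    assert (E1 : upd (upd (mu_state s b i x) (b + 1) (pred x)) (b + 1) 0 = mu_state s b i 0)
      by (unfold mu_state; store_eq).
    assert (E2 : upd (mu_state s b i 0) b (S (mu_state s b i 0 b)) = mu_state s b (S i) 0).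
    { unfold mu_state. rewrite (upd_other _ (b + 1) 0 b), upd_same by lia. store_eq. }
    split.
    - intros (m1 & (m0 & [H0 ->] & ->) & m2 & H2 & m3 & (m4 & -> & ->) & H3). rewrite E0 in *.
      apply clear_spec in H2. rewrite E1 in H2. subst m2. rewrite E2 in H3. split; auto.
      apply Hc; auto.
    - intros [Hx H]. eexists. split; [simpl; eexists; split; [split; [rewrite E0; auto|reflexivity]|reflexivity]|].
      exists (mu_state s b i 0). split; [apply clear_spec; rewrite E0; auto|].
      exists (mu_state s b (S i) 0). split; [simpl; eexists; split; [reflexivity|auto]|]. apply Hc; auto. }
  assert (E0 : mu_state s b 0 0 = s).
  { unfold mu_state. store_eq; symmetry; apply Hz; lia. }
  assert (Hend : forall i x m,
     (exists m1, exec rstep [Zer (b + 1)] (mu_state s b i x) m1 /\ rsem (drain b [out]) m1 m) <->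
     x = 0 /\ m = upd s out i).
  { intros i x m. assert (E1 : mu_state s b i x (b + 1) = x) by apply upd_same.
    assert (E : upd (upd (mu_state s b i 0) out
        (mu_state s b i 0 out + mu_state s b i 0 b)) b 0 = upd s out i).
    { unfold mu_state. rewrite !(upd_other _ (b + 1) 0) by lia. rewrite upd_same.
      rewrite (upd_other _ b) by lia. rewrite Hout.
      store_eq; symmetry; apply Hz; lia. }
    split.
    - intros (m1 & (m0 & [H0 ->] & ->) & H2). rewrite E1 in H0. subst x.
      apply move_spec in H2; [|lia]. rewrite E in H2. auto.
    - intros [-> ->]. exists (mu_state s b i 0). split.
      + exists (mu_state s b i 0). split; [split; auto|]. reflexivity.
      + apply move_spec; [lia|]. auto. }
  cbn [sem]. split.
  - intros (m1 & H1 & m2 & H2 & H3). rewrite <- E0 in H1. apply Hc in H1.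
    destruct H1 as (x0 & H1 & ->).
    (* A round begins with [Dec (b + 1)], which certifies that the value at the current candidate is
       a successor; so every smaller candidate has been refuted when the loop is left. *)
    assert (Inv : forall i x m, star (rsem (mu_body f ins b)) (mu_state s b i x) m ->
       reval f (i :: v) x -> (forall j, j < i -> exists k, reval f (j :: v) (S k)) ->
       exists i' x', m = mu_state s b i' x' /\ reval f (i' :: v) x' /\
         (forall j, j < i' -> exists k, reval f (j :: v) (S k))).
    { intros i x m H. remember (mu_state s b i x) as p eqn:Ep. revert i x Ep.
      induction H as [p|p q m Hpq Hq IH]; intros i x -> Hr Hj.
      - exists i, x. auto.
      - apply Hbody in Hpq. destruct Hpq as (Hx & x' & Hx' & ->).
        apply (IH (S i) x'); auto. intros j Hlt.
        destruct (Nat.eq_dec j i) as [->|]; [|apply Hj; lia].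
        exists (pred x). rewrite Nat.succ_pred; auto. }
    destruct (Inv _ _ _ H2 H1) as (i' & x' & -> & Hr & Hj); [lia|].
    apply Hend in H3. destruct H3 as [-> ->]. exists i'. split; auto. constructor; auto.
  - intros (y & H & ->). inversion H as [| | | | | |f' v' n' Hy0 Hlt]; subst. fold v in Hy0, Hlt.
    assert (Cmp : forall d i, i + d = y -> exists x, reval f (i :: v) x /\
       star (rsem (mu_body f ins b)) (mu_state s b i x) (mu_state s b y 0)).
    { induction d as [|d IH]; intros i Hd.
      - exists 0. replace i with y by lia. split; auto. constructor.
      - destruct (IH (S i)) as (x' & Hx' & Hs); [lia|].
        destruct (Hlt i) as (k & Hk); [lia|]. exists (S k). split; auto.
        eapply star_step; [apply Hbody|exact Hs]. split; auto. eauto. }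
    destruct (Cmp y 0) as (x & Hx & Hs); auto.
    exists (mu_state s b 0 x). split; [rewrite <- E0 at 1; apply Hc; eauto|].
    exists (mu_state s b y 0). split; auto. apply Hend. auto.
Qed.

Theorem comp_spec f : comp_correct f.
Proof.
  induction f using recf_nested_ind.
  - apply comp_zero.
  - apply comp_succ.
  - apply comp_proj.
  - apply comp_comp; auto.
  - apply comp_prim; auto.
  - apply comp_mu; auto.
Qed.

(** * Counter acts and stack control *)

Ltac letters a := destruct a as [|[|[|[|[|[|]]]]]].

Inductive act : Type := Up (j : nat) | Dn (j : nat) | Chk (j : nat).

Definition counters := nat -> Z.

(** The threshold is a parameter because it differs in the two directions: the honest tree passes
    every check with threshold 1, that is [v j <= 0], whereas a false tree is only known to contain
    a check at which some counter is at least [g]. *)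
Definition astep (th : Z) (a : act) (v v' : counters) : Prop :=
  match a with
  | Up j => v' = upd v j (v j + 1)%Z
  | Dn j => v' = upd v j (v j - 1)%Z
  | Chk j => (v j < th)%Z /\ v' = v
  end.

(* Counter [2 c] holds [g] times register [c] and counter [2 c + 1] its opposite, so that every check is
   a test [<= 0]: a wrong [Zer] shows as [2 c] being at least [g], a wrong [Dec] as [2 c + 1] being [g]. *)
Definition expand_op (g : nat) (o : rop) : list act :=
  match o with
  | Inc c => repeat (Up (2 * c)) g ++ repeat (Dn (2 * c + 1)) g
  | Dec c => repeat (Dn (2 * c)) g ++ repeat (Up (2 * c + 1)) g ++ [Chk (2 * c + 1)]
  | Zer c => [Chk (2 * c)]
  end.

Fixpoint expand (g : nat) (p : prog rop) : prog act :=
  match p with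
  | Blk l => Blk (flat_map (expand_op g) l)
  | Seq p q => Seq (expand g p) (expand g q)
  | Star p => Star (expand g p)
  end.

Definition emb (g : nat) (s : store) : nat -> Z :=
  fun j => if Nat.even j then Z.of_nat (g * s (j / 2)) else (- Z.of_nat (g * s (j / 2)%nat))%Z.

Lemma emb_even g s c : emb g s (2 * c) = Z.of_nat (g * s c).
Proof.
  unfold emb. rewrite Nat.even_mul, (Nat.mul_comm 2 c), Nat.div_mul by lia. reflexivity.
Qed.

Lemma emb_odd g s c : emb g s (2 * c + 1) = (- Z.of_nat (g * s c))%Z.
Proof.
  unfold emb. rewrite Nat.add_1_r, Nat.even_succ, <- Nat.negb_even, Nat.even_mul. simpl negb.
  replace (S (2 * c)) with (1 + c * 2) by lia. rewrite Nat.div_add by lia. reflexivity.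
Qed.

Lemma emb_upd g s c y :
  emb g (upd s c y) = upd (upd (emb g s) (2 * c) (Z.of_nat (g * y))) (2 * c + 1) (- Z.of_nat (g * y))%Z.
Proof.
  apply functional_extensionality; intro j.
  destruct (Nat.Even_or_Odd j) as [[k ->]|[k ->]].
  - rewrite emb_even. unfold upd.
    destruct (Nat.eq_dec k c), (Nat.eq_dec (2 * k) (2 * c + 1)), (Nat.eq_dec (2 * k) (2 * c));
      try lia. rewrite emb_even. auto.
  - rewrite emb_odd. unfold upd.
    destruct (Nat.eq_dec k c), (Nat.eq_dec (2 * k + 1) (2 * c + 1)), (Nat.eq_dec (2 * k + 1) (2 * c));
      try lia. rewrite emb_odd. auto.
Qed.

Lemma exec_app {A S : Type} (at_ : A -> S -> S -> Prop) l1 l2 s s' :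
  exec at_ (l1 ++ l2) s s' <-> exists m, exec at_ l1 s m /\ exec at_ l2 m s'.
Proof.
  revert s. induction l1 as [|a l1 IH]; intro s; simpl.
  - split; [intro H; exists s; auto|]. intros (m & -> & H); auto.
  - split.
    + intros (m & H1 & H2). apply IH in H2. destruct H2 as (m' & H2 & H3). eauto.
    + intros (m & (m' & H1 & H2) & H3). exists m'. split; auto. apply IH. eauto.
Qed.

Lemma exec_up th j n v v' : exec (astep th) (repeat (Up j) n) v v' <-> v' = upd v j (v j + Z.of_nat n)%Z.
Proof.
  revert v. induction n as [|n IH]; intro v; cbn [repeat exec].
  - replace (upd v j (v j + Z.of_nat 0)%Z) with v; [tauto|]. store_eq.
  - assert (E : upd (upd v j (v j + 1)%Z) j (upd v j (v j + 1)%Z j + Z.of_nat n)%Z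
              = upd v j (v j + Z.of_nat (S n))%Z) by (rewrite upd_same; store_eq).
    split.
    + intros (m & -> & H). apply IH in H. rewrite H, E. auto.
    + intros ->. eexists. split; [reflexivity|]. apply IH. auto.
Qed.

Lemma exec_dn th j n v v' : exec (astep th) (repeat (Dn j) n) v v' <-> v' = upd v j (v j - Z.of_nat n)%Z.
Proof.
  revert v. induction n as [|n IH]; intro v; cbn [repeat exec].
  - replace (upd v j (v j - Z.of_nat 0)%Z) with v; [tauto|]. store_eq.
  - assert (E : upd (upd v j (v j - 1)%Z) j (upd v j (v j - 1)%Z j - Z.of_nat n)%Z
              = upd v j (v j - Z.of_nat (S n))%Z) by (rewrite upd_same; store_eq).
    split.
    + intros (m & -> & H). apply IH in H. rewrite H, E. auto.
    + intros ->. eexists. split; [reflexivity|]. apply IH. auto.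
Qed.

(** The counters tested are multiples of [g] at each check, so all thresholds from 1 to [g] give the
    checks the same meaning. *)
Lemma expand_op_spec th g o s v' : (1 <= th <= Z.of_nat g)%Z ->
  (exec (astep th) (expand_op g o) (emb g s) v' <-> exists s', v' = emb g s' /\ rstep o s s').
Proof.
  intro Hth. destruct o as [c|c|c]; cbn [expand_op rstep].
  - rewrite exec_app.
    assert (E : upd (upd (emb g s) (2 * c) (emb g s (2 * c) + Z.of_nat g)%Z) (2 * c + 1)
       (upd (emb g s) (2 * c) (emb g s (2 * c) + Z.of_nat g)%Z (2 * c + 1) - Z.of_nat g)%Z
       = emb g (upd s c (S (s c)))).
    { rewrite emb_upd, (upd_other (emb g s)), emb_even, emb_odd by lia. f_equal; [f_equal|]; lia. }
    split.
    + intros (m & H1 & H2). apply exec_up in H1. apply exec_dn in H2. subst m.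
      eexists. split; [|reflexivity]. congruence.
    + intros (s' & -> & ->). eexists. split; [apply exec_up; reflexivity|]. apply exec_dn. auto.
  - rewrite exec_app.
    set (v1 := upd (emb g s) (2 * c) (emb g s (2 * c) - Z.of_nat g)%Z).
    set (v2 := upd v1 (2 * c + 1) (v1 (2 * c + 1)%nat + Z.of_nat g)%Z).
    assert (E1 : v1 (2 * c + 1) = (- Z.of_nat (g * s c))%Z).
    { unfold v1. rewrite upd_other, emb_odd by lia. auto. }
    assert (E2 : v2 (2 * c + 1) = (- Z.of_nat (g * s c) + Z.of_nat g)%Z).
    { unfold v2. rewrite upd_same. lia. }
    assert (E : s c <> 0 -> v2 = emb g (upd s c (pred (s c)))).
    { intro Hc. unfold v2. rewrite E1. unfold v1. rewrite emb_upd, emb_even.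
      destruct (s c) as [|n]; [lia|]. simpl pred. f_equal; [f_equal|]; lia. }
    split.
    + intros (m & H1 & H2). apply exec_dn in H1. fold v1 in H1. subst m.
      apply exec_app in H2. destruct H2 as (m & H1 & H2). apply exec_up in H1. fold v2 in H1. subst m.
      simpl in H2. destruct H2 as (m & [H2 ->] & ->). rewrite Nat.add_0_r in *.
      replace (c + c + 1) with (2 * c + 1) in H2 by lia. rewrite E2 in H2.
      assert (Hc : s c <> 0) by (destruct (s c); lia).
      exists (upd s c (pred (s c))). rewrite <- E; auto.
    + intros (s' & -> & Hc & ->). exists v1. split; [apply exec_dn; auto|]. apply exec_app.
      exists v2. split; [apply exec_up; auto|]. cbn [exec astep].
      exists v2. rewrite E2, E by auto. split; auto. split; auto. destruct (s c); lia.
  - cbn [exec astep]. rewrite emb_even. split.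
    + intros (m & [H ->] & ->). exists s. split; auto. split; auto. destruct (s c); auto. lia.
    + intros (s' & -> & Hc & ->). exists (emb g s). split; auto. split; auto. rewrite Hc. lia.
Qed.

Lemma expand_spec th g p s v' : (1 <= th <= Z.of_nat g)%Z ->
  (sem (astep th) (expand g p) (emb g s) v' <-> exists s', v' = emb g s' /\ rsem p s s').
Proof.
  intro Hth. revert s v'. induction p as [l|p IHp q IHq|p IHp]; intros s v'; cbn [expand sem].
  - revert s. induction l as [|o l IH]; intro s; simpl.
    + split; [intros ->; eauto|]. intros (s' & -> & ->); auto.
    + rewrite exec_app. split.
      * intros (m & H1 & H2). apply expand_op_spec in H1; auto. destruct H1 as (s1 & -> & H1).
        apply IH in H2. destruct H2 as (s2 & -> & H2). eauto.
      * intros (s' & -> & m & H1 & H2). exists (emb g m). split; [apply expand_op_spec; eauto|].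
        apply IH. eauto.
  - split.
    + intros (m & H1 & H2). apply IHp in H1. destruct H1 as (s1 & -> & H1).
      apply IHq in H2. destruct H2 as (s2 & -> & H2). eauto.
    + intros (s' & -> & m & H1 & H2). exists (emb g m). split; [apply IHp|apply IHq]; eauto.
  - split.
    + intro H. remember (emb g s) as v eqn:Ev. revert s Ev. induction H as [v|v m v' H1 H2 IH]; intros s ->.
      * exists s. split; auto. constructor.
      * apply IHp in H1. destruct H1 as (s1 & -> & H1). destruct (IH s1 eq_refl) as (s2 & -> & H).
        exists s2. split; auto. econstructor; eauto.
    + intros (s' & -> & H). induction H as [s|s m s' H1 H2 IH].
      * constructor.
      * econstructor; [apply IHp; eauto|auto].
Qed.

(** * Control by a stack of pending programs, and the words that spell a computation *)

Definition stack := list (prog act).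

Definition kact (K : stack) : option act :=
  match K with
  | Blk (a :: _) :: _ => Some a
  | _ => None
  end.

(* Letters: 0 and 1 resolve a choice, 2 is written at an [Up] and 3 at every other forced step,
   4 and 5 may be written when the stack is empty. *)
Definition nexts (K0 K : stack) (a : nat) : option stack :=
  match K with
  | [] => match a with 4 | 5 => Some K0 | _ => None end
  | Blk [] :: K' => match a with 3 => Some K' | _ => None end
  | Blk (Up _ :: l) :: K' => match a with 2 => Some (Blk l :: K') | _ => None end
  | Blk (_ :: l) :: K' => match a with 3 => Some (Blk l :: K') | _ => None end
  | Seq p q :: K' => match a with 3 => Some (p :: q :: K') | _ => None end
  | Star p :: K' =>
      match a with 0 => Some K' | 1 => Some (p :: Star p :: K') | _ => None end
  end.

Definition kstep (th : Z) (o : option act) (v v' : counters) : Prop :=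
  match o with
  | None => v' = v
  | Some a => astep th a v v'
  end.

Inductive okpath (K0 : stack) (th : Z) : stack -> counters -> list nat -> Prop :=
| okpath_nil v : okpath K0 th [] v []
| okpath_cons K v a K' v' l :
    K <> [] -> nexts K0 K a = Some K' -> kstep th (kact K) v v' ->
    okpath K0 th K' v' l -> okpath K0 th K v (a :: l).

Fixpoint semstack (th : Z) (K : stack) (v v' : counters) : Prop :=
  match K with
  | [] => v' = v
  | p :: K' => exists m, sem (astep th) p v m /\ semstack th K' m v'
  end.

Lemma okpath_sem K0 th K v l : okpath K0 th K v l -> exists v', semstack th K v v'.
Proof.
  induction 1 as [v|K v a K' v' l HK Hn Hs Hp (w & IH)]; [exists v; reflexivity|].
  destruct K as [|[[|b l']|p q|p] K]; [congruence|..]; simpl in *.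
  - destruct a as [|[|[|[|]]]]; try discriminate. inversion Hn; subst. eauto.
  - assert (K' = Blk l' :: K).
    { destruct b; destruct a as [|[|[|[|]]]]; congruence. }
    subst K'. simpl in IH. destruct IH as (m & H1 & H2). exists w, m. split; auto. exists v'. auto.
  - destruct a as [|[|[|[|]]]]; try discriminate. inversion Hn; subst.
    simpl in IH. destruct IH as (m & H1 & m' & H2 & H3). exists w, m'. split; auto. eauto.
  - destruct a as [|[|]]; try discriminate; inversion Hn; subst.
    + exists w, v. split; auto. constructor.
    + simpl in IH. destruct IH as (m & H1 & m' & H2 & H3). exists w, m'. split; auto.
      econstructor; eauto.
Qed.

Definition aletter (a : act) : nat := match a with Up _ => 2 | _ => 3 end.

Lemma nexts_act K0 a l K : nexts K0 (Blk (a :: l) :: K) (aletter a) = Some (Blk l :: K).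
Proof. destruct a; reflexivity. Qed.

Lemma okpath_blk K0 th acts K v v' l :
  exec (astep th) acts v v' -> okpath K0 th K v' l ->
  okpath K0 th (Blk acts :: K) v (map aletter acts ++ 3 :: l).
Proof.
  revert v. induction acts as [|a acts IH]; intros v He Hk; simpl in *.
  - subst v'. econstructor; [discriminate|reflexivity|reflexivity|auto].
  - destruct He as (m & H1 & H2). econstructor; [discriminate|apply nexts_act|exact H1|auto].
Qed.

Lemma okpath_blk_inv K0 th acts K v l :
  okpath K0 th (Blk acts :: K) v l ->
  exists v' l', l = map aletter acts ++ 3 :: l' /\ exec (astep th) acts v v' /\ okpath K0 th K v' l'.
Proof.
  revert v l. induction acts as [|a acts IH]; intros v l H; inversion H; subst; simpl in *.
  - destruct a as [|[|[|[|]]]]; try discriminate.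
    simpl in *. match goal with E : Some _ = Some _ |- _ => inversion E; subst end. eauto.
  - assert (a0 = aletter a /\ K' = Blk acts :: K) as [-> ->].
    { destruct a; destruct a0 as [|[|[|[|]]]]; simpl; split; congruence. }
    match goal with E : okpath _ _ (Blk acts :: K) _ _ |- _ => apply IH in E; destruct E as (w & l' & -> & X1 & X2) end.
    exists w, l'. split; auto. split; eauto.
Qed.

Lemma aletter_range acts a : In a (map aletter acts) -> a = 2 \/ a = 3.
Proof. intro H. apply in_map_iff in H. destruct H as ([] & <- & _); simpl; auto. Qed.

Lemma sem_okpath K0 th p K v v' l :
  sem (astep th) p v v' -> okpath K0 th K v' l ->
  exists l', (forall a, In a l' -> a < 4) /\ okpath K0 th (p :: K) v (l' ++ l).
Proof.
  revert K v v' l. induction p as [acts|p IHp q IHq|p IHp]; intros K v v' l H Hk; simpl in H.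
  - exists (map aletter acts ++ [3]). split.
    + intros a Ha. apply in_app_iff in Ha. destruct Ha as [Ha|[<-|[]]]; [|lia].
      apply aletter_range in Ha. lia.
    + rewrite <- app_assoc. simpl. eapply okpath_blk; eauto.
  - destruct H as (m & H1 & H2). destruct (IHq _ _ _ _ H2 Hk) as (l2 & R2 & Hk2).
    destruct (IHp _ _ _ _ H1 Hk2) as (l1 & R1 & Hk1).
    exists (3 :: l1 ++ l2). split.
    + intros a [<-|Ha]; [lia|]. apply in_app_iff in Ha. destruct Ha; auto.
    + simpl. rewrite <- app_assoc. econstructor; [discriminate|reflexivity|reflexivity|auto].
  - induction H as [v|v m v' H1 H2 IH].
    + exists [0]. split; [intros a [<-|[]]; lia|]. simpl.
      econstructor; [discriminate|reflexivity|reflexivity|auto].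
    + destruct (IH Hk) as (l2 & R2 & Hk2). destruct (IHp _ _ _ _ H1 Hk2) as (l1 & R1 & Hk1).
      exists (1 :: l1 ++ l2). split.
      * intros a [<-|Ha]; [lia|]. apply in_app_iff in Ha. destruct Ha; auto.
      * simpl. rewrite <- app_assoc. econstructor; [discriminate|reflexivity|reflexivity|auto].
Qed.

Inductive chst : Type := Chn (j : nat) | Done.

(* [Chn j]: [j] letters 1 have been read since the copy started, and no letter 0 yet. *)
Definition chstep (x : nat) (z : chst) (a : nat) : option chst :=
  match z with
  | Chn j =>
      match a with
      | 0 => if j =? x then Some Done else None
      | 1 => if j <? x then Some (Chn (S j)) else None
      | 2 | 3 => Some (Chn j)
      | _ => None
      end
  | Done => match a with 4 | 5 => Some (Chn 0) | _ => Some Done end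
  end.

Fixpoint chrun (x : nat) (z : chst) (l : list nat) : option chst :=
  match l with
  | [] => Some z
  | a :: l' => match chstep x z a with Some z' => chrun x z' l' | None => None end
  end.

Lemma chrun_app x z l1 l2 :
  chrun x z (l1 ++ l2) = match chrun x z l1 with Some z' => chrun x z' l2 | None => None end.
Proof. revert z. induction l1 as [|a l1 IH]; intro z; simpl; auto. destruct (chstep x z a); auto. Qed.

Lemma chrun_neutral x j acts l : chrun x (Chn j) (map aletter acts ++ l) = chrun x (Chn j) l.
Proof. induction acts as [|[] acts IH]; simpl; auto. Qed.

Lemma chrun_done x l : (forall a, In a l -> a < 4) -> chrun x Done l = Some Done.
Proof.
  induction l as [|a l IH]; intro H; simpl; auto.
  assert (a < 4) by (apply H; left; auto).
  destruct a as [|[|[|[|]]]]; try lia; apply IH; intros; apply H; right; auto.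
Qed.

(** The control must not depend on [x], so the input is not built in: a copy first increments
    register 0 a guessed number of times, one letter 1 per round and a 0 to leave the loop, and
    [chstep] checks separately that exactly [x] letters 1 precede the first 0. *)
Definition load (g : nat) (R : prog rop) : stack := [expand g (Star (Blk [Inc 0])); expand g R].

Definition good_word (g : nat) (R : prog rop) (th : Z) (x : nat) (w : list nat) : Prop :=
  okpath (load g R) th (load g R) (fun _ => 0%Z) w /\ chrun x (Chn 0) w = Some Done.

(** Inside the loading loop register 0 equals the number of letters 1 read, so the first 0 can only
    come when the register holds [x]. The induction is on the length of the word because a round of
    the loop takes several letters. *)
Lemma load_sound g R th x l s : (1 <= th <= Z.of_nat g)%Z ->
  okpath (load g R) th (load g R) (emb g s) l -> chrun x (Chn (s 0)) l = Some Done ->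
  exists l', okpath (load g R) th [expand g R] (emb g (upd s 0 x)) l'.
Proof.
  intro Hth. remember (length l) as n eqn:Hn. revert l s Hn.
  induction n as [n IH] using lt_wf_ind. intros l s Hn Hk Hc.
  unfold load at 2 in Hk. inversion Hk; subst. simpl in *.
  destruct a as [|[|]]; try discriminate; simpl in *;
    match goal with E : Some _ = Some _ |- _ => inversion E; subst; clear E end.
  - destruct (Nat.eqb_spec (s 0) x); [|discriminate]. subst x.
    replace (upd s 0 (s 0)) with s by store_eq. eauto.
  - destruct (Nat.ltb_spec (s 0) x); [|discriminate].
    match goal with E : okpath _ _ (_ :: _) _ _ |- _ => apply okpath_blk_inv in E; destruct E as (w & l' & -> & X1 & X2) end.
    rewrite chrun_neutral in Hc. simpl in Hc.
    rewrite app_nil_r in X1.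
    apply (expand_op_spec th g (Inc 0) s) in X1; auto. destruct X1 as (s' & -> & X1). simpl in X1. subst s'.
    destruct (IH (length l')) with (l := l') (s := upd s 0 (S (s 0))) as (l'' & Hl''); auto.
    + simpl. rewrite length_app. simpl. lia.
    + exists l''. replace (upd s 0 x) with (upd (upd s 0 (S (s 0))) 0 x) by store_eq. auto.
Qed.

Lemma emb_zero g : emb g (fun _ => 0) = (fun _ => 0%Z).
Proof. apply functional_extensionality; intro j. unfold emb. rewrite Nat.mul_0_r. destruct (Nat.even j); auto. Qed.

Theorem good_word_sound g R th x w : (1 <= th <= Z.of_nat g)%Z ->
  good_word g R th x w -> exists s', rsem R (upd (fun _ => 0) 0 x) s'.
Proof.
  intros Hth [Hk Hc]. rewrite <- (emb_zero g) in Hk.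
  apply load_sound with (x := x) in Hk; auto. destruct Hk as (l & Hk).
  apply okpath_sem in Hk. destruct Hk as (v & m & H & _).
  apply expand_spec in H; auto. destruct H as (s' & _ & H). eauto.
Qed.

(** Since [0 < x], there is a round of the loading loop, hence an increment and a letter 2: the
    estimate of credit in the honest tree wants a coin in every copy. *)
Theorem good_word_complete g R th x s' : (1 <= th <= Z.of_nat g)%Z -> 0 < x ->
  rsem R (upd (fun _ => 0) 0 x) s' ->
  exists w, good_word g R th x w /\ (forall a, In a w -> a < 4) /\ In 2 w.
Proof.
  intros Hth Hx H.
  assert (Hl : exists l, (forall a, In a l -> a < 4) /\
     okpath (load g R) th [expand g R] (emb g (upd (fun _ => 0) 0 x)) l).
  { destruct (sem_okpath (load g R) th (expand g R) [] (emb g (upd (fun _ => 0) 0 x)) (emb g s') [])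
      as (l & R1 & Hk).
    - apply expand_spec; eauto.
    - constructor.
    - rewrite app_nil_r in Hk. eauto. }
  destruct Hl as (l & Rl & Hl).
  (* The word is built backwards: with [k] rounds of the loading loop to come, both register 0 and
     the number of letters 1 read stand at [x - k]. *)
  assert (Cmp : forall k, k <= x -> exists w,
     okpath (load g R) th (load g R) (emb g (upd (fun _ => 0) 0 (x - k))) w /\
     chrun x (Chn (x - k)) w = Some Done /\ (forall a, In a w -> a < 4) /\ (0 < k -> In 2 w)).
  { induction k as [|k IH]; intro Hk.
    - exists (0 :: l). rewrite Nat.sub_0_r. split; [|split; [|split]].
      + econstructor; [discriminate|reflexivity|reflexivity|auto].
      + simpl. rewrite Nat.eqb_refl. apply chrun_done; auto.
      + intros a [<-|Ha]; auto; lia.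
      + lia.
    - destruct IH as (w & H1 & H2 & H3 & _); [lia|].
      exists (1 :: map aletter (flat_map (expand_op g) [Inc 0]) ++ 3 :: w). split; [|split; [|split]].
      + econstructor; [discriminate|reflexivity|reflexivity|].
        eapply okpath_blk; [|exact H1].
        apply (expand_spec th g (Blk [Inc 0])); auto.
        exists (upd (fun _ => 0) 0 (x - k)). split; auto. simpl. rewrite upd_same.
        replace (S (x - S k)) with (x - k) by lia. eexists. split; [reflexivity|]. store_eq.
      + cbn [chrun chstep]. destruct (Nat.ltb_spec (x - S k) x); [|lia].
        rewrite chrun_neutral. simpl. replace (S (x - S k)) with (x - k) by lia. auto.
      + intros a [<-|Ha]; [lia|]. apply in_app_iff in Ha. destruct Ha as [Ha|[<-|Ha]]; [|lia|auto].
        apply aletter_range in Ha. lia.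
      + intros _. right. apply in_app_iff. left. simpl expand_op.
        destruct g; [lia|]. simpl. auto. }
  destruct (Cmp x) as (w & H1 & H2 & H3 & H4); auto. rewrite Nat.sub_diag in *.
  exists w. split; [split|]; auto. rewrite <- (emb_zero g).
  replace (fun _ : nat => 0) with (upd (fun _ => 0) 0 0) by store_eq. auto.
Qed.

(** * Only finitely many stacks and counters occur *)

Fixpoint pall {A : Type} (Q : A -> Prop) (p : prog A) : Prop :=
  match p with
  | Blk l => forall a, In a l -> Q a
  | Seq p q => pall Q p /\ pall Q q
  | Star p => pall Q p
  end.

Definition rop_reg (o : rop) : nat := match o with Inc c | Dec c | Zer c => c end.
Definition act_idx (a : act) : nat := match a with Up j | Dn j | Chk j => j end.

Lemma pall_mono {A : Type} (Q Q' : A -> Prop) p : (forall a, Q a -> Q' a) -> pall Q p -> pall Q' p.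
Proof. intro H. induction p; simpl; firstorder. Qed.

Lemma regs_bounded p : exists d, pall (fun o => rop_reg o < d) p.
Proof.
  induction p as [l|p [d1 H1] q [d2 H2]|p [d H]]; simpl.
  - induction l as [|o l [d IH]].
    + exists 0. intros a [].
    + exists (S (rop_reg o) + d). intros a [<-|Ha]; [lia|]. apply IH in Ha. lia.
  - exists (d1 + d2). split; eapply pall_mono; try eassumption; simpl; intros; lia.
  - eauto.
Qed.

Lemma expand_idx g d p : pall (fun o => rop_reg o < d) p -> pall (fun a => act_idx a < 2 * d) (expand g p).
Proof.
  induction p as [l|p IHp q IHq|p IHp]; cbn [expand pall]; [|firstorder|auto].
  intros H a Ha. apply in_flat_map in Ha. destruct Ha as (o & Ho & Ha). apply H in Ho.
  destruct o; simpl in *; repeat rewrite in_app_iff in Ha;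
    repeat match goal with
    | X : _ \/ _ |- _ => destruct X
    | X : False |- _ => destruct X
    | X : In _ (repeat _ _) |- _ => apply repeat_spec in X
    | X : In _ [_] |- _ => destruct X as [X|[]]
    end; subst; simpl; lia.
Qed.

Fixpoint suffixes (l : list act) (K : stack) : list stack :=
  (Blk l :: K) :: match l with [] => [] | _ :: l' => suffixes l' K end.

(** Stacks met while [p] runs above [K], before [K] itself is exposed. Every round of a loop runs
    above the same [Star p :: K], so stacks do not grow with the computation. *)
Fixpoint reach (p : prog act) (K : stack) : list stack :=
  match p with
  | Blk l => suffixes l K
  | Seq p q => (Seq p q :: K) :: reach p (q :: K) ++ reach q K
  | Star p => (Star p :: K) :: reach p (Star p :: K)
  end.

Lemma reach_head p K : In (p :: K) (reach p K).
Proof. destruct p as [[|b l]|p q|p]; simpl; auto. Qed.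

Lemma reach_closed K0 p K X a X' : In X (reach p K) -> nexts K0 X a = Some X' ->
  In X' (reach p K) \/ X' = K.
Proof.
  revert K X. induction p as [l|p IHp q IHq|p IHp]; intros K X HX Hn; cbn [reach] in *.
  - induction l as [|b l IH]; cbn [suffixes] in *.
    + destruct HX as [<-|[]]. simpl in Hn. destruct a as [|[|[|[|]]]]; inversion Hn; auto.
    + destruct HX as [<-|HX].
      * assert (X' = Blk l :: K).
        { simpl in Hn. destruct b; destruct a as [|[|[|[|]]]]; congruence. }
        subst. left. right. destruct l; left; auto.
      * destruct (IH HX); auto. left; right; auto.
  - destruct HX as [<-|HX].
    + simpl in Hn. destruct a as [|[|[|[|]]]]; inversion Hn. left. right.
      apply in_app_iff. left. apply reach_head.
    + apply in_app_iff in HX. destruct HX as [HX|HX].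
      * destruct (IHp _ _ HX Hn) as [ | ->]; left; right; apply in_app_iff; auto. right; apply reach_head.
      * destruct (IHq _ _ HX Hn) as [ | ->]; auto. left; right; apply in_app_iff; auto.
  - destruct HX as [<-|HX].
    + simpl in Hn. destruct a as [|[|]]; inversion Hn; auto. left. right. apply reach_head.
    + destruct (IHp _ _ HX Hn) as [ | ->]; left; [right; auto|left; auto].
Qed.

Lemma reach_idx (Q : act -> Prop) p K X a : pall Q p -> In X (reach p K) -> kact X = Some a -> Q a.
Proof.
  revert K X. induction p as [l|p IHp q IHq|p IHp]; intros K X Hp HX Ha; cbn [reach pall] in *.
  - induction l as [|b l IH]; cbn [suffixes] in *.
    + destruct HX as [<-|[]]. discriminate.
    + destruct HX as [<-|HX].
      * simpl in Ha. inversion Ha; subst. apply Hp. left; auto.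
      * apply IH; auto. intros; apply Hp; right; auto.
  - destruct HX as [<-|HX]; [discriminate|]. destruct Hp.
    apply in_app_iff in HX. destruct HX; eauto.
  - destruct HX as [<-|HX]; [discriminate|]. eauto.
Qed.

(** This makes the stack a finite control: it is bounded by the syntax of the program. The empty
    stack, which [reach] leaves out, is added explicitly; from it letters 4 and 5 lead back to
    [load g R]. *)
Lemma stacks_finite g R d : 0 < d -> pall (fun o => rop_reg o < d) R ->
  exists RS : list stack, In (load g R) RS /\
    (forall K a K', In K RS -> nexts (load g R) K a = Some K' -> In K' RS) /\
    (forall K a, In K RS -> kact K = Some a -> act_idx a < 2 * d).
Proof.
  intros Hd HR. set (I := expand g (Star (Blk [Inc 0]))). set (P := expand g R).
  exists (reach I [P] ++ reach P [] ++ [[]]). split; [|split].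
  - apply in_app_iff. left. apply reach_head.
  - intros K a K' HK Hn. rewrite !in_app_iff in *. destruct HK as [HK|[HK|[<-|[]]]].
    + destruct (reach_closed _ _ _ _ _ _ HK Hn) as [ | ->]; auto. right; left. apply reach_head.
    + destruct (reach_closed _ _ _ _ _ _ HK Hn) as [ | ->]; auto. right; right; left; auto.
    + left. simpl in Hn. letters a; inversion Hn; apply reach_head.
  - intros K a HK Ha. rewrite !in_app_iff in *. destruct HK as [HK|[HK|[<-|[]]]]; [| |discriminate].
    + apply (reach_idx (fun a => act_idx a < 2 * d) I [P] K); auto.
      apply expand_idx. simpl. intros o [<-|[]]. auto.
    + apply (reach_idx (fun a => act_idx a < 2 * d) P [] K); auto. apply expand_idx; auto.
Qed.

(** * Null sets of branches *)

Open Scope R_scope.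

Notation em := excluded_middle_informative.

Definition indic (P : Prop) : R := if em P then 1 else 0.

Lemma indic_true (P : Prop) : P -> indic P = 1.
Proof. unfold indic. destruct (em P); tauto. Qed.

Lemma indic_false (P : Prop) : ~ P -> indic P = 0.
Proof. unfold indic. destruct (em P); tauto. Qed.

Lemma indic_bounds (P : Prop) : 0 <= indic P <= 1.
Proof. unfold indic. destruct (em P); lra. Qed.

Lemma indic_mono (P Q : Prop) : (P -> Q) -> indic P <= indic Q.
Proof. unfold indic. destruct (em P), (em Q); intros; try lra; tauto. Qed.

(** Expectation over a uniformly random node of level [n]. These finite expectations replace the
    measure on branches throughout. *)
Fixpoint Ex (n : nat) (f : node -> R) : R :=
  match n with
  | O => f []
  | S n => (Ex n (fun u => f (false :: u)) + Ex n (fun u => f (true :: u))) / 2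
  end.

Lemma Ex_mono n f g : (forall u, length u = n -> f u <= g u) -> Ex n f <= Ex n g.
Proof.
  revert f g. induction n as [|n IH]; intros f g H; simpl; auto.
  assert (H1 := IH (fun u => f (false :: u)) (fun u => g (false :: u))).
  assert (H2 := IH (fun u => f (true :: u)) (fun u => g (true :: u))).
  assert (Ex n (fun u => f (false :: u)) <= Ex n (fun u => g (false :: u))) by (apply H1; intros; apply H; simpl; auto).
  assert (Ex n (fun u => f (true :: u)) <= Ex n (fun u => g (true :: u))) by (apply H2; intros; apply H; simpl; auto).
  lra.
Qed.

Lemma Ex_ext n f g : (forall u, length u = n -> f u = g u) -> Ex n f = Ex n g.
Proof. intro H. apply Rle_antisym; apply Ex_mono; intros; rewrite H; auto; lra. Qed.

Lemma Ex_const n c : Ex n (fun _ => c) = c.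
Proof. induction n; simpl; lra. Qed.

Lemma Ex_plus n f g : Ex n (fun u => f u + g u) = Ex n f + Ex n g.
Proof. revert f g. induction n as [|n IH]; intros; simpl; auto. rewrite !IH. lra. Qed.

Lemma Ex_minus n f g : Ex n (fun u => f u - g u) = Ex n f - Ex n g.
Proof. revert f g. induction n as [|n IH]; intros; simpl; auto. rewrite !IH. lra. Qed.

(** [Ex] splits off the first bit, whereas a step down the tree appends the last one. *)
Lemma Ex_snoc n f : Ex (S n) f = Ex n (fun u => (f (u ++ [false]) + f (u ++ [true])) / 2).
Proof.
  revert f. induction n as [|n IH]; intro f; [reflexivity|].
  change (Ex (S (S n)) f) with ((Ex (S n) (fun u => f (false :: u)) + Ex (S n) (fun u => f (true :: u))) / 2).
  rewrite (IH (fun u => f (false :: u))), (IH (fun u => f (true :: u))). reflexivity.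
Qed.

Definition supermart (W : node -> R) : Prop :=
  forall u, (W (u ++ [false]) + W (u ++ [true])) / 2 <= W u.

Lemma Ex_supermart W n : supermart W -> Ex n W <= W [].
Proof.
  intro H. induction n as [|n IH]; [simpl; lra|]. rewrite Ex_snoc.
  eapply Rle_trans; [|exact IH]. apply Ex_mono. intros; apply H.
Qed.

Definition sumR {A : Type} (f : A -> R) (l : list A) : R := fold_right Rplus 0 (map f l).

Lemma sumR_nonneg {A : Type} (f : A -> R) l : (forall a, In a l -> 0 <= f a) -> 0 <= sumR f l.
Proof.
  unfold sumR. induction l as [|a l IH]; intro H; simpl; [lra|].
  assert (0 <= f a) by (apply H; left; auto).
  assert (0 <= fold_right Rplus 0 (map f l)) by (apply IH; intros; apply H; right; auto). lra.
Qed.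

Lemma sumR_app {A : Type} (f : A -> R) l1 l2 : sumR f (l1 ++ l2) = sumR f l1 + sumR f l2.
Proof. unfold sumR. induction l1; simpl; [lra|]. rewrite IHl1. lra. Qed.

Lemma sumR_le {A : Type} (f g : A -> R) l : (forall a, In a l -> f a <= g a) -> sumR f l <= sumR g l.
Proof.
  unfold sumR. induction l as [|a l IH]; intro H; simpl; [lra|].
  assert (f a <= g a) by (apply H; left; auto).
  assert (fold_right Rplus 0 (map f l) <= fold_right Rplus 0 (map g l)) by (apply IH; intros; apply H; right; auto).
  lra.
Qed.

Lemma sumR_plus {A : Type} (f g : A -> R) l : sumR (fun a => f a + g a) l = sumR f l + sumR g l.
Proof. unfold sumR. induction l; simpl; [lra|]. rewrite IHl. lra. Qed.

Lemma sumR_scal {A : Type} c (f : A -> R) l : sumR (fun a => c * f a) l = c * sumR f l.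
Proof. unfold sumR. induction l; simpl; [lra|]. rewrite IHl. lra. Qed.

Lemma sumR_map {A B : Type} (f : B -> R) (h : A -> B) l : sumR f (map h l) = sumR (fun a => f (h a)) l.
Proof. unfold sumR. rewrite map_map. auto. Qed.

Lemma sumR_incl {A : Type} (f : A -> R) l l' : (forall a, 0 <= f a) -> NoDup l -> incl l l' ->
  sumR f l <= sumR f l'.
Proof.
  intro Hf. revert l'. induction l as [|a l IH]; intros l' Hn Hi.
  - apply sumR_nonneg; auto.
  - inversion Hn; subst. assert (Ha : In a l') by (apply Hi; left; auto).
    apply in_split in Ha. destruct Ha as (l1 & l2 & ->).
    assert (sumR f l <= sumR f (l1 ++ l2)).
    { apply IH; auto. intros b Hb. assert (Hb' := Hi b (or_intror Hb)).
      apply in_app_iff in Hb'. apply in_app_iff. destruct Hb' as [|[->|]]; auto. contradiction. }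
    rewrite sumR_app in *. unfold sumR in *. simpl. lra.
Qed.

Lemma Ex_sumR {A : Type} n (F : A -> node -> R) l :
  Ex n (fun u => sumR (fun a => F a u) l) = sumR (fun a => Ex n (F a)) l.
Proof.
  induction l as [|a l IH]; unfold sumR in *; simpl; [apply Ex_const|]. rewrite Ex_plus, IH. auto.
Qed.

Definition is_prefix (c u : node) : Prop := exists w, u = c ++ w.

Lemma Ex_pre n v (F : node -> R) :
  Ex (length v + n) (fun u => indic (is_prefix v u) * F u) = (/ 2) ^ length v * Ex n (fun w => F (v ++ w)).
Proof.
  revert F. induction v as [|b v IH]; intro F.
  - simpl. rewrite Rmult_1_l. apply Ex_ext. intros u _. rewrite indic_true; [lra|]. exists u; auto.
  - assert (E0 : forall F', Ex (length v + n) (fun u => indic (is_prefix (b :: v) (negb b :: u)) * F' u) = 0).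
    { intro F'. rewrite <- (Ex_const (length v + n) 0). apply Ex_ext. intros u _.
      rewrite indic_false; [lra|]. intros [w Hw]. destruct b; discriminate. }
    assert (E1 : Ex (length v + n) (fun u => indic (is_prefix (b :: v) (b :: u)) * F (b :: u)) =
                 (/ 2) ^ length v * Ex n (fun w => F ((b :: v) ++ w))).
    { etransitivity; [|exact (IH (fun u => F (b :: u)))]. apply Ex_ext. intros u _. f_equal.
      apply Rle_antisym; apply indic_mono; intros [w Hw]; exists w; [simpl in Hw; congruence|subst; auto]. }
    simpl length. simpl plus. cbn [Ex].
    destruct b; simpl negb in *;
      [rewrite (E0 (fun u => F (false :: u)))|rewrite (E0 (fun u => F (true :: u)))]; rewrite E1;
      cbn [pow]; lra.
Qed.

Lemma Ex_pre_ind n v : (length v <= n)%nat -> Ex n (fun u => indic (is_prefix v u)) = (/ 2) ^ length v.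
Proof.
  intro H. replace n with (length v + (n - length v))%nat by lia.
  rewrite <- (Rmult_1_r ((/ 2) ^ length v)). rewrite <- (Ex_const (n - length v) 1).
  rewrite <- (Ex_pre _ _ (fun _ => 1)). apply Ex_ext. intros; lra.
Qed.

(** The binary digits of [p], lowest first and without the leading 1: a bijection between positive
    numbers and nodes. *)
Fixpoint pos_node (p : positive) : node :=
  match p with
  | xH => []
  | xO p => false :: pos_node p
  | xI p => true :: pos_node p
  end.

Definition nat_node (i : nat) : node := pos_node (Pos.of_succ_nat i).

Lemma nat_node_inj i j : nat_node i = nat_node j -> i = j.
Proof.
  unfold nat_node. intro H. apply SuccNat2Pos.inj. revert H.
  generalize (Pos.of_succ_nat i) (Pos.of_succ_nat j). intros p.
  induction p as [p IH|p IH|]; intros [q|q|] H; simpl in H; inversion H; f_equal; auto.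
Qed.

Lemma nat_node_surj u : exists i, nat_node i = u.
Proof.
  assert (H : exists p, pos_node p = u).
  { induction u as [|[] u [p Hp]].
    - exists xH; auto.
    - exists (xI p). simpl. congruence.
    - exists (xO p). simpl. congruence. }
  destruct H as [p <-]. exists (pred (Pos.to_nat p)). unfold nat_node. f_equal.
  rewrite <- (Pos2Nat.id p) at 2. pose proof (Pos2Nat.is_pos p).
  rewrite Pos.of_nat_succ. f_equal. lia.
Qed.

Lemma bprefix_length pi n : length (bprefix pi n) = n.
Proof. unfold bprefix. rewrite length_map, length_seq. auto. Qed.

Lemma bprefix_S pi n : bprefix pi (S n) = bprefix pi n ++ [pi n].
Proof. unfold bprefix. rewrite seq_S, map_app. auto. Qed.

Lemma bprefix_firstn pi m n : (m <= n)%nat -> bprefix pi m = firstn m (bprefix pi n).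
Proof.
  intro H. replace n with (m + (n - m))%nat by lia.
  unfold bprefix. rewrite seq_app, map_app, firstn_app, length_map, length_seq, Nat.sub_diag.
  simpl. rewrite app_nil_r, firstn_all2; auto. rewrite length_map, length_seq. auto.
Qed.

Lemma half_pow_small eps : 0 < eps -> exists k, (/ 2) ^ k < eps.
Proof.
  intro H. destruct (pow_lt_1_zero (/ 2)) with (y := eps) as [N HN]; auto.
  - rewrite Rabs_pos_eq; lra.
  - exists N. specialize (HN N (le_n N)). rewrite Rabs_pos_eq in HN; auto. apply pow_le. lra.
Qed.

Lemma half_pow_pos k : 0 < (/ 2) ^ k.
Proof. apply pow_lt. lra. Qed.

Lemma sum_half_pow k N : sumR (fun i => (/ 2) ^ (k + i)) (seq 0 N) = 2 * (/ 2) ^ k - 2 * (/ 2) ^ (k + N).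
Proof.
  induction N as [|N IH].
  - unfold sumR. simpl. rewrite Nat.add_0_r. lra.
  - rewrite seq_S, sumR_app, IH. unfold sumR. simpl. rewrite <- plus_n_Sm. simpl. lra.
Qed.

(* A cover must be an infinite sequence of cones: the indices that are not used are filled with
   cones of total measure at most [eps]. *)
Lemma null_of_families (S : branch -> Prop) :
  (forall eps, 0 < eps -> exists M : node -> Prop,
     (forall l, NoDup l -> (forall v, In v l -> M v) -> sumR (fun v => (/ 2) ^ length v) l <= eps) /\
     (forall pi, S pi -> exists n, M (bprefix pi n))) -> mu_null S.
Proof.
  intros H eps Heps. destruct (H (eps / 2)) as (M & HM & HS); [lra|].
  (* The filler cones have lengths [k], [k + 1] and so on, hence total measure at most [2 * 2^-k],
     which is below [eps / 2]. *)
  destruct (half_pow_small (eps / 4)) as [k Hk]; [lra|].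
  exists (fun i => if em (M (nat_node i)) then nat_node i else repeat false (k + i)).
  split.
  - intros pi Hpi. destruct (HS pi Hpi) as [n Hn]. destruct (nat_node_surj (bprefix pi n)) as [i Hi].
    exists i. rewrite Hi. destruct (em (M (bprefix pi n))); [|contradiction].
    rewrite bprefix_length. auto.
  - intro N.
    set (l := filter (fun v => if em (M v) then true else false) (map nat_node (seq 0 N))).
    assert (Hl : sumR (fun v => (/ 2) ^ length v) l <= eps / 2).
    { apply HM.
      - apply NoDup_filter. apply FinFun.Injective_map_NoDup; [intros i j; apply nat_node_inj|apply seq_NoDup].
      - intros v Hv. apply filter_In in Hv. destruct Hv as [_ Hv].
        destruct (em (M v)); auto. discriminate. }
    assert (E : sumR (fun v => (/ 2) ^ length v) l =
                sumR (fun i => indic (M (nat_node i)) * (/ 2) ^ length (nat_node i)) (seq 0 N)).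
    { unfold l. generalize (seq 0 N). intro s. induction s as [|i s IH]; [reflexivity|].
      cbn [map filter]. unfold sumR in *. cbn [map fold_right]. rewrite <- IH. unfold indic.
      destruct (em (M (nat_node i))); cbn [map fold_right]; lra. }
    assert (Hs := sum_half_pow k N). assert (Hp := half_pow_pos (k + N)).
    change (sumR (fun i => (/ 2) ^ length (if em (M (nat_node i)) then nat_node i else repeat false (k + i))) (seq 0 N) <= eps).
    apply Rle_trans with (sumR (fun i => indic (M (nat_node i)) * (/ 2) ^ length (nat_node i) + (/ 2) ^ (k + i)) (seq 0 N)).
    + apply sumR_le. intros i _. unfold indic. assert (Hq := half_pow_pos (k + i)).
      destruct (em (M (nat_node i))); [lra|]. rewrite repeat_length. lra.
    + rewrite sumR_plus, <- E, Hs. lra.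
Qed.

Lemma app_comparable {A : Type} (a b c d : list A) : a ++ b = c ++ d ->
  (exists e, a = c ++ e) \/ (exists e, c = a ++ e).
Proof.
  revert c. induction a as [|x a IH]; intros c H; [right; exists c; auto|].
  destruct c as [|y c]; [left; exists (x :: a); auto|].
  inversion H; subst. destruct (IH c H2) as [[e ->]|[e ->]]; [left|right]; exists e; auto.
Qed.

Lemma sumR_ind_le1 {A : Type} (P : A -> Prop) l : NoDup l ->
  (forall a b, In a l -> In b l -> P a -> P b -> a = b) ->
  sumR (fun a => indic (P a)) l <= indic (exists a, In a l /\ P a).
Proof.
  induction l as [|a l IH]; intros Hn H.
  - unfold sumR. simpl. apply indic_bounds.
  - inversion Hn; subst. unfold sumR. simpl. fold (sumR (fun a => indic (P a)) l).
    destruct (classic (P a)) as [Pa|Pa].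
    + rewrite (indic_true (exists _, _)) by (exists a; split; auto; left; auto). rewrite indic_true by auto.
      assert (sumR (fun a => indic (P a)) l <= sumR (fun a => 0 * 1) l).
      { apply sumR_le. intros b Hb. rewrite indic_false; [lra|]. intro Pb.
        assert (a = b) by (apply H; auto; [left|right]; auto). subst; contradiction. }
      rewrite sumR_scal in H0. lra.
    + rewrite (indic_false (P a)) by auto.
      assert (sumR (fun a => indic (P a)) l <= indic (exists a, In a l /\ P a)).
      { apply IH; auto. intros; apply H; auto; right; auto. }
      assert (indic (exists a, In a l /\ P a) <= indic (exists a0, (a = a0 \/ In a0 l) /\ P a0)).
      { apply indic_mono. intros (b & Hb & Pb). exists b. auto. }
      lra.
Qed.

Definition hitpre (W : node -> R) (u : node) : Prop := exists v, is_prefix v u /\ 1 <= W v.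

(** Doob's inequality: [W] stopped at its first value at least 1, with that value cut down to 1, is
    still a supermartingale. *)
Lemma maximal_inequality W n : (forall u, 0 <= W u) -> supermart W -> Ex n (fun u => indic (hitpre W u)) <= W [].
Proof.
  intros H0 HW.
  set (Y := fun u => if em (hitpre W u) then 1 else W u).
  assert (HY : supermart Y).
  { intro u. unfold Y at 3. destruct (em (hitpre W u)) as [h|h].
    - assert (E : forall b, Y (u ++ [b]) = 1).
      { intro b. unfold Y. destruct (em (hitpre W (u ++ [b]))) as [|h']; auto.
        exfalso; apply h'. destruct h as (v & [w ->] & Hv). exists v. split; auto.
        exists (w ++ [b]). rewrite app_assoc. auto. }
      rewrite !E. lra.
    - assert (E : forall b, Y (u ++ [b]) <= W (u ++ [b])).
      { intro b. unfold Y. destruct (em (hitpre W (u ++ [b]))) as [h'|]; [|lra].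
        destruct h' as (v & [w Hw] & Hv). destruct w as [|c w] using rev_ind.
        - rewrite app_nil_r in Hw. rewrite Hw. auto.
        - rewrite app_assoc in Hw. apply app_inj_tail in Hw. destruct Hw as [-> _].
          exfalso; apply h. exists v. split; auto. exists w; auto. }
      assert (E1 := E false). assert (E2 := E true). assert (E3 := HW u). lra. }
  apply Rle_trans with (Ex n Y).
  - apply Ex_mono. intros u _. unfold Y, indic. destruct (em (hitpre W u)); [lra|auto].
  - apply Rle_trans with (Y []); [apply Ex_supermart; auto|].
    unfold Y. destruct (em (hitpre W [])) as [(v & [w Hw] & Hv)|]; [|lra].
    symmetry in Hw. apply app_eq_nil in Hw. destruct Hw as [-> _]. auto.
Qed.

(** The cover consists of the cones at the first nodes where [W] reaches 1. They are disjoint, so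
    their total measure is a probability of reaching 1, which the maximal inequality bounds by [W
    []]. *)
Theorem null_of_supermart (S : branch -> Prop) :
  (forall eps, 0 < eps -> exists W : node -> R, (forall u, 0 <= W u) /\ supermart W /\ W [] <= eps /\
     (forall pi, S pi -> exists n, 1 <= W (bprefix pi n))) -> mu_null S.
Proof.
  intro H. apply null_of_families. intros eps Heps. destruct (H eps Heps) as (W & H0 & HW & He & HS).
  exists (fun v => 1 <= W v /\ forall v', is_prefix v' v -> 1 <= W v' -> v' = v). split.
  - intros l Hn Hl.
    (* A level below all the listed nodes, where the measures of their cones can be counted
       together. *)
    set (D := list_max (map (@length bool) l)).
    assert (HD : forall v, In v l -> (length v <= D)%nat).
    { intros v Hv. assert (HF := list_max_le (map (@length bool) l) D). destruct HF as [HF _].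
      specialize (HF (le_n _)). rewrite Forall_forall in HF. apply HF. apply in_map; auto. }
    apply Rle_trans with (Ex D (fun u => sumR (fun v => indic (is_prefix v u)) l)).
    + rewrite (Ex_sumR D (fun v u => indic (is_prefix v u))). apply sumR_le. intros v Hv.
      rewrite Ex_pre_ind; auto. lra.
    + apply Rle_trans with (W []); auto.
      apply Rle_trans with (Ex D (fun u => indic (hitpre W u))); [|apply maximal_inequality; auto].
      apply Ex_mono. intros u _. eapply Rle_trans; [apply sumR_ind_le1; auto|].
      * intros a b Ha Hb [wa Pa] [wb Pb]. apply Hl in Ha. apply Hl in Hb.
        assert (E : a ++ wa = b ++ wb) by congruence.
        apply app_comparable in E. destruct E as [[e He']|[e He']].
        -- symmetry. apply Ha; [exists e; auto|apply Hb].
        -- apply Hb; [exists e; auto|apply Ha].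
      * apply indic_mono. intros (a & Ha & Pa). exists a. split; auto. apply Hl; auto.
  - intros pi Hpi. destruct (HS pi Hpi) as [n Hn].
    assert (Hmin : exists m, 1 <= W (bprefix pi m) /\ forall k, (k < m)%nat -> ~ 1 <= W (bprefix pi k)).
    { induction n as [n IH] using lt_wf_ind.
      destruct (classic (exists k, (k < n)%nat /\ 1 <= W (bprefix pi k))) as [(k & Hk & Wk)|Hno].
      - eapply IH; eauto.
      - exists n. split; auto. intros k Hk Wk. apply Hno. eauto. }
    destruct Hmin as (m & Hm & Hlt). exists m. split; auto.
    intros v' [w Hw] Hv'. assert (Hle : (length v' <= m)%nat).
    { rewrite <- (bprefix_length pi m), Hw, length_app. lia. }
    assert (E : v' = bprefix pi (length v')).
    { rewrite (bprefix_firstn pi _ m) by auto. rewrite Hw, firstn_app, Nat.sub_diag, firstn_all. simpl.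
      rewrite app_nil_r. auto. }
    destruct (Nat.eq_dec (length v') m) as [e|ne]; [rewrite E, e; auto|].
    exfalso. apply (Hlt (length v')); [lia|]. rewrite <- E. auto.
Qed.

Lemma null_subset (S S' : branch -> Prop) : (forall pi, S pi -> S' pi) -> mu_null S' -> mu_null S.
Proof.
  intros H HS eps He. destruct (HS eps He) as (c & H1 & H2). exists c. split; auto.
Qed.

Theorem null_union (S : nat -> branch -> Prop) :
  (forall n, mu_null (S n)) -> mu_null (fun pi => exists n, S n pi).
Proof.
  intros H eps He.
  assert (Hc : forall n, exists c : nat -> node,
     (forall pi, S n pi -> exists i, bprefix pi (length (c i)) = c i) /\
     (forall N, sumR (fun i => (/ 2) ^ length (c i)) (seq 0 N) <= eps * (/ 2) ^ (1 + n))).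
  { intro n. apply H. apply Rmult_lt_0_compat; auto. apply half_pow_pos. }
  apply choice in Hc. destruct Hc as [c Hc].
  exists (fun k => let '(n, i) := Cantor.of_nat k in c n i). split.
  - intros pi [n Hn]. destruct (Hc n) as [H1 _]. destruct (H1 pi Hn) as [i Hi].
    exists (Cantor.to_nat (n, i)). rewrite Cantor.cancel_of_to. auto.
  - intro N.
    set (f := fun p : nat * nat => (/ 2) ^ length (c (fst p) (snd p))).
    change (sumR (fun k => (/ 2) ^ length (let '(n, i) := Cantor.of_nat k in c n i)) (seq 0 N) <= eps).
    assert (E : sumR (fun k => (/ 2) ^ length (let '(n, i) := Cantor.of_nat k in c n i)) (seq 0 N)
                = sumR f (map Cantor.of_nat (seq 0 N))).
    { rewrite sumR_map. unfold f, sumR. f_equal. apply map_ext. intro k. destruct (Cantor.of_nat k); auto. }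
    rewrite E.
    (* The first [N] pairs in Cantor's enumeration lie in the square of side [N]. *)
    apply Rle_trans with (sumR f (list_prod (seq 0 N) (seq 0 N))).
    + apply sumR_incl.
      * intros [n i]. unfold f. left. apply half_pow_pos.
      * apply FinFun.Injective_map_NoDup; [intros i j; apply Cantor.of_nat_inj|apply seq_NoDup].
      * intros [n i] Hin. apply in_map_iff in Hin. destruct Hin as (k & Hk & Hin).
        apply in_seq in Hin. assert (Hk' := f_equal Cantor.to_nat Hk). rewrite Cantor.cancel_to_of in Hk'.
        assert (Hb := Cantor.to_nat_non_decreasing n i).
        apply in_prod_iff. split; apply in_seq; lia.
    + assert (E2 : forall l, sumR f (list_prod l (seq 0 N)) =
                   sumR (fun n => sumR (fun i => (/ 2) ^ length (c n i)) (seq 0 N)) l).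
      { induction l as [|n l IH]; [reflexivity|]. simpl list_prod. rewrite sumR_app, IH, sumR_map. reflexivity. }
      rewrite E2. apply Rle_trans with (sumR (fun n => eps * (/ 2) ^ (1 + n)) (seq 0 N)).
      * apply sumR_le. intros n _. apply Hc.
      * rewrite sumR_scal, sum_half_pow. assert (Hp := half_pow_pos (1 + N)).
        assert (0 <= eps * (/ 2) ^ (1 + N)) by (apply Rmult_le_pos; lra). simpl in *. lra.
Qed.

(** * Lower bounds: closed sets of positive measure are not null *)

Lemma finitely_many_witnesses (Q : nat -> node -> Prop) d : forall v,
  exists N, forall u, length u = d -> (exists i, Q i (v ++ u)) -> exists i, (i < N)%nat /\ Q i (v ++ u).
Proof.
  induction d as [|d IH]; intro v.
  - destruct (classic (exists i, Q i (v ++ []))) as [[i Hi]|Hno].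
    + exists (S i). intros [|] Hu _; [|discriminate]. exists i. auto.
    + exists 0%nat. intros [|] Hu Hq; [|discriminate]. contradiction.
  - destruct (IH (v ++ [false])) as [N1 H1]. destruct (IH (v ++ [true])) as [N2 H2].
    exists (N1 + N2)%nat. intros [|b u] Hu [i Hi]; [discriminate|]. simpl in Hu. injection Hu as Hu.
    replace (v ++ b :: u) with ((v ++ [b]) ++ u) in * by (rewrite <- app_assoc; auto).
    destruct b; [destruct (H2 u Hu (ex_intro _ i Hi)) as (j & Hj & Hq)|destruct (H1 u Hu (ex_intro _ i Hi)) as (j & Hj & Hq)];
      exists j; split; auto; lia.
Qed.

Lemma Ex_pos_witness n f : 0 < Ex n f -> exists u, length u = n /\ 0 < f u.
Proof.
  intro H. apply NNPP. intro Hno. assert (Ex n f <= Ex n (fun _ => 0)).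
  { apply Ex_mono. intros u Hu. apply Rnot_lt_le. intro. apply Hno. eauto. }
  rewrite Ex_const in H0. lra.
Qed.

Lemma konig (G : node -> Prop) : (forall u v, is_prefix u v -> G v -> G u) ->
  (forall d, exists u, length u = d /\ G u) -> exists pi : branch, forall n, G (bprefix pi n).
Proof.
  intros Hp Hd.
  set (alive := fun u => forall d, exists w, length w = d /\ G (u ++ w)).
  assert (Hs : forall u, alive u -> exists b, alive (u ++ [b])).
  { intros u Hu. apply NNPP. intro Hno.
    assert (Hb : forall b, exists d, forall w, length w = d -> ~ G ((u ++ [b]) ++ w)).
    { intro b. apply NNPP. intro Hb. apply Hno. exists b. intro d. apply NNPP. intro Hw.
      apply Hb. exists d. intros w Hl Hg. apply Hw. eauto. }
    destruct (Hb false) as [d1 H1]. destruct (Hb true) as [d2 H2].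
    destruct (Hu (S (d1 + d2))) as ([|b w] & Hl & Hg); [discriminate|].
    simpl in Hl. injection Hl as Hl.
    replace (u ++ b :: w) with ((u ++ [b]) ++ w) in Hg by (rewrite <- app_assoc; auto).
    destruct b.
    - apply (H2 (firstn d2 w)); [rewrite length_firstn; lia|].
      eapply Hp; [|exact Hg]. exists (skipn d2 w). rewrite <- !app_assoc, firstn_skipn. auto.
    - apply (H1 (firstn d1 w)); [rewrite length_firstn; lia|].
      eapply Hp; [|exact Hg]. exists (skipn d1 w). rewrite <- !app_assoc, firstn_skipn. auto. }
  set (next := fun u => match em (alive (u ++ [false])) with left _ => false | right _ => true end).
  assert (Hn : forall u, alive u -> alive (u ++ [next u])).
  { intros u Hu. unfold next. destruct (em (alive (u ++ [false]))); auto.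
    destruct (Hs u Hu) as [[] Hb]; auto. contradiction. }
  set (path := fix path n := match n with O => [] | S n => path n ++ [next (path n)] end).
  exists (fun n => next (path n)).
  assert (E : forall n, bprefix (fun n => next (path n)) n = path n).
  { induction n as [|n IH]; auto. rewrite bprefix_S, IH. auto. }
  intro n. rewrite E.
  assert (Ha : alive (path n)).
  { induction n as [|n IH]; [exact Hd|]. apply Hn. auto. }
  destruct (Ha 0%nat) as (w & Hw & Hg). destruct w; [|discriminate]. rewrite app_nil_r in Hg. auto.
Qed.

(** A cover of measure [delta / 2] leaves uncovered nodes satisfying [P] at every level, since only
    finitely many of its cones matter at a given level. By König's lemma some branch stays among
    such nodes, so it lies in the set and in no cone of the cover. *)
Theorem closed_not_null (P : node -> Prop) delta : 0 < delta ->
  (forall u v, is_prefix u v -> P v -> P u) ->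
  (forall d, exists n, (d <= n)%nat /\ delta <= Ex n (fun u => indic (P u))) ->
  ~ mu_null (fun pi => forall n, P (bprefix pi n)).
Proof.
  intros Hdelta Hp Hm Hnull. destruct (Hnull (delta / 2)) as (c & Hc & Hs); [lra|].
  set (Cov := fun u => exists i, is_prefix (c i) u).
  assert (HCov : forall d, Ex d (fun u => indic (Cov u)) <= delta / 2).
  { intro d. destruct (finitely_many_witnesses (fun i u => is_prefix (c i) u) d []) as [N HN].
    apply Rle_trans with (Ex d (fun u => sumR (fun i => indic (is_prefix (c i) u)) (seq 0 N))).
    - apply Ex_mono. intros u Hu. unfold indic at 1.
      destruct (em (Cov u)) as [hc|hc].
      + destruct (HN u Hu hc) as (i & Hi & Hpi). simpl in Hpi.
        apply Rle_trans with (sumR (fun i => indic (is_prefix (c i) u)) [i]).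
        * unfold sumR. simpl. rewrite indic_true by auto. lra.
        * apply sumR_incl; [intro; apply indic_bounds|repeat constructor; auto|].
          intros j [<-|[]]. apply in_seq. lia.
      + apply sumR_nonneg. intros; apply indic_bounds.
    - rewrite (Ex_sumR d (fun i u => indic (is_prefix (c i) u))).
      eapply Rle_trans; [|apply (Hs N)].
      change (sumR (fun i => Ex d (fun u => indic (is_prefix (c i) u))) (seq 0 N) <= sumR (fun i => (/ 2) ^ length (c i)) (seq 0 N)).
      apply sumR_le. intros i _. destruct (Nat.le_gt_cases (length (c i)) d).
      + rewrite Ex_pre_ind by auto. lra.
      + apply Rle_trans with (Ex d (fun _ => 0)).
        * apply Ex_mono. intros u Hu. rewrite indic_false; [lra|]. intros [w ->].
          rewrite length_app in Hu. lia.
        * rewrite Ex_const. left. apply half_pow_pos. }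
  destruct (konig (fun u => P u /\ ~ Cov u)) as [pi Hpi].
  - intros u v Huv [H1 H2]. split; [eapply Hp; eauto|]. intros [i [w Hw]]. apply H2. exists i.
    destruct Huv as [w' ->]. exists (w ++ w'). rewrite Hw, app_assoc. auto.
  - intro d. destruct (Hm d) as (n & Hn & Hle).
    destruct (Ex_pos_witness n (fun u => indic (P u) - indic (Cov u))) as (u & Hu & Hpos).
    + rewrite Ex_minus. specialize (HCov n). lra.
    + assert (HP : P u /\ ~ Cov u).
      { unfold indic in Hpos. destruct (em (P u)), (em (Cov u)); try lra; auto. }
      exists (firstn d u). split; [rewrite length_firstn; lia|].
      assert (Hpre : is_prefix (firstn d u) u) by (exists (skipn d u); symmetry; apply firstn_skipn).
      destruct HP as [H1 H2]. split; [eapply Hp; eauto|].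
      intros [i [w Hw]]. apply H2. exists i. destruct Hpre as [w' Hw']. exists (w ++ w').
      rewrite Hw', Hw at 1. rewrite app_assoc. auto.
  - destruct (Hc pi) as [i Hi]; [apply Hpi|]. apply (Hpi (length (c i))). exists i. rewrite Hi.
    exists []. rewrite app_nil_r. auto.
Qed.

Close Scope R_scope.

(** * The automaton, and a tree it accepts when the program halts *)

(* [SFmt] and [SCh] check the letters and the input length, [SX] is the rejecting sink.  Credit: [SBW]
   waits, [SBA] and [SBD] are alive and dead in the current iteration, [SBC] has just received credit.
   Risk: [SN] guesses a counter, [SAct j] follows counter [j], [SD] has stopped at a check, [SR] has lost,
   [SRN] has just won the iteration and guesses again. *)
Inductive st : Type :=
| SInit | SX | SBW | SBA | SBD | SBC | SN | SRN | SR | SD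
| SCh (z : chst) | SFmt (K : stack) | SAct (j : nat) (K : stack).

Definition sprio (s : st) : nat :=
  match s with
  | SBC => 0
  | SX | SBA | SBD | SRN => 1
  | _ => 2
  end.

Definition both (s : st) : list (st * st) := [(s, s)].
Definition coin (s s' : st) : list (st * st) := [(s, s'); (s', s)].

(** After [n] letters 2 of a copy, a run that follows [j] has survived with probability
    [2 ^ (v j - n)]. To win it must stop at a check of [j], by moving to [SD]: at the end of the
    copy, letter 4 turns a run that still follows [j] into [SR], and letter 5 lets it guess again
    without a visit to [SRN]. *)
Definition outs_act (K0 : stack) (j : nat) (K : stack) (a : nat) : list (st * st) :=
  match nexts K0 K a with
  | None => []
  | Some K' =>
      match K with
      | [] => both (if a =? 5 then SN else SR)
      | _ :: _ =>
          match kact K with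
          | Some (Up i) => if i =? j then both (SAct j K') else coin (SAct j K') SR
          | Some (Dn i) => if i =? j then coin (SAct j K') SR else both (SAct j K')
          | Some (Chk i) => both (SAct j K') ++ (if i =? j then both SD else [])
          | None => both (SAct j K')
          end
      end
  end.

Definition outs (K0 : stack) (J x : nat) (s : st) (a : nat) : list (st * st) :=
  match s with
  | SInit => both (SFmt K0) ++ both (SCh (Chn 0)) ++ both SBW ++ both SBD ++ both SN
  | SX => both SX
  | SBW => both SBW ++ both SBD
  | SBA | SBC => match a with 2 => coin SBA SBD | 5 => both SBC | _ => both SBA end
  | SBD => match a with 5 => both SBA | _ => both SBD end
  | SFmt K => match nexts K0 K a with Some K' => both (SFmt K') | None => both SX end
  | SCh z => match chstep x z a with Some z' => both (SCh z') | None => both SX end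
  | SN | SRN => flat_map (fun j => outs_act K0 j K0 a) (seq 0 J)
  | SAct j K => outs_act K0 j K a
  | SD => match a with 2 => coin SD SR | 4 => coin SN SR | 5 => both SRN | _ => both SD end
  | SR => match a with 5 => both SN | _ => both SR end
  end.

Definition srun (K0 : stack) (J x : nat) (t : node -> nat) (rho : node -> st) : Prop :=
  rho [] = SInit /\
  forall u, In (rho (u ++ [false]), rho (u ++ [true])) (outs K0 J x (rho u) (t u)).

(** The parity condition for priorities 0, 1 and 2, stated without naming the state that recurs. *)
Definition sacc (r : nat -> st) : Prop :=
  (forall N, exists n, N <= n /\ sprio (r n) = 0) \/ (exists N, forall n, N <= n -> sprio (r n) <> 1).

Definition symbolic_lang (K0 : stack) (J x : nat) (t : node -> nat) : Prop :=
  (forall u, t u < 6) /\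
  forall rho, srun K0 J x t rho -> mu_null (fun pi => ~ sacc (along rho pi)).

Definition cnt2 (l : list nat) : nat := count_occ Nat.eq_dec l 2.

Ltac solve_pairs :=
  intuition; repeat match goal with H : (_, _) = (_, _) |- _ => inversion H; clear H end; subst.

Section Honest.
Variables (K0 : stack) (J x : nat) (w : list nat).
Hypothesis w_path : okpath K0 1 K0 (fun _ => 0%Z) w.
Hypothesis w_chain : chrun x (Chn 0) w = Some Done.
Hypothesis w_letters : forall a, In a w -> a < 4.
Hypothesis w_coin : In 2 w.

Let L := cnt2 w.

Lemma L_pos : 0 < L.
Proof. unfold L, cnt2. apply count_occ_In. auto. Qed.

(** A position in the honest tree: iteration [cK], the repetitions and copies still to come after
    the present ones, the letters left in the present copy, and the control, counters and input
    check reached so far. *)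
Record config : Type := mkC {
  cK : nat; cRep : nat; cCopies : nat; cRest : list nat; cStack : stack; cVal : counters; cCh : chst }.

Definition start (k rep c : nat) : config := mkC k rep c w K0 (fun _ => 0%Z) (Chn 0).

Definition vnext (K : stack) (v : counters) : counters :=
  match kact K with
  | Some (Up j) => upd v j (v j + 1)%Z
  | Some (Dn j) => upd v j (v j - 1)%Z
  | _ => v
  end.

(** One play of iteration [k] has [S k * L] coin letters, so these repetitions yield one expected
    credit, while their risks add up to [2^-k]. *)
Definition reps (k : nat) : nat := 2 ^ (S k * L).

(* Iteration [k] consists of [k + 1] copies of [w] and is played [reps k] times. *)
Definition cstep (C : config) : config :=
  match cRest C with
  | a :: l =>
      mkC (cK C) (cRep C) (cCopies C) l
        (match nexts K0 (cStack C) a with Some K => K | None => [] end)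
        (vnext (cStack C) (cVal C))
        (match chstep x (cCh C) a with Some z => z | None => Done end)
  | [] =>
      match cCopies C, cRep C with
      | S c, _ => start (cK C) (cRep C) c
      | 0, S r => start (cK C) r (cK C)
      | 0, 0 => start (S (cK C)) (pred (reps (S (cK C)))) (S (cK C))
      end
  end.

Definition cletter (C : config) : nat :=
  match cRest C with
  | a :: _ => a
  | [] => match cCopies C with S _ => 4 | 0 => 5 end
  end.

Definition cfg (n : nat) : config := Nat.iter n cstep (start 0 (pred (reps 0)) 0).

(** Letters depend on depth only, so it does not matter to which child a run gives which outcome of
    a coin. Copies start one level below the root, hence the shift by one. *)
Definition honest (u : node) : nat :=
  match u with [] => 0 | _ :: u' => cletter (cfg (length u')) end.

Definition cinv (C : config) : Prop :=
  okpath K0 1 (cStack C) (cVal C) (cRest C) /\ chrun x (cCh C) (cRest C) = Some Done /\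
  (forall a, In a (cRest C) -> a < 4).

Lemma cinv_start k r c : cinv (start k r c).
Proof. split; [|split]; auto. Qed.

Lemma cinv_step C : cinv C -> cinv (cstep C).
Proof.
  intros (H1 & H2 & H3). unfold cstep. destruct C as [k r c [|a l] K v z]; simpl in *.
  - destruct c; [destruct r|]; apply cinv_start.
  - inversion H1; subst. destruct (chstep x z a) as [z'|]; [|discriminate].
    match goal with H : nexts _ _ _ = Some _ |- _ => rewrite H end. split; [|split]; simpl; auto.
    replace (vnext K v) with v'; auto.
    unfold vnext. destruct (kact K) as [[]|]; simpl in *; intuition.
Qed.

Lemma cinv_cfg n : cinv (cfg n).
Proof. induction n; [apply cinv_start|]. simpl. apply cinv_step; auto. Qed.

Lemma honest_range u : honest u < 6.
Proof.
  destruct u as [|b u]; simpl; [lia|]. destruct (cinv_cfg (length u)) as (_ & _ & H).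
  unfold cletter. destruct (cRest (cfg (length u))) as [|a l]; [destruct (cCopies _); lia|].
  specialize (H a (or_introl eq_refl)). lia.
Qed.

(** The states that a run may have at this position. Excluding [SX] says that the deterministic
    checks never fail; the guessing states occur only where a copy starts. *)
Definition compat (C : config) (s : st) : Prop :=
  match s with
  | SInit | SX => False
  | SBW | SBA | SBD | SBC | SR | SD => True
  | SN | SRN => cRest C = w /\ cStack C = K0 /\ cVal C = fun _ => 0%Z
  | SCh z => cCh C = z
  | SFmt K => cStack C = K
  | SAct j K => cStack C = K
  end.

Lemma cfg_end C : cinv C -> (cRest C = [] <-> cStack C = []).
Proof.
  intros (H & _). destruct C as [k r c l K v z]; simpl in *. inversion H; subst; split; congruence.
Qed.

Lemma nexts_cfg C a l : cinv C -> cRest C = a :: l ->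
  nexts K0 (cStack C) a = Some (cStack (cstep C)) /\ chstep x (cCh C) a = Some (cCh (cstep C)) /\
  kstep 1 (kact (cStack C)) (cVal C) (cVal (cstep C)) /\ cStack C <> [] /\ a < 4 /\
  cK (cstep C) = cK C /\ cRep (cstep C) = cRep C /\ cCopies (cstep C) = cCopies C /\ cRest (cstep C) = l.
Proof.
  intros (H1 & H2 & H3) E. unfold cstep. destruct C as [k r c l' K v z]; simpl in *. subst l'.
  inversion H1; subst. simpl in H2. match goal with H : nexts _ _ _ = Some _ |- _ => rewrite H end. destruct (chstep x z a) as [z'|]; [|discriminate].
  assert (Ev : v' = vnext K v) by (unfold vnext; destruct (kact K) as [[]|]; simpl in *; intuition).
  rewrite <- Ev. repeat split; auto. apply H3. left; auto.
Qed.

Lemma outs_act_compat j C s0 s1 : cinv C ->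
  In (s0, s1) (outs_act K0 j (cStack C) (cletter C)) -> compat (cstep C) s0 /\ compat (cstep C) s1.
Proof.
  intros HC Hin. unfold outs_act in Hin. unfold cletter in Hin.
  destruct (cRest C) as [|a l] eqn:E.
  - assert (cStack C = []) as EK by (apply cfg_end; auto). rewrite EK in Hin. simpl in Hin.
    assert (HS : forall c, cCopies C = c -> compat (cstep C) (match c with S _ => SR | 0 => SN end)).
    { intros c Ec. unfold cstep. rewrite E, Ec. destruct c; simpl; auto. destruct (cRep C); simpl; auto. }
    destruct (cCopies C) as [|c]; simpl in Hin; destruct Hin as [Hin|[]]; inversion Hin; subst;
      split; apply (HS _ eq_refl).
  - destruct (nexts_cfg C a l HC E) as (H1 & _ & _ & H2 & _). rewrite H1 in Hin.
    set (C' := cstep C) in *.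
    destruct (cStack C) as [|p K]; [congruence|].
    destruct (kact (p :: K)) as [[i|i|i]|].
    + destruct (i =? j); simpl in Hin; repeat (destruct Hin as [Hin|Hin]; [inversion Hin; subst; simpl; auto|]);
        destruct Hin.
    + destruct (i =? j); simpl in Hin; repeat (destruct Hin as [Hin|Hin]; [inversion Hin; subst; simpl; auto|]);
        destruct Hin.
    + destruct (i =? j); simpl in Hin; repeat (destruct Hin as [Hin|Hin]; [inversion Hin; subst; simpl; auto|]);
        destruct Hin.
    + simpl in Hin; repeat (destruct Hin as [Hin|Hin]; [inversion Hin; subst; simpl; auto|]); destruct Hin.
Qed.

Lemma start_after_end C : cinv C -> cletter C = 4 \/ cletter C = 5 ->
  exists k r c, cstep C = start k r c.
Proof.
  intros (_ & _ & H) Ha. unfold cletter, cstep in *. destruct (cRest C) as [|a l].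
  - destruct (cCopies C); [destruct (cRep C)|]; eauto.
  - specialize (H a (or_introl eq_refl)). lia.
Qed.

Lemma cletter_cases C : cinv C -> cletter C < 6.
Proof.
  intros (_ & _ & H). unfold cletter. destruct (cRest C) as [|a l]; [destruct (cCopies C); lia|].
  specialize (H a (or_introl eq_refl)). lia.
Qed.

Lemma compat_step C s s0 s1 : cinv C -> compat C s ->
  In (s0, s1) (outs K0 J x s (cletter C)) -> compat (cstep C) s0 /\ compat (cstep C) s1.
Proof.
  intros HC Hs Hin.
  assert (Hlt := cletter_cases C HC).
  assert (HF : cletter C = 4 \/ cletter C = 5 -> forall s, s = SN \/ s = SRN -> compat (cstep C) s).
  { intros Ha s' Hs'. destruct (start_after_end C HC Ha) as (k & r & c & ->).
    destruct Hs' as [-> | ->]; simpl; auto. }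
  assert (HN : In (s0, s1) (flat_map (fun j => outs_act K0 j K0 (cletter C)) (seq 0 J)) ->
     cStack C = K0 -> compat (cstep C) s0 /\ compat (cstep C) s1).
  { intros Hi E. apply in_flat_map in Hi. destruct Hi as (j & _ & Hi). apply outs_act_compat with j; auto.
    rewrite E. auto. }
  destruct s; cbn [compat] in Hs; cbn [outs] in Hin; try contradiction.
  - simpl in Hin. solve_pairs; simpl; auto.
  - letters (cletter C); simpl in Hin; solve_pairs; simpl; auto.
  - letters (cletter C); simpl in Hin; solve_pairs; simpl; auto.
  - letters (cletter C); simpl in Hin; solve_pairs; simpl; auto.
  - apply HN; tauto.
  - apply HN; tauto.
  - destruct (cletter C) as [|[|[|[|[|[|]]]]]] eqn:E; simpl in Hin; solve_pairs; try exact I; auto.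
  - destruct (cletter C) as [|[|[|[|[|[|]]]]]] eqn:E; simpl in Hin; solve_pairs; try exact I; auto.
  - unfold cletter in Hin. destruct (cRest C) as [|a l] eqn:E.
    + destruct HC as (_ & HC & _). rewrite E in HC. simpl in HC. inversion HC. subst z. rewrite H0 in *.
      simpl in Hin. unfold cstep. rewrite E.
      destruct (cCopies C); simpl in Hin; destruct Hin as [Hin|[]]; inversion Hin; subst;
        [destruct (cRep C)|]; simpl; auto.
    + destruct (nexts_cfg C a l HC E) as (_ & H1 & _). subst z. rewrite H1 in Hin.
      destruct Hin as [Hin|[]]; inversion Hin; subst; simpl; auto.
  - unfold cletter in Hin. destruct (cRest C) as [|a l] eqn:E.
    + assert (cStack C = []) as EK by (apply cfg_end; auto). subst K. rewrite EK in Hin. simpl in Hin.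
      unfold cstep. rewrite E.
      destruct (cCopies C); simpl in Hin; destruct Hin as [Hin|[]]; inversion Hin; subst;
        [destruct (cRep C)|]; simpl; auto.
    + destruct (nexts_cfg C a l HC E) as (H1 & _). subst K. rewrite H1 in Hin.
      destruct Hin as [Hin|[]]; inversion Hin; subst; simpl; auto.
  - subst K. apply outs_act_compat with j; auto.
Qed.

(** * Potentials for risk and credit on the honest tree *)

Local Open Scope R_scope.

(** Bound for the risk after the current play of iteration [k]: each of the [cRep] remaining plays
    contributes [2^-((k+1)L + k)], and the later iterations contribute the sum of [2^-i] over
    [i > k]. *)
Definition risk_tail (C : config) : R :=
  INR (cRep C) * (/ 2) ^ (S (cK C) * L + cK C) + (/ 2) ^ (cK C).

(** Coins that a stopped run has yet to win in this iteration: each further copy costs [L] and the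
    one at the letter 4 before it. *)
Definition rem (C : config) : nat := (cnt2 (cRest C) + cCopies C * S L)%nat.

(* Bounds the expected number of future visits to [SRN]. *)
Definition risk_pot (C : config) (s : st) : R :=
  match s with
  | SN | SRN | SD => (/ 2) ^ rem C + risk_tail C
  | SAct j _ => (/ 2) ^ rem C * powerRZ 2 (- cVal C j) + risk_tail C
  | SR => risk_tail C
  | _ => 0
  end.

Definition is_risk (s : st) : R := match s with SRN => 1 | _ => 0 end.

Lemma risk_tail_nonneg C : 0 <= risk_tail C.
Proof.
  unfold risk_tail. assert (H1 := half_pow_pos (S (cK C) * L + cK C)). assert (H2 := half_pow_pos (cK C)).
  assert (H3 := pos_INR (cRep C)). assert (0 <= INR (cRep C) * (/ 2) ^ (S (cK C) * L + cK C)) by (apply Rmult_le_pos; lra). lra.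
Qed.

Lemma pow2Z_pos z : 0 < powerRZ 2 z.
Proof. apply powerRZ_lt. lra. Qed.

Lemma risk_pot_nonneg C s : 0 <= risk_pot C s.
Proof.
  assert (H := risk_tail_nonneg C). assert (H1 := half_pow_pos (rem C)).
  destruct s; simpl; try lra.
  assert (0 <= (/ 2) ^ rem C * powerRZ 2 (- cVal C j)); [|lra].
  apply Rmult_le_pos; [lra|]. left; apply pow2Z_pos.
Qed.

Lemma INR_reps k : INR (reps k) * (/ 2) ^ (S k * L) = 1.
Proof.
  unfold reps. rewrite pow_INR. simpl INR. rewrite <- Rpow_mult_distr.
  replace ((1 + 1) * / 2) with 1 by lra. apply pow1.
Qed.

Lemma reps_pos k : (0 < reps k)%nat.
Proof. unfold reps. apply Nat.neq_0_lt_0. apply Nat.pow_nonzero. lia. Qed.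

Lemma step_inside C a l : cinv C -> cRest C = a :: l ->
  risk_tail (cstep C) = risk_tail C /\ rem C = (rem (cstep C) + (if Nat.eq_dec a 2 then 1 else 0))%nat.
Proof.
  intros HC E. destruct (nexts_cfg C a l HC E) as (_ & _ & _ & _ & _ & E1 & E2 & E3 & E4).
  unfold risk_tail, rem. rewrite E1, E2, E3, E4, E. split; auto.
  unfold cnt2. simpl. destruct (Nat.eq_dec a 2); lia.
Qed.

Lemma step_copy C c : cRest C = [] -> cCopies C = S c ->
  risk_tail (cstep C) = risk_tail C /\ rem C = S (rem (cstep C)).
Proof.
  intros E Ec. unfold cstep, risk_tail, rem. rewrite E, Ec. simpl. split; auto.
Qed.

(** A new play takes its own term out of the tail. On passing to [k + 1], the old [2^-k] splits into
    two halves: one is spread over the [reps (k + 1)] plays, the other is the new tail. *)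
Lemma step_iter C : cRest C = [] -> cCopies C = 0%nat ->
  (/ 2) ^ rem (cstep C) + risk_tail (cstep C) = risk_tail C /\ rem C = 0%nat.
Proof.
  intros E Ec. unfold cstep, risk_tail, rem. rewrite E, Ec. split; [|unfold cnt2; simpl; lia].
  destruct (cRep C) as [|r]; cbn [cRest start cCopies cRep cK].
  - fold L. set (k := S (cK C)).
    replace (L + k * S L)%nat with (S k * L + k)%nat by lia.
    assert (H := INR_reps k). assert (Hp := reps_pos k).
    rewrite pow_add.
    assert (E1 : INR (pred (reps k)) = INR (reps k) - 1).
    { destruct (reps k); [lia|]. simpl pred. rewrite S_INR. lra. }
    rewrite E1. replace ((/ 2) ^ cK C) with (2 * (/ 2) ^ k) by (unfold k; simpl; lra).
    simpl INR.
    transitivity (INR (reps k) * (/ 2) ^ (S k * L) * (/ 2) ^ k + (/ 2) ^ k); [ring|]. rewrite H. ring.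
  - fold L. replace (L + cK C * S L)%nat with (S (cK C) * L + cK C)%nat by lia.
    rewrite S_INR. ring.
Qed.

Lemma avg_both (f : st -> R) s s0 s1 : In (s0, s1) (both s) -> (f s0 + f s1) / 2 = f s.
Proof. intros [H|[]]. inversion H. lra. Qed.

Lemma avg_coin (f : st -> R) s s' s0 s1 : In (s0, s1) (coin s s') -> (f s0 + f s1) / 2 = (f s + f s') / 2.
Proof. intros [H|[H|[]]]; inversion H; lra. Qed.

Lemma upd_pow2 (v : counters) i j d :
  powerRZ 2 (- upd v i (v i + d)%Z j) = if (i =? j)%nat then powerRZ 2 (- v j) * powerRZ 2 (- d) else powerRZ 2 (- v j).
Proof.
  unfold upd. destruct (Nat.eq_dec j i), (Nat.eqb_spec i j); subst; try congruence; auto.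
  rewrite <- powerRZ_add by lra. f_equal. lia.
Qed.

(** At increments and decrements the coin, [rem] and the weight [2^-(v j)] balance exactly. Stopping
    replaces this weight by 1, which is no gain as long as the check is right. *)
Lemma risk_super_act j C s0 s1 : cinv C ->
  In (s0, s1) (outs_act K0 j (cStack C) (cletter C)) ->
  (risk_pot (cstep C) s0 + is_risk s0 + (risk_pot (cstep C) s1 + is_risk s1)) / 2 <=
  risk_pot C (SAct j (cStack C)).
Proof.
  intros HC Hin.
  set (f := fun s => risk_pot (cstep C) s + is_risk s). change ((f s0 + f s1) / 2 <= risk_pot C (SAct j (cStack C))).
  assert (Hp := half_pow_pos (rem C)). assert (Hq := pow2Z_pos (- cVal C j)).
  assert (Hpq : 0 < (/ 2) ^ rem C * powerRZ 2 (- cVal C j)) by (apply Rmult_lt_0_compat; auto).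
  unfold outs_act, cletter in Hin. destruct (cRest C) as [|a l] eqn:E.
  - assert (cStack C = []) as EK by (apply cfg_end; auto). rewrite EK in Hin. simpl in Hin.
    destruct (cCopies C) as [|c] eqn:Ec; simpl in Hin.
    + rewrite (avg_both f SN) by auto. destruct (step_iter C E Ec) as [H _].
      unfold f. simpl. lra.
    + rewrite (avg_both f SR) by auto. destruct (step_copy C c E Ec) as [H _].
      unfold f. simpl. rewrite H. lra.
  - destruct (nexts_cfg C a l HC E) as (H1 & _ & Hk & H2 & _).
    destruct (step_inside C a l HC E) as [Ht Hr].
    assert (Ha : a = match kact (cStack C) with Some (Up _) => 2%nat | _ => a end /\
                 (match kact (cStack C) with Some (Up _) => True | _ => a <> 2%nat end)).
    { clear -H1 H2. destruct (cStack C) as [|[[|[]]| |] K]; simpl in *; try congruence; destruct a as [|[|[|[|]]]]; try discriminate; auto. }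
    rewrite H1 in Hin. destruct (cStack C) as [|p K] eqn:EK; [congruence|].
    destruct (kact (p :: K)) as [[i|i|i]|]; simpl in Hk; destruct Ha as [Ha1 Ha2].
    + rewrite Ha1 in Hr. simpl in Hr. rewrite Nat.add_1_r in Hr.
      assert (Hv := upd_pow2 (cVal C) i j 1). rewrite <- Hk in Hv.
      replace (powerRZ 2 (-1)) with (/ 2) in Hv by (simpl; lra).
      rewrite Hr in *. destruct (i =? j)%nat.
      * rewrite (avg_both f _ _ _ Hin). unfold f. simpl. rewrite Hv, Ht, Hr. simpl. lra.
      * rewrite (avg_coin f _ _ _ _ Hin). unfold f. simpl. rewrite Hv, Ht, Hr. simpl. lra.
    + destruct (Nat.eq_dec a 2); [congruence|]. rewrite Nat.add_0_r in Hr.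
      assert (Hv := upd_pow2 (cVal C) i j (-1)). replace (cVal C i + -1)%Z with (cVal C i - 1)%Z in Hv by lia.
      rewrite <- Hk in Hv. replace (powerRZ 2 (- -1)) with 2 in Hv by (simpl; lra).
      destruct (i =? j)%nat.
      * rewrite (avg_coin f _ _ _ _ Hin). unfold f. simpl. rewrite Hv, Ht, Hr. lra.
      * rewrite (avg_both f _ _ _ Hin). unfold f. simpl. rewrite Hv, Ht, Hr. lra.
    + destruct (Nat.eq_dec a 2); [congruence|]. rewrite Nat.add_0_r in Hr. destruct Hk as [Hk Hv].
      apply in_app_iff in Hin. destruct Hin as [Hin|Hin].
      * rewrite (avg_both f _ _ _ Hin). unfold f. simpl. rewrite Hv, Ht, Hr. lra.
      * destruct (Nat.eqb_spec i j); [|destruct Hin]. subst i.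
        rewrite (avg_both f _ _ _ Hin). unfold f. simpl. rewrite Ht, <- Hr.
        (* Correctness of the copy enters here: with threshold 1 the check gives [v j <= 0]. *)
        assert (1 <= powerRZ 2 (- cVal C j)).
        { destruct (Z.opp (cVal C j)) as [|q|q] eqn:Eq; [simpl; lra| |lia].
          simpl. apply pow_R1_Rle. lra. }
        assert ((/ 2) ^ rem C * 1 <= (/ 2) ^ rem C * powerRZ 2 (- cVal C j)) by (apply Rmult_le_compat_l; lra).
        lra.
    + destruct (Nat.eq_dec a 2); [congruence|]. rewrite Nat.add_0_r in Hr.
      rewrite (avg_both f _ _ _ Hin). unfold f. simpl. rewrite Hk, Ht, Hr. lra.
Qed.

Lemma risk_super C s s0 s1 : cinv C -> compat C s ->
  In (s0, s1) (outs K0 J x s (cletter C)) ->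
  (risk_pot (cstep C) s0 + is_risk s0 + (risk_pot (cstep C) s1 + is_risk s1)) / 2 <= risk_pot C s.
Proof.
  intros HC Hs Hin. assert (Hlt := cletter_cases C HC).
  set (f := fun s => risk_pot (cstep C) s + is_risk s).
  assert (HN : In (s0, s1) (flat_map (fun j => outs_act K0 j K0 (cletter C)) (seq 0 J)) ->
     cStack C = K0 -> cVal C = (fun _ => 0%Z) -> (f s0 + f s1) / 2 <= (/ 2) ^ rem C + risk_tail C).
  { intros Hi E Ev. apply in_flat_map in Hi. destruct Hi as (j & _ & Hi).
    assert (Hi' : In (s0, s1) (outs_act K0 j (cStack C) (cletter C))) by (rewrite E; auto).
    clear Hi. rename Hi' into Hi. apply risk_super_act in Hi; auto. simpl in Hi. rewrite Ev in Hi. simpl in Hi.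
    unfold f. lra. }
  change ((f s0 + f s1) / 2 <= risk_pot C s).
  assert (Z0 : forall s, In (s0, s1) (both s) -> f s = 0 -> (f s0 + f s1) / 2 <= 0).
  { intros s' Hi E. rewrite (avg_both f s') by auto. lra. }
  destruct s; cbn [compat] in Hs; cbn [outs] in Hin; try contradiction; try (cbn [risk_pot]).
  - simpl in Hin. solve_pairs; unfold f; simpl; lra.
  - letters (cletter C); simpl in Hin; solve_pairs; unfold f; simpl; lra.
  - letters (cletter C); simpl in Hin; solve_pairs; unfold f; simpl; lra.
  - letters (cletter C); simpl in Hin; solve_pairs; unfold f; simpl; lra.
  - apply HN; tauto.
  - apply HN; tauto.
  - unfold cletter in Hin. destruct (cRest C) as [|a l] eqn:E.
    + destruct (cCopies C) as [|c] eqn:Ec.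
      * rewrite (avg_both f _ _ _ Hin). destruct (step_iter C E Ec) as [H _]. unfold f; simpl. lra.
      * rewrite (avg_both f _ _ _ Hin). destruct (step_copy C c E Ec) as [H _]. unfold f; simpl. lra.
    + destruct (nexts_cfg C a l HC E) as (_ & _ & _ & _ & Ha & _).
      destruct (step_inside C a l HC E) as [Ht Hr].
      assert (Hi : In (s0, s1) (both SR)) by (destruct a as [|[|[|[|]]]]; auto; lia).
      rewrite (avg_both f _ _ _ Hi). unfold f; simpl. lra.
  - unfold cletter in Hin. destruct (cRest C) as [|a l] eqn:E.
    + destruct (cCopies C) as [|c] eqn:Ec.
      * rewrite (avg_both f _ _ _ Hin). destruct (step_iter C E Ec) as [H Hr]. unfold f; simpl. rewrite Hr. simpl. lra.
      * rewrite (avg_coin f _ _ _ _ Hin). destruct (step_copy C c E Ec) as [H Hr]. unfold f; simpl.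
        rewrite H, Hr. simpl. lra.
    + destruct (nexts_cfg C a l HC E) as (_ & _ & _ & _ & Ha & _).
      destruct (step_inside C a l HC E) as [Ht Hr].
      destruct (Nat.eq_dec a 2) as [->|].
      * rewrite (avg_coin f _ _ _ _ Hin). unfold f; simpl. rewrite Ht, Hr, Nat.add_1_r. simpl. lra.
      * assert (Hi : In (s0, s1) (both SD)) by (destruct a as [|[|[|[|]]]]; auto; lia).
        rewrite (avg_both f _ _ _ Hi). unfold f; simpl. rewrite Ht, Hr, Nat.add_0_r. lra.
  - destruct (chstep x z (cletter C)); eapply Z0; eauto; unfold f; simpl; lra.
  - destruct (nexts K0 K (cletter C)); eapply Z0; eauto; unfold f; simpl; lra.
  - subst K. apply risk_super_act; auto.
Qed.

(* [credit_pot] is a supermartingale until credit is received, and is unbounded if it never is. *)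
Definition credit_base (C : config) : R :=
  (1 - (/ 2) ^ (S (cK C) * L)) ^ cRep C * 2 ^ cK C.

Definition crem (C : config) : nat := (cnt2 (cRest C) + cCopies C * L)%nat.

Definition credit_pot (C : config) (s : st) : R :=
  match s with
  | SBA => (1 - (/ 2) ^ crem C) * credit_base C
  | SBD => credit_base C
  | _ => 0
  end.

Lemma half_pow_le1 n : (/ 2) ^ n <= 1.
Proof. rewrite <- (pow1 n). apply pow_incr. lra. Qed.

Lemma half_pow_le_half n : (0 < n)%nat -> (/ 2) ^ n <= / 2.
Proof. destruct n; [lia|]. intros _. simpl. assert (H := half_pow_le1 n). lra. Qed.

Lemma half_pow_anti m n : (m <= n)%nat -> (/ 2) ^ n <= (/ 2) ^ m.
Proof.
  intro H. replace n with (m + (n - m))%nat by lia. rewrite pow_add.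
  assert (H1 := half_pow_pos m). assert (H2 := half_pow_le1 (n - m)).
  rewrite <- (Rmult_1_r ((/ 2) ^ m)) at 2. apply Rmult_le_compat_l; lra.
Qed.

Lemma credit_base_bounds C : 0 <= credit_base C <= 2 ^ cK C.
Proof.
  unfold credit_base. assert (H1 := half_pow_le1 (S (cK C) * L)). assert (H2 := half_pow_pos (S (cK C) * L)).
  assert (H3 : 0 < 2 ^ cK C) by (apply pow_lt; lra).
  assert (0 <= (1 - (/ 2) ^ (S (cK C) * L)) ^ cRep C) by (apply pow_le; lra).
  assert ((1 - (/ 2) ^ (S (cK C) * L)) ^ cRep C <= 1).
  { apply Rle_trans with (1 ^ cRep C); [apply pow_incr; lra|rewrite pow1; lra]. }
  split; [apply Rmult_le_pos; lra|].
  rewrite <- (Rmult_1_l (2 ^ cK C)) at 2. apply Rmult_le_compat_r; lra.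
Qed.

Lemma credit_pot_bounds C s : 0 <= credit_pot C s <= 2 ^ cK C.
Proof.
  assert (H := credit_base_bounds C). assert (H1 := half_pow_le1 (crem C)). assert (H2 := half_pow_pos (crem C)).
  assert (0 < 2 ^ cK C) by (apply pow_lt; lra).
  destruct s; simpl; try lra. split; [apply Rmult_le_pos; lra|].
  apply Rle_trans with (1 * credit_base C); [|lra]. apply Rmult_le_compat_r; lra.
Qed.

(* Bernoulli: (1-q)^R (1+q)^R <= 1 and (1+q)^R >= 1 + R q = 2. *)
Lemma no_credit_half k : (1 - (/ 2) ^ (S k * L)) ^ reps k <= / 2.
Proof.
  set (q := (/ 2) ^ (S k * L)). assert (Hq := half_pow_pos (S k * L)). fold q in Hq.
  assert (Hq1 := half_pow_le1 (S k * L)). fold q in Hq1.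
  assert (H1 := poly (reps k) q Hq). assert (H2 := INR_reps k). fold q in H2. rewrite H2 in H1.
  assert (H3 : (1 - q) ^ reps k * (1 + q) ^ reps k <= 1).
  { rewrite <- Rpow_mult_distr. apply Rle_trans with (1 ^ reps k); [|rewrite pow1; lra]. apply pow_incr.
    replace ((1 - q) * (1 + q)) with (1 - q * q) by ring.
    assert (0 <= q * q) by (apply Rmult_le_pos; lra).
    assert (q * q <= 1 * 1) by (apply Rmult_le_compat; lra). lra. }
  assert (H4 : 0 <= (1 - q) ^ reps k) by (apply pow_le; lra).
  assert ((1 - q) ^ reps k * 2 <= (1 - q) ^ reps k * (1 + q) ^ reps k) by (apply Rmult_le_compat_l; lra).
  lra.
Qed.

(** A new play uses up one factor [1 - q]. On passing to [k + 1] the factor [2^k] doubles, and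
    [no_credit_half] pays for it: all plays of an iteration miss credit with probability at most one
    half. *)
Lemma credit_iter C : cRest C = [] -> cCopies C = 0%nat ->
  (1 - (/ 2) ^ crem (cstep C)) * credit_base (cstep C) <= credit_base C.
Proof.
  intros E Ec. unfold cstep, crem, credit_base. rewrite E, Ec.
  destruct (cRep C) as [|r]; cbn [cRest start cCopies cRep cK]; fold L.
  - set (k := S (cK C)). replace (L + k * L)%nat with (S k * L)%nat by lia.
    assert (H := no_credit_half k). assert (Hp := reps_pos k).
    rewrite <- Rmult_assoc, tech_pow_Rmult.
    replace (S (pred (reps k))) with (reps k) by lia.
    assert (0 < 2 ^ cK C) by (apply pow_lt; lra).
    replace (2 ^ k) with (2 * 2 ^ cK C) by (unfold k; simpl; lra). simpl pow at 3.
    apply Rle_trans with (/ 2 * (2 * 2 ^ cK C)); [|lra]. apply Rmult_le_compat_r; lra.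
  - replace (L + cK C * L)%nat with (S (cK C) * L)%nat by lia.
    rewrite <- Rmult_assoc, tech_pow_Rmult. lra.
Qed.

Lemma credit_super C s s0 s1 : cinv C -> s = SBA \/ s = SBD ->
  In (s0, s1) (outs K0 J x s (cletter C)) ->
  (credit_pot (cstep C) s0 + credit_pot (cstep C) s1) / 2 <= credit_pot C s.
Proof.
  intros HC Hs Hin. set (f := credit_pot (cstep C)). change ((f s0 + f s1) / 2 <= credit_pot C s).
  assert (Hb := credit_pot_bounds C s).
  unfold cletter in Hin. destruct (cRest C) as [|a l] eqn:E.
  - destruct (cCopies C) as [|c] eqn:Ec.
    + destruct Hs as [-> | ->]; cbn [outs] in Hin.
      * rewrite (avg_both f _ _ _ Hin). unfold f. simpl in *. lra.
      * rewrite (avg_both f _ _ _ Hin). unfold f. apply credit_iter; auto.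
    + assert (Eb : credit_base (cstep C) = credit_base C).
      { unfold cstep, credit_base. rewrite E, Ec. auto. }
      assert (Er : crem (cstep C) = crem C).
      { unfold cstep, crem. rewrite E, Ec. simpl. fold L. lia. }
      destruct Hs as [-> | ->]; cbn [outs] in Hin; rewrite (avg_both f _ _ _ Hin); unfold f; simpl;
        rewrite Eb; try rewrite Er; lra.
  - destruct (nexts_cfg C a l HC E) as (_ & _ & _ & _ & Ha & E1 & E2 & E3 & E4).
    assert (Eb : credit_base (cstep C) = credit_base C) by (unfold credit_base; rewrite E1, E2; auto).
    assert (Er : crem C = (crem (cstep C) + (if Nat.eq_dec a 2 then 1 else 0))%nat).
    { unfold crem. rewrite E3, E4, E. unfold cnt2. simpl. destruct (Nat.eq_dec a 2); lia. }
    destruct Hs as [-> | ->]; cbn [outs] in Hin.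
    + destruct (Nat.eq_dec a 2) as [->|].
      * rewrite (avg_coin f _ _ _ _ Hin). unfold f. simpl. rewrite Er, Eb, Nat.add_1_r. simpl. lra.
      * assert (Hi : In (s0, s1) (both SBA)) by (destruct a as [|[|[|[|]]]]; auto; lia).
        rewrite (avg_both f _ _ _ Hi). unfold f. simpl. rewrite Er, Eb, Nat.add_0_r. lra.
    + assert (Hi : In (s0, s1) (both SBD)) by (destruct a as [|[|[|[|]]]]; auto; lia).
      rewrite (avg_both f _ _ _ Hi). unfold f. simpl. rewrite Eb. lra.
Qed.

(** * Every iteration is reached *)

Lemma cstep_rest l : forall k r c K v z, cinv (mkC k r c l K v z) ->
  exists n K' v' z', Nat.iter n cstep (mkC k r c l K v z) = mkC k r c [] K' v' z'.
Proof.
  induction l as [|a l IH]; intros k r c K v z HC.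
  - exists 0%nat, K, v, z. auto.
  - assert (HC' := cinv_step _ HC). unfold cstep in HC'. simpl in HC'.
    destruct (IH _ _ _ _ _ _ HC') as (n & K' & v' & z' & H).
    exists (S n), K', v', z'. rewrite Nat.iter_succ_r. exact H.
Qed.

Lemma reach_next_iter c : forall k r, exists n,
  Nat.iter n cstep (start k r c) =
  match r with S r' => start k r' k | 0%nat => start (S k) (pred (reps (S k))) (S k) end.
Proof.
  induction c as [|c IH]; intros k r.
  - destruct (cstep_rest w k r 0%nat K0 (fun _ => 0%Z) (Chn 0) (cinv_start _ _ _)) as (n & K & v & z & H).
    exists (S n). simpl. unfold start at 1. rewrite H. destruct r; reflexivity.
  - destruct (cstep_rest w k r (S c) K0 (fun _ => 0%Z) (Chn 0) (cinv_start _ _ _)) as (n & K & v & z & H).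
    destruct (IH k r) as (m & Hm). exists (m + S n)%nat. rewrite Nat.iter_add. simpl Nat.iter at 2.
    unfold start at 1. rewrite H. exact Hm.
Qed.

Lemma reach_last_rep r : forall k c, exists n c', Nat.iter n cstep (start k r c) = start k 0%nat c' /\ (c' = c \/ c' = k).
Proof.
  induction r as [|r IH]; intros k c.
  - exists 0%nat, c. auto.
  - destruct (reach_next_iter c k (S r)) as (n & Hn).
    destruct (IH k k) as (m & c' & Hm & Hc).
    exists (m + n)%nat, c'. rewrite Nat.iter_add, Hn. split; auto. destruct Hc; auto.
Qed.

(** At the start of the last play of iteration [k] the potentials are easy to read: [risk_tail] is
    [2^-k] and [credit_base] is [2^k]. *)
Lemma reach_start k : exists n, cfg n = start k 0 k.
Proof.
  assert (Hl : forall r k, exists n, Nat.iter n cstep (start k r k) = start k 0%nat k).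
  { intros r k'. destruct (reach_last_rep r k' k') as (n & c' & Hn & Hc).
    exists n. destruct Hc; subst; auto. }
  induction k as [|k [n IH]].
  - apply Hl.
  - destruct (reach_next_iter k k 0%nat) as (m & Hm). destruct (Hl (pred (reps (S k))) (S k)) as (p & Hp).
    exists (p + (m + n))%nat. unfold cfg in *. rewrite !Nat.iter_add, IH, Hm. auto.
Qed.

Lemma cK_cfg n : (cK (cfg n) <= n)%nat.
Proof.
  induction n as [|n IH]; [simpl; lia|]. simpl. unfold cstep.
  destruct (cRest (cfg n)); simpl; [destruct (cCopies (cfg n)); simpl; [destruct (cRep (cfg n)); simpl|]|]; lia.
Qed.

Lemma honest_at u n : length u = S n -> honest u = cletter (cfg n).
Proof. destruct u as [|b u]; [discriminate|]. intro H. injection H as <-. reflexivity. Qed.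

(** * Rejecting branches of a run on the honest tree form a null set *)

Section Run.
Variable rho : node -> st.
Hypothesis Hrun : srun K0 J x honest rho.

Lemma run_step u n : length u = S n ->
  In (rho (u ++ [false]), rho (u ++ [true])) (outs K0 J x (rho u) (cletter (cfg n))).
Proof. intro H. rewrite <- (honest_at u n H). apply Hrun. Qed.

Lemma run_compat n : forall u, length u = S n -> compat (cfg n) (rho u).
Proof.
  induction n as [|n IH]; intros u Hu.
  - destruct u as [|b [|]]; try discriminate. destruct Hrun as [H0 H1]. specialize (H1 []).
    rewrite H0 in H1. simpl in H1.
    assert (compat (cfg 0) (rho [false]) /\ compat (cfg 0) (rho [true])) as [A B].
    { destruct H1 as [H1|[H1|[H1|[H1|[H1|[]]]]]]; injection H1 as E1 E2; rewrite <- E1, <- E2; simpl; auto. }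
    destruct b; auto.
  - destruct u as [|b u _] using rev_ind; [discriminate|]. rewrite length_app in Hu. simpl in Hu.
    assert (Hl : length u = S n) by lia.
    destruct (compat_step (cfg n) (rho u) _ _ (cinv_cfg n) (IH u Hl) (run_step u n Hl)) as [A B].
    destruct b; auto.
Qed.

(** The supermartingale is constant down to a level where the potential, at most [2 * 2^-k], is
    below [eps]; from there it is the potential plus the visit at the current node. Infinitely many
    visits include one below that level, where the value is at least 1. *)
Lemma risk_null : mu_null (fun pi => forall N, exists n, (N <= n)%nat /\ along rho pi n = SRN).
Proof.
  apply null_of_supermart. intros eps Heps.
  destruct (half_pow_small (eps / 2)) as [k Hk]; [lra|]. destruct (reach_start k) as [n0 Hn0].
  set (N := S n0).
  set (W := fun u => if le_dec (length u) N then eps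
                     else risk_pot (cfg (pred (length u))) (rho u) + is_risk (rho u)).
  assert (Hr : forall s, 0 <= is_risk s) by (intros []; simpl; lra).
  assert (Hstep : forall u n, length u = S n ->
     (risk_pot (cfg (S n)) (rho (u ++ [false])) + is_risk (rho (u ++ [false])) +
     (risk_pot (cfg (S n)) (rho (u ++ [true])) + is_risk (rho (u ++ [true])))) / 2 <= risk_pot (cfg n) (rho u)).
  { intros u n Hu. apply risk_super; [apply cinv_cfg|apply run_compat; auto|apply run_step; auto]. }
  exists W. split; [|split; [|split]].
  - intro u. unfold W. destruct (le_dec (length u) N); [lra|].
    assert (H1 := risk_pot_nonneg (cfg (pred (length u))) (rho u)). assert (H2 := Hr (rho u)). lra.
  - intro u. unfold W. rewrite !length_app. simpl length.
    destruct (le_dec (length u + 1) N) as [h|h].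
    + destruct (le_dec (length u) N); [lra|lia].
    + assert (exists n, length u = S n) as [n Hn] by (exists (pred (length u)); lia).
      replace (pred (length u + 1)) with (S n) by lia. specialize (Hstep u n Hn).
      eapply Rle_trans; [exact Hstep|].
      destruct (le_dec (length u) N) as [h'|h'].
      * assert (n = n0) by lia. subst n. rewrite Hn0.
        assert (Ht : risk_tail (start k 0 k) = (/ 2) ^ k) by (unfold risk_tail; simpl; lra).
        assert (He : (/ 2) ^ rem (start k 0 k) <= (/ 2) ^ k).
        { apply half_pow_anti. unfold rem. simpl. lia. }
        assert (Hp := half_pow_pos (rem (start k 0 k))).
        destruct (rho u); simpl risk_pot; rewrite ?Ht; simpl powerRZ; lra.
      * rewrite Hn. simpl pred. specialize (Hr (rho u)). lra.
  - unfold W. simpl. lra.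
  - intros pi Hpi. destruct (Hpi (S N)) as (n & Hn & En). exists n. unfold W. rewrite bprefix_length.
    destruct (le_dec n N); [lia|]. unfold along in En. rewrite En.
    assert (H := risk_pot_nonneg (cfg (pred n)) SRN). simpl is_risk. lra.
Qed.

(** The potential scaled by [2^-k] is below [eps] at level [N + 1]; but a branch without credit up
    to the last play of iteration [S k + N] has potential at least [2^(k + N)] there. The indicator
    drops branches that leave [SBA] and [SBD], since the potential may grow after a credit. *)
Lemma credit_null N : mu_null (fun pi => forall n, (S N <= n)%nat -> along rho pi n = SBA \/ along rho pi n = SBD).
Proof.
  apply null_of_supermart. intros eps Heps.
  assert (Hpos : 0 < 2 ^ cK (cfg N)) by (apply pow_lt; lra).
  destruct (half_pow_small (eps / 2 ^ cK (cfg N))) as [k Hk]; [apply Rdiv_lt_0_compat; lra|].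
  assert (Hkp := half_pow_pos k).
  set (allB := fun u => forall v, is_prefix v u -> (S N <= length v)%nat -> rho v = SBA \/ rho v = SBD).
  set (W := fun u => if le_dec (length u) (S N) then eps
                     else indic (allB u) * ((/ 2) ^ k * credit_pot (cfg (pred (length u))) (rho u))).
  assert (Hnn : forall C s, 0 <= (/ 2) ^ k * credit_pot C s).
  { intros C s. apply Rmult_le_pos; [lra|]. apply credit_pot_bounds. }
  assert (Hstep : forall u n, length u = S n -> rho u = SBA \/ rho u = SBD ->
     (credit_pot (cfg (S n)) (rho (u ++ [false])) + credit_pot (cfg (S n)) (rho (u ++ [true]))) / 2
     <= credit_pot (cfg n) (rho u)).
  { intros u n Hu Hb. apply credit_super; [apply cinv_cfg|auto|apply run_step; auto]. }
  exists W. split; [|split; [|split]].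
  - intro u. unfold W. destruct (le_dec (length u) (S N)); [lra|].
    apply Rmult_le_pos; [apply indic_bounds|apply Hnn].
  - intro u. unfold W. rewrite !length_app. simpl length.
    destruct (le_dec (length u + 1) (S N)) as [h|h].
    + destruct (le_dec (length u) (S N)); [lra|lia].
    + assert (exists n, length u = S n) as [n Hn] by (exists (pred (length u)); lia).
      replace (pred (length u + 1)) with (S n) by lia.
      assert (Hch : forall b, allB (u ++ [b]) -> allB u).
      { intros b Hall v [e He] Hv. apply Hall; auto. exists (e ++ [b]). rewrite He, app_assoc. auto. }
      destruct (classic (allB u)) as [Hall|Hall].
      * assert (Hb : rho u = SBA \/ rho u = SBD).
        { apply Hall; [exists []; rewrite app_nil_r; auto|lia]. }
        specialize (Hstep u n Hn Hb).
        assert (Hc : forall b, indic (allB (u ++ [b])) * ((/ 2) ^ k * credit_pot (cfg (S n)) (rho (u ++ [b])))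
                      <= (/ 2) ^ k * credit_pot (cfg (S n)) (rho (u ++ [b]))).
        { intro b. rewrite <- (Rmult_1_l ((/ 2) ^ k * _)) at 2. apply Rmult_le_compat_r; [apply Hnn|apply indic_bounds]. }
        assert (H1 := Hc false). assert (H2 := Hc true).
        assert (H3 : (/ 2) ^ k * ((credit_pot (cfg (S n)) (rho (u ++ [false])) + credit_pot (cfg (S n)) (rho (u ++ [true]))) / 2)
                 <= (/ 2) ^ k * credit_pot (cfg n) (rho u)) by (apply Rmult_le_compat_l; lra).
        apply Rle_trans with ((/ 2) ^ k * credit_pot (cfg n) (rho u)); [lra|].
        destruct (le_dec (length u) (S N)) as [h'|h'].
        -- assert (n = N) by lia. subst n.
           assert (Hb' := credit_pot_bounds (cfg N) (rho u)).
           apply Rle_trans with ((/ 2) ^ k * 2 ^ cK (cfg N)); [apply Rmult_le_compat_l; lra|].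
           apply Rlt_le in Hk. apply Rmult_le_compat_r with (r := 2 ^ cK (cfg N)) in Hk; [|lra].
           unfold Rdiv in Hk. rewrite Rmult_assoc, Rinv_l in Hk by lra. lra.
        -- rewrite Hn, indic_true by auto. simpl pred. lra.
      * rewrite (indic_false (allB (u ++ [false]))), (indic_false (allB (u ++ [true])))
          by (intro Hb; apply Hall; eapply Hch; eauto).
        destruct (le_dec (length u) (S N)); [lra|].
        rewrite indic_false by auto. lra.
  - unfold W. simpl. lra.
  - intros pi Hpi. destruct (reach_start (S k + N)) as [n Hn]. exists (S n). unfold W. rewrite bprefix_length.
    assert (Hle := cK_cfg n). rewrite Hn in Hle. simpl in Hle.
    destruct (le_dec (S n) (S N)); [lia|]. simpl pred. rewrite Hn.
    assert (Hall : allB (bprefix pi (S n))).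
    { intros v [e He] Hv. assert (Hlv : (length v <= S n)%nat).
      { rewrite <- (bprefix_length pi (S n)), He, length_app. lia. }
      replace v with (bprefix pi (length v)); [apply Hpi; auto|].
      rewrite (bprefix_firstn pi _ (S n)) by auto. rewrite He, firstn_app, Nat.sub_diag, firstn_all. simpl.
      apply app_nil_r. }
    rewrite indic_true by auto.
    assert (Hp2 : (/ 2) ^ k * 2 ^ (S k + N) >= 2).
    { rewrite Nat.add_succ_l. simpl. rewrite pow_add.
      assert (E : (/ 2) ^ k * 2 ^ k = 1) by (rewrite <- Rpow_mult_distr; replace (/ 2 * 2) with 1 by lra; apply pow1).
      assert (1 <= 2 ^ N) by (apply pow_R1_Rle; lra).
      replace ((/ 2) ^ k * (2 * (2 ^ k * 2 ^ N))) with (((/ 2) ^ k * 2 ^ k) * (2 * 2 ^ N)) by ring.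
      rewrite E. lra. }
    assert (Hge : / 2 * 2 ^ (S k + N) <= credit_pot (start (S k + N) 0 (S k + N)) (rho (bprefix pi (S n)))).
    { assert (0 < 2 ^ (S k + N)) by (apply pow_lt; lra).
      assert (Eb : credit_base (start (S k + N) 0 (S k + N)) = 2 ^ (S k + N)) by (unfold credit_base; simpl cRep; simpl cK; simpl pow; lra).
      destruct (Hpi (S n)) as [E|E]; [lia| |]; unfold along in E; rewrite E; cbn [credit_pot]; rewrite Eb.
      - assert (Hh : (/ 2) ^ crem (start (S k + N) 0 (S k + N)) <= / 2).
        { apply half_pow_le_half. unfold crem. simpl. assert (H0 := L_pos). unfold L in *. lia. }
        apply Rmult_le_compat_r; lra.
      - lra. }
    apply Rle_trans with ((/ 2) ^ k * (/ 2 * 2 ^ (S k + N))); [lra|].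
    rewrite Rmult_1_l. apply Rmult_le_compat_l; lra.
Qed.

Lemma along_step pi n : (1 <= n)%nat ->
  exists s0 s1, In (s0, s1) (outs K0 J x (along rho pi n) (cletter (cfg (pred n)))) /\
    (along rho pi (S n) = s0 \/ along rho pi (S n) = s1).
Proof.
  intro Hn. unfold along. rewrite bprefix_S. do 2 eexists. split.
  - apply run_step. rewrite bprefix_length. lia.
  - destruct (pi n); auto.
Qed.

(** A branch that is rejected and visits [SRN] finitely often has priority 1 at some late node,
    hence is in [SBA] or [SBD] there; without further credit it stays in these states. This gives a
    countable union over the level from which it does so. *)
Lemma honest_run_null : mu_null (fun pi => ~ sacc (along rho pi)).
Proof.
  apply null_subset with (fun pi => exists n, match n with
     | O => forall N, exists n, (N <= n)%nat /\ along rho pi n = SRN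
     | S N => forall n, (S N <= n)%nat -> along rho pi n = SBA \/ along rho pi n = SBD end).
  - intros pi Hpi. unfold sacc in Hpi. apply not_or_and in Hpi. destruct Hpi as [H1 H2].
    apply not_all_ex_not in H1. destruct H1 as [N1 H1].
    destruct (classic (forall N, exists n, (N <= n)%nat /\ along rho pi n = SRN)) as [H3|H3]; [exists 0%nat; auto|].
    apply not_all_ex_not in H3. destruct H3 as [N2 H3].
    assert (Hn : exists n, (S (N1 + N2) <= n)%nat /\ sprio (along rho pi n) = 1%nat).
    { apply NNPP. intro Hno. apply H2. exists (S (N1 + N2)). intros n Hn E. apply Hno. eauto. }
    destruct Hn as (n & Hn & En).
    assert (Hall : forall m, along rho pi (n + m) = SBA \/ along rho pi (n + m) = SBD).
    { induction m as [|m IH].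
      - rewrite Nat.add_0_r.
        assert (Hc : compat (cfg (pred n)) (along rho pi n)).
        { apply run_compat. rewrite bprefix_length. lia. }
        destruct (along rho pi n) eqn:E; simpl in En; try discriminate; auto; try contradiction.
        exfalso. apply H3. exists n. split; auto. lia.
      - rewrite Nat.add_succ_r. destruct (along_step pi (n + m)) as (s0 & s1 & Hin & Hs); [lia|].
        assert (Hne : along rho pi (S (n + m)) <> SBC).
        { intro E. apply H1. exists (S (n + m)). split; [lia|]. rewrite E. auto. }
        destruct IH as [E|E]; rewrite E in Hin; cbn [outs] in Hin;
          destruct (cletter (cfg (pred (n + m)))) as [|[|[|[|[|[|]]]]]]; simpl in Hin;
          solve_pairs;
          auto; try (left; congruence); try (right; congruence); try congruence. }
    exists n. destruct n as [|n]; [lia|]. intros p Hp. replace p with (S n + (p - S n))%nat by lia. apply Hall.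
  - apply null_union. intros [|N]; [apply risk_null|apply credit_null].
Qed.
End Run.

Theorem honest_in_lang : symbolic_lang K0 J x honest.
Proof. split; [apply honest_range|]. intros rho Hrun. apply honest_run_null; auto. Qed.
End Honest.

(** * Rejecting every tree when the program does not halt *)

Open Scope R_scope.

(** A label computed from that of the parent is a recursion on the last bit, hence the reversal. *)
Fixpoint track_rev {X : Type} (step : node -> bool -> X -> X) (x0 : X) (r : node) : X :=
  match r with
  | [] => x0
  | b :: r' => step (rev r') b (track_rev step x0 r')
  end.

Definition track {X : Type} (step : node -> bool -> X -> X) (x0 : X) (u : node) : X :=
  track_rev step x0 (rev u).

Lemma track_snoc {X : Type} (step : node -> bool -> X -> X) x0 u b :
  track step x0 (u ++ [b]) = step u b (track step x0 u).
Proof. unfold track. rewrite rev_app_distr. simpl. rewrite rev_involutive. auto. Qed.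

Lemma snoc_not_nil {X : Type} (u : list X) b : u ++ [b] <> [].
Proof. destruct u; discriminate. Qed.

Definition in_cone (v u : node) : Prop := is_prefix u v \/ is_prefix v u.

Lemma in_cone_prefix v a b : is_prefix a b -> in_cone v b -> in_cone v a.
Proof.
  intros [e He] [[f Hf]|[f Hf]].
  - left. exists (e ++ f). rewrite Hf, He, app_assoc. auto.
  - assert (E : a ++ e = v ++ f) by congruence. apply app_comparable in E.
    destruct E as [[h Hh]|[h Hh]]; [right|left]; exists h; auto.
Qed.

Lemma cone_not_null (S : branch -> Prop) u :
  (forall pi, bprefix pi (length u) = u -> S pi) -> ~ mu_null S.
Proof.
  intros H Hn. apply (closed_not_null (in_cone u) ((/ 2) ^ length u)).
  - apply half_pow_pos.
  - apply in_cone_prefix.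
  - intro d. exists (length u + d)%nat. split; [lia|].
    rewrite <- (Ex_pre_ind (length u + d) u) by lia. apply Ex_mono. intros w _. apply indic_mono. right; auto.
  - apply null_subset with S; auto. intros pi Hpi. apply H. specialize (Hpi (length u)).
    destruct Hpi as [[e He]|[e He]].
    + assert (E := f_equal (@length bool) He). rewrite length_app, bprefix_length in E.
      destruct e; [rewrite app_nil_r in He; auto|simpl in E; lia].
    + assert (E := f_equal (@length bool) He). rewrite length_app, bprefix_length in E.
      destruct e; [rewrite app_nil_r in He; auto|simpl in E; lia].
Qed.

Section Cheat.
Variables (K0 : stack) (J x g : nat) (RS : list stack) (t : node -> nat).
Hypothesis K0_in : In K0 RS.
Hypothesis RS_closed : forall K a K', In K RS -> nexts K0 K a = Some K' -> In K' RS.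
Hypothesis RS_idx : forall K a, In K RS -> kact K = Some a -> (act_idx a < J)%nat.
Hypothesis J_pos : (0 < J)%nat.
Hypothesis J_small : 2 * INR J <= 2 ^ g.
Hypothesis no_good : forall w,
  ~ (okpath K0 (Z.of_nat g) K0 (fun _ => 0%Z) w /\ chrun x (Chn 0) w = Some Done).
Hypothesis t_lang : symbolic_lang K0 J x t.

(** If the device [d] failed at some node, the corresponding run would be in the sink on a whole
    cone, which is not null. So on an accepted tree it never fails, and its states label all nodes
    below the root. *)
Lemma deterministic_mode (X : Type) (f : X -> st) (d : X -> nat -> option X) (z0 : X) :
  (forall z a, outs K0 J x (f z) a = both (match d z a with Some z' => f z' | None => SX end)) ->
  In (f z0, f z0) (outs K0 J x SInit (t [])) ->
  exists c : node -> X, (forall b, c [b] = z0) /\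
    (forall u b, u <> [] -> d (c u) (t u) = Some (c (u ++ [b]))).
Proof.
  intros Hf H0.
  set (step := fun (u : node) (b : bool) (o : option X) =>
     match u with [] => Some z0 | _ => match o with Some z => d z (t u) | None => None end end).
  set (c := track step (Some z0)).
  set (rho := fun u => match u with [] => SInit | _ => match c u with Some z => f z | None => SX end end).
  assert (Hs : forall u b, c (u ++ [b]) = step u b (c u)) by (intros; apply track_snoc).
  assert (Er : forall u b, rho (u ++ [b]) = match c (u ++ [b]) with Some z => f z | None => SX end).
  { intros u b. unfold rho. assert (H := snoc_not_nil u b). destruct (u ++ [b]); congruence. }
  assert (Hrun : srun K0 J x t rho).
  { split; auto. intro u. rewrite !Er, !Hs. destruct u as [|b u]; [exact H0|].
    unfold rho, step. destruct (c (b :: u)) as [z|]; [rewrite Hf|]; left; auto. }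
  destruct t_lang as [_ Hl]. specialize (Hl rho Hrun).
  assert (Hsome : forall u, c u <> None).
  { intros u Hu. revert Hl. apply (cone_not_null _ u). intros pi Hpi.
    assert (Hdead : forall k, c (bprefix pi (length u + k)) = None /\ bprefix pi (length u + k) <> []).
    { assert (u <> []) by (intro; subst u; discriminate Hu).
      induction k as [|k [IH1 IH2]]; [rewrite Nat.add_0_r, Hpi; auto|].
      rewrite Nat.add_succ_r, bprefix_S. split; [|apply snoc_not_nil].
      rewrite Hs, IH1. unfold step. destruct (bprefix pi (length u + k)); congruence. }
    assert (Hx : forall k, along rho pi (length u + k) = SX).
    { intro k. destruct (Hdead k) as [H1 H2]. unfold along, rho. rewrite H1.
      destruct (bprefix pi (length u + k)); congruence. }
    intros [H|[N H]].
    - destruct (H (length u)) as (n & Hn & E). replace n with (length u + (n - length u))%nat in E by lia.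
      rewrite Hx in E. discriminate.
    - apply (H (length u + N)%nat); [lia|]. rewrite Hx. auto. }
  exists (fun u => match c u with Some z => z | None => z0 end). split.
  - intro b. change [b] with ([] ++ [b]). rewrite Hs. auto.
  - intros u b Hu. assert (H1 := Hsome u). assert (H2 := Hsome (u ++ [b])). rewrite Hs in *.
    unfold step in *. destruct u as [|b' u]; [congruence|].
    destruct (c (b' :: u)); [|congruence]. destruct (d x0 (t (b' :: u))); congruence.
Qed.

(** * In an accepted tree credit has probability 1 below every node *)

Definition avg (f : node -> R) (u : node) : R := (f (u ++ [false]) + f (u ++ [true])) / 2.

(* Probability that credit is received within [m] levels below [u], when the coins of the automaton
   are independent of the branch. *)
Fixpoint cr (m : nat) (alive : bool) (u : node) : R :=
  match m with
  | O => 0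
  | S m =>
      match t u, alive with
      | 2%nat, true => avg (fun c => (cr m true c + cr m false c) / 2) u
      | 5%nat, true => 1
      | 5%nat, false => avg (cr m true) u
      | _, _ => avg (cr m alive) u
      end
  end.

Lemma avg_mono f f' u : (forall b, f (u ++ [b]) <= f' (u ++ [b])) -> avg f u <= avg f' u.
Proof. intro H. unfold avg. assert (H1 := H false). assert (H2 := H true). lra. Qed.

Lemma cr_bounds m : forall al u, 0 <= cr m al u <= 1.
Proof.
  induction m as [|m IH]; intros al u; simpl; [lra|].
  assert (H1 := fun al => IH al (u ++ [false])). assert (H2 := fun al => IH al (u ++ [true])).
  assert (H1t := H1 true). assert (H1f := H1 false). assert (H2t := H2 true). assert (H2f := H2 false).
  letters (t u); destruct al; unfold avg; lra.
Qed.

Lemma cr_alive m : forall u, cr m false u <= cr m true u.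
Proof.
  induction m as [|m IH]; intro u; simpl; [lra|].
  assert (H1 := IH (u ++ [false])). assert (H2 := IH (u ++ [true])).
  assert (H3 := cr_bounds m true (u ++ [false])). assert (H4 := cr_bounds m true (u ++ [true])).
  letters (t u); unfold avg; lra.
Qed.

Lemma cr_mono m : forall al u, cr m al u <= cr (S m) al u.
Proof.
  induction m as [|m IH]; intros al u; [apply (cr_bounds 1)|].
  assert (IH' : forall al b, cr m al (u ++ [b]) <= cr (S m) al (u ++ [b])) by auto.
  remember (S m) as m' eqn:Em. cbn [cr]. rewrite Em at 1. cbn [cr].
  assert (H1t := IH' true false). assert (H1f := IH' false false).
  assert (H2t := IH' true true). assert (H2f := IH' false true).
  letters (t u); destruct al; unfold avg; lra.
Qed.

Lemma cr_mono_le m m' al u : (m <= m')%nat -> cr m al u <= cr m' al u.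
Proof. induction 1; [lra|]. eapply Rle_trans; [eassumption|apply cr_mono]. Qed.

Definition cr_set (al : bool) (u : node) : R -> Prop := fun r => exists m, r = cr m al u.

Lemma cr_set_bound al u : bound (cr_set al u).
Proof. exists 1. intros r [m ->]. apply cr_bounds. Qed.

Lemma cr_set_inhabited al u : exists r, cr_set al u r.
Proof. exists (cr 0 al u), 0%nat. auto. Qed.

Definition crsup (al : bool) (u : node) : R :=
  proj1_sig (completeness (cr_set al u) (cr_set_bound al u) (cr_set_inhabited al u)).

Lemma crsup_ub al u m : cr m al u <= crsup al u.
Proof. unfold crsup. destruct completeness as [l [H1 H2]]. simpl. apply H1. exists m; auto. Qed.

Lemma crsup_lub al u c : (forall m, cr m al u <= c) -> crsup al u <= c.
Proof. intro H. unfold crsup. destruct completeness as [l [H1 H2]]. simpl. apply H2. intros r [m ->]. auto. Qed.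

(** Suprema of increasing sequences add up: different horizons [m] and [m'] are both replaced by
    [m + m']. The recursion of [cr] thus passes to the limit. *)
Lemma crsup_sum l c : (forall m, sumR (fun p => cr m (fst p) (snd p)) l <= c) ->
  sumR (fun p => crsup (fst p) (snd p)) l <= c.
Proof.
  revert c. induction l as [|p l IH]; intros c H; [apply (H 0%nat)|].
  unfold sumR in *. cbn [map fold_right] in *.
  set (S0 := fold_right Rplus 0 (map (fun p => crsup (fst p) (snd p)) l)) in *.
  assert (crsup (fst p) (snd p) <= c - S0); [|lra].
  apply crsup_lub. intro m. assert (S0 <= c - cr m (fst p) (snd p)); [|lra].
  apply IH. intro m'. specialize (H (m + m')%nat).
  assert (cr m (fst p) (snd p) <= cr (m + m') (fst p) (snd p)) by (apply cr_mono_le; lia).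
  assert (H1 := sumR_le (fun q => cr m' (fst q) (snd q)) (fun q => cr (m + m') (fst q) (snd q)) l).
  unfold sumR in H1. specialize (H1 ltac:(intros; apply cr_mono_le; lia)). lra.
Qed.

Lemma crsup_avg al al' u : (forall m, avg (cr m al') u <= cr (S m) al u) -> avg (crsup al') u <= crsup al u.
Proof.
  intro H. assert (H1 := crsup_sum [(al', u ++ [false]); (al', u ++ [true])] (2 * crsup al u)).
  unfold sumR, avg in *. cbn [map fold_right fst snd] in H1.
  enough (H2 : forall m, cr m al' (u ++ [false]) + (cr m al' (u ++ [true]) + 0) <= 2 * crsup al u) by (specialize (H1 H2); lra).
  intro m. specialize (H m). assert (H2 := crsup_ub al u (S m)). lra.
Qed.

Lemma crsup_coin u : t u = 2%nat ->
  (crsup true (u ++ [false]) + crsup false (u ++ [false]) + (crsup true (u ++ [true]) + crsup false (u ++ [true]))) / 4 <= crsup true u.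
Proof.
  intro Hu. assert (H1 := crsup_sum [(true, u ++ [false]); (false, u ++ [false]); (true, u ++ [true]); (false, u ++ [true])]
    (4 * crsup true u)).
  unfold sumR in *. cbn [map fold_right fst snd] in H1.
  enough (H2 : forall m, cr m true (u ++ [false]) + (cr m false (u ++ [false]) + (cr m true (u ++ [true]) +
    (cr m false (u ++ [true]) + 0))) <= 4 * crsup true u) by (specialize (H1 H2); lra).
  intro m. assert (H2 := crsup_ub true u (S m)). simpl in H2. rewrite Hu in H2. unfold avg in H2. lra.
Qed.

Section CreditRun.
Variable v : node.
Hypothesis v_nonempty : v <> [].

(* The run stays in [SBW] above [v], is dead at [v], and then gives the live state of each coin to the
   child where this makes credit less probable. *)
Definition bstep (u : node) (b : bool) (s : st) : st :=
  if (S (length u) <? length v)%nat then SBW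
  else if (S (length u) =? length v)%nat then SBD
  else match s, t u with
       | (SBA | SBC), 2%nat =>
           if Rle_dec (crsup true (u ++ [false]) + crsup false (u ++ [true]))
                      (crsup false (u ++ [false]) + crsup true (u ++ [true]))
           then (if b then SBD else SBA) else (if b then SBA else SBD)
       | (SBA | SBC), 5%nat => SBC
       | (SBA | SBC), _ => SBA
       | _, 5%nat => SBA
       | _, _ => SBD
       end.

Definition brun (u : node) : st := track bstep SInit u.

Lemma brun_snoc u b : brun (u ++ [b]) = bstep u b (brun u).
Proof. apply track_snoc. Qed.

Lemma v_length : (0 < length v)%nat.
Proof. destruct v; [congruence|simpl; lia]. Qed.

Lemma brun_shape u :
  if (length u =? 0)%nat then brun u = SInit
  else if (length u <? length v)%nat then brun u = SBW
  else if (length u =? length v)%nat then brun u = SBD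
  else brun u = SBA \/ brun u = SBD \/ brun u = SBC.
Proof.
  assert (Hv := v_length).
  induction u as [|b u IH] using rev_ind; [reflexivity|].
  rewrite length_app, brun_snoc. simpl length. rewrite Nat.add_1_r. simpl (_ =? 0)%nat.
  unfold bstep. destruct (S (length u) <? length v)%nat; auto.
  destruct (S (length u) =? length v)%nat; auto. cbn [Nat.eqb].
  destruct (brun u); letters (t u); auto; destruct (Rle_dec _ _); destruct b; auto.
Qed.

Lemma brun_is_run : srun K0 J x t brun.
Proof.
  split; [reflexivity|]. intro u. assert (Hv := v_length). assert (Hs := brun_shape u).
  rewrite !brun_snoc. unfold bstep.
  destruct (Nat.eqb_spec (length u) 0).
  - rewrite Hs. destruct (Nat.ltb_spec (S (length u)) (length v)); [simpl; auto|].
    destruct (Nat.eqb_spec (S (length u)) (length v)); [simpl; auto|lia].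
  - destruct (Nat.ltb_spec (length u) (length v)).
    + rewrite Hs. destruct (Nat.ltb_spec (S (length u)) (length v)); [simpl; auto|].
      destruct (Nat.eqb_spec (S (length u)) (length v)); [simpl; auto|lia].
    + destruct (Nat.ltb_spec (S (length u)) (length v)); [lia|].
      destruct (Nat.eqb_spec (S (length u)) (length v)); [lia|].
      assert (Hs' : brun u = SBA \/ brun u = SBD \/ brun u = SBC).
      { destruct (length u =? length v)%nat; auto. }
      destruct Hs' as [-> |[-> | ->]]; letters (t u); simpl; auto; destruct (Rle_dec _ _); simpl; auto.
Qed.

Definition credited (u : node) : Prop := exists w, is_prefix w u /\ brun w = SBC.

Definition yval (u : node) : R :=
  if em (credited u) then 1
  else crsup (match brun u with SBA => true | _ => false end) u.

Lemma credited_snoc u b : credited u -> credited (u ++ [b]).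
Proof. intros (w & [e ->] & H). exists w. split; auto. exists (e ++ [b]). rewrite app_assoc; auto. Qed.

Lemma crsup_le1 al u : crsup al u <= 1.
Proof. apply crsup_lub. intro; apply cr_bounds. Qed.

(** At a coin the two orders of [SBA] and [SBD] have together the four values summed in
    [crsup_coin]; [bstep] takes the order with the smaller sum, which is at most half of that
    total. *)
Lemma yval_super w : avg yval (v ++ w) <= yval (v ++ w).
Proof.
  set (u := v ++ w). unfold yval at 2. destruct (em (credited u)) as [h|h].
  - unfold avg, yval. destruct (em (credited (u ++ [false]))) as [|n]; [|exfalso; apply n, credited_snoc; auto].
    destruct (em (credited (u ++ [true]))) as [|n]; [|exfalso; apply n, credited_snoc; auto]. lra.
  - assert (Hb : forall b, yval (u ++ [b]) <= match brun (u ++ [b]) with SBC => 1 | SBA => crsup true (u ++ [b]) | _ => crsup false (u ++ [b]) end).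
    { intro b. unfold yval. destruct (em (credited (u ++ [b]))) as [(w' & [e He] & Hw)|n].
      - destruct e as [|c e _] using rev_ind.
        + rewrite app_nil_r in He. rewrite He, Hw. lra.
        + exfalso. apply h. rewrite app_assoc in He. apply app_inj_tail in He. destruct He as [He _].
          exists w'. split; auto. exists e. auto.
      - assert (H1 := crsup_le1 false (u ++ [b])). destruct (brun (u ++ [b])); lra. }
    assert (Hne : brun u <> SBC).
    { intro E. apply h. exists u. split; auto. exists []. rewrite app_nil_r. auto. }
    assert (Hs := brun_shape u). assert (Hv := v_length).
    assert (Hl : (length v <= length u)%nat) by (unfold u; rewrite length_app; lia).
    destruct (Nat.eqb_spec (length u) 0); [lia|]. destruct (Nat.ltb_spec (length u) (length v)); [lia|].
    assert (Hs' : brun u = SBA \/ brun u = SBD) by (destruct (length u =? length v)%nat; intuition).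
    assert (Hf := Hb false). assert (Ht := Hb true). rewrite brun_snoc in Hf, Ht. unfold bstep in Hf, Ht.
    destruct (Nat.ltb_spec (S (length u)) (length v)); [lia|].
    destruct (Nat.eqb_spec (S (length u)) (length v)); [lia|].
    assert (Hother : forall al, (t u <> 2 \/ al = false)%nat -> t u <> 5%nat -> avg (crsup al) u <= crsup al u).
    { intros al H2 H5. apply crsup_avg. intro m. cbn [cr].
      letters (t u); destruct al; try lra; try congruence.
      destruct H2; congruence. }
    assert (H5d : t u = 5%nat -> avg (crsup true) u <= crsup false u).
    { intro H5. apply crsup_avg. intro m. cbn [cr]. rewrite H5. lra. }
    assert (H5a : t u = 5%nat -> 1 <= crsup true u).
    { intro H5. assert (H6 := crsup_ub true u 1). simpl in H6. rewrite H5 in H6. auto. }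
    assert (Hc := crsup_coin u).
    assert (Ho1 : t u <> 2%nat -> t u <> 5%nat -> avg (crsup true) u <= crsup true u) by (intros; apply Hother; auto).
    assert (Ho2 : t u <> 5%nat -> avg (crsup false) u <= crsup false u) by (intros; apply Hother; auto). unfold avg in *.
    destruct Hs' as [E|E]; rewrite E; rewrite E in Hf, Ht;
      clear -Hf Ht Ho1 Ho2 H5d H5a Hc; set (A0 := crsup true (u ++ [false])) in *;
      set (A1 := crsup true (u ++ [true])) in *; set (D0 := crsup false (u ++ [false])) in *;
      set (D1 := crsup false (u ++ [true])) in *; clearbody A0 A1 D0 D1.
    + destruct (t u) as [|[|[|[|[|[|k]]]]]].
      3: { specialize (Hc eq_refl). clear Ho1 Ho2 H5d H5a. destruct (Rle_dec _ _); lra. }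
      5: { specialize (H5a eq_refl). lra. }
      all: clear H5d H5a Hc Ho2;
        match type of Ho1 with ?P -> ?Q -> _ => assert (h1 : P) by discriminate; assert (h2 : Q) by discriminate end;
        specialize (Ho1 h1 h2); clear h1 h2; lra.
    + destruct (t u) as [|[|[|[|[|[|k]]]]]].
      6: { specialize (H5d eq_refl). lra. }
      all: clear H5d H5a Hc Ho1; match type of Ho2 with ?P -> _ => assert (h1 : P) by discriminate end;
        specialize (Ho2 h1); clear h1; lra.
Qed.

(** Otherwise the run that is dead at [v] misses credit with probability at least
    [1 - crsup false v] below [v]. Missing credit forever is a closed event, hence not null, and
    there the priority is 1 from [v] on. *)
Lemma credit_sup_one : crsup false v = 1.
Proof.
  apply Rle_antisym; [apply crsup_le1|]. apply Rnot_lt_le. intro Hlt.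
  set (eps := 1 - crsup false v).
  destruct t_lang as [_ Hl]. specialize (Hl brun brun_is_run). revert Hl.
  assert (Hv := v_length).
  set (P := fun u => in_cone v u /\ ~ credited u).
  intro Hl. apply (closed_not_null P ((/ 2) ^ length v * eps)).
  - apply Rmult_lt_0_compat; [apply half_pow_pos|unfold eps; lra].
  - intros a b Hab [Hb Hc]. split; [eapply in_cone_prefix; eauto|].
    intros (w & [f ->] & Hw). destruct Hab as [e He]. apply Hc. exists w. split; auto.
    exists (f ++ e). rewrite He, app_assoc. auto.
  - intro d. exists (length v + d)%nat. split; [lia|].
    apply Rle_trans with (Ex (length v + d) (fun u => indic (is_prefix v u) * (1 - indic (credited u)))).
    + rewrite (Ex_pre d v (fun u => 1 - indic (credited u))).
      apply Rmult_le_compat_l; [left; apply half_pow_pos|].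
      rewrite (Ex_minus d (fun _ => 1)), Ex_const.
      assert (H : Ex d (fun w => indic (credited (v ++ w))) <= Ex d (fun w => yval (v ++ w))).
      { apply Ex_mono. intros w _. unfold yval, indic.
        destruct (em (credited (v ++ w))); [lra|].
        eapply Rle_trans; [|apply (crsup_ub _ _ 0)]. simpl. lra. }
      assert (H2 : Ex d (fun w => yval (v ++ w)) <= yval (v ++ [])).
      { apply (Ex_supermart (fun w => yval (v ++ w))). intro w. assert (H2 := yval_super w). unfold avg in H2.
        rewrite <- !app_assoc in H2. auto. }
      rewrite app_nil_r in H2. unfold yval in H2 at 2.
      assert (Hsh := brun_shape v). destruct (Nat.eqb_spec (length v) 0); [lia|].
      rewrite Nat.ltb_irrefl, Nat.eqb_refl in Hsh.
      destruct (em (credited v)) as [(w & [e He] & Hw)|n'].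
      * exfalso. assert (Hsh' := brun_shape w). rewrite Hw in Hsh'.
        assert (length w <= length v)%nat by (rewrite He, length_app; lia).
        destruct (length w =? 0)%nat; [discriminate|].
        destruct (Nat.ltb_spec (length w) (length v)); [discriminate|].
        replace (length w) with (length v) in Hsh' by lia. rewrite Nat.eqb_refl in Hsh'. discriminate.
      * rewrite Hsh in H2. unfold eps. lra.
    + apply Ex_mono. intros u _. unfold indic, P.
      repeat destruct (em _); try lra; exfalso; unfold in_cone in *; tauto.
  - eapply null_subset; [|exact Hl]. intros pi Hpi.
    assert (Hst : forall n, (length v <= n)%nat -> sprio (along brun pi n) = 1%nat).
    { intros n Hn. unfold along. destruct (Hpi n) as [_ Hc].
      assert (Hsh := brun_shape (bprefix pi n)). rewrite bprefix_length in Hsh.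
      destruct (Nat.eqb_spec n 0); [lia|]. destruct (Nat.ltb_spec n (length v)); [lia|].
      assert (brun (bprefix pi n) <> SBC).
      { intro E. apply Hc. exists (bprefix pi n). split; auto. exists []. rewrite app_nil_r. auto. }
      destruct (n =? length v)%nat; [rewrite Hsh; auto|].
      destruct Hsh as [E|[E|E]]; rewrite E; auto; contradiction. }
    intros [H|[N H]].
    + destruct (H (length v)) as (n & Hn & E). rewrite Hst in E by auto. discriminate.
    + apply (H (length v + N)%nat); [lia|]. apply Hst. lia.
Qed.
End CreditRun.

Lemma credit_eventually u eps : u <> [] -> 0 < eps -> exists m, 1 - eps <= cr m false u.
Proof.
  intros Hu He. apply NNPP. intro Hno. assert (crsup false u <= 1 - eps).
  { apply crsup_lub. intro m. apply Rlt_le, Rnot_le_lt. intro. apply Hno. eauto. }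
  rewrite credit_sup_one in H by auto. lra.
Qed.

(** One horizon for a whole level, so that the stages of the risk run can be delimited by depth
    alone. *)
Lemma credit_uniform n eps : 0 < eps ->
  exists m, forall u, length u = S n -> 1 - eps <= cr m false u.
Proof.
  intro He.
  assert (H : forall k v, exists m, forall w, length w = k -> v ++ w <> [] -> 1 - eps <= cr m false (v ++ w)).
  { induction k as [|k IH]; intro v.
    - destruct (classic (v = [])) as [->|Hv].
      + exists 0%nat. intros [|] Hw H; [exfalso; apply H; auto|discriminate].
      + destruct (credit_eventually v eps Hv He) as [m Hm]. exists m. intros [|] Hw _; [|discriminate].
        rewrite app_nil_r. auto.
    - destruct (IH (v ++ [false])) as [m1 H1]. destruct (IH (v ++ [true])) as [m2 H2].
      exists (m1 + m2)%nat. intros [|b w] Hw Hne; [discriminate|]. simpl in Hw. injection Hw as Hw.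
      replace (v ++ b :: w) with ((v ++ [b]) ++ w) in * by (rewrite <- app_assoc; auto).
      destruct b.
      + eapply Rle_trans; [apply (H2 w Hw Hne)|apply cr_mono_le; lia].
      + eapply Rle_trans; [apply (H1 w Hw Hne)|apply cr_mono_le; lia]. }
  destruct (H (S n) []) as [m Hm]. exists m. intros u Hu. apply (Hm u Hu). destruct u; discriminate.
Qed.

(** * Risk is at least credit when every copy is wrong *)

Definition visit (s : st) (r : R) : R := match s with SRN => 1 | _ => r end.

Definition pair_value (val : node -> st -> R) (u : node) (p : st * st) : R :=
  (visit (fst p) (val (u ++ [false]) (fst p)) + visit (snd p) (val (u ++ [true]) (snd p))) / 2.

(* Greatest probability of visiting [SRN] at one of the [m] levels below [u], over the runs that
   are in state [s] at [u]. *)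
Fixpoint V (m : nat) (u : node) (s : st) : R :=
  match m with
  | O => 0
  | S m => fold_right Rmax 0 (map (pair_value (V m) u) (outs K0 J x s (t u)))
  end.

Lemma max_ge l r : In r l -> r <= fold_right Rmax 0 l.
Proof.
  induction l as [|a l IH]; intros [].
  - subst. simpl. apply Rmax_l.
  - simpl. eapply Rle_trans; [apply IH; auto|apply Rmax_r].
Qed.

Lemma max_attained l : l <> [] -> (forall r, In r l -> 0 <= r) -> In (fold_right Rmax 0 l) l.
Proof.
  induction l as [|a l IH]; intros Hl H0; [congruence|]. simpl.
  destruct l as [|b l].
  - simpl. left. symmetry. apply Rmax_left. apply H0. left; auto.
  - destruct (Rle_dec a (fold_right Rmax 0 (b :: l))).
    + rewrite Rmax_right by auto. right. apply IH; [discriminate|]. intros; apply H0; right; auto.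
    + rewrite Rmax_left by lra. auto.
Qed.

Lemma V_bounds m : forall u s, 0 <= V m u s <= 1.
Proof.
  induction m as [|m IH]; intros u s; simpl; [lra|].
  assert (Hp : forall p, 0 <= pair_value (V m) u p <= 1).
  { intros [s0 s1]. unfold pair_value. simpl.
    assert (H0 := IH (u ++ [false]) s0). assert (H1 := IH (u ++ [true]) s1).
    destruct s0, s1; simpl; lra. }
  induction (outs K0 J x s (t u)) as [|p l IHl]; simpl; [lra|].
  assert (H := Hp p). split.
  - eapply Rle_trans; [apply IHl|apply Rmax_r].
  - apply Rmax_lub; [apply H|apply IHl].
Qed.

Lemma visit_ge m u s : V m u s <= visit s (V m u s).
Proof. assert (H := V_bounds m u s). destruct s; simpl; lra. Qed.

Lemma V_ge m u s s0 s1 : In (s0, s1) (outs K0 J x s (t u)) ->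
  pair_value (V m) u (s0, s1) <= V (S m) u s.
Proof. intro H. cbn [V]. apply max_ge. apply in_map_iff. eauto. Qed.

Lemma V_ge_both m u s s' : In (s', s') (outs K0 J x s (t u)) ->
  avg (fun c => V m c s') u <= V (S m) u s.
Proof.
  intro H. eapply Rle_trans; [|apply (V_ge m u s s' s'); auto]. unfold pair_value, avg. simpl.
  assert (H0 := visit_ge m (u ++ [false]) s'). assert (H1 := visit_ge m (u ++ [true]) s'). lra.
Qed.

(** The better of the two orders is at least their average, so a coin works for the opponent as if
    it were independent of the branch, even though letters may depend on it. *)
Lemma V_ge_coin m u s s0 s1 : In (s0, s1) (outs K0 J x s (t u)) -> In (s1, s0) (outs K0 J x s (t u)) ->
  (avg (fun c => V m c s0) u + avg (fun c => V m c s1) u) / 2 <= V (S m) u s.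
Proof.
  intros H H'. assert (A := V_ge m u s s0 s1 H). assert (B := V_ge m u s s1 s0 H').
  unfold pair_value, avg in *. simpl in *.
  assert (H1 := visit_ge m (u ++ [false]) s0). assert (H2 := visit_ge m (u ++ [true]) s1).
  assert (H3 := visit_ge m (u ++ [false]) s1). assert (H4 := visit_ge m (u ++ [true]) s0). lra.
Qed.

Lemma V_attained m u s : outs K0 J x s (t u) <> [] ->
  exists p, In p (outs K0 J x s (t u)) /\ V (S m) u s = pair_value (V m) u p.
Proof.
  intro H. cbn [V].
  assert (Hin : In (fold_right Rmax 0 (map (pair_value (V m) u) (outs K0 J x s (t u))))
                   (map (pair_value (V m) u) (outs K0 J x s (t u)))).
  { apply max_attained.
    - intro E. apply map_eq_nil in E. contradiction.
    - intros r Hr. apply in_map_iff in Hr. destruct Hr as ([s0 s1] & <- & _). unfold pair_value. simpl.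
      assert (H0 := V_bounds m (u ++ [false]) s0). assert (H1 := V_bounds m (u ++ [true]) s1).
      destruct s0, s1; simpl; lra. }
  apply in_map_iff in Hin. destruct Hin as (p & E & Hp). exists p. auto.
Qed.

(** The part of the current copy already read, with the counters it leads to, as long as every check
    was below [g]. It grows at its end, following the descent in the tree, whereas [okpath] is read
    from its start. *)
Inductive hist : stack -> counters -> list nat -> Prop :=
| hist_nil : hist K0 (fun _ => 0%Z) []
| hist_snoc K v p a K' v' : hist K v p -> K <> [] -> nexts K0 K a = Some K' ->
    kstep (Z.of_nat g) (kact K) v v' -> hist K' v' (p ++ [a]).

Lemma hist_okpath K v p l : hist K v p -> okpath K0 (Z.of_nat g) K v l ->
  okpath K0 (Z.of_nat g) K0 (fun _ => 0%Z) (p ++ l).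
Proof.
  intro H. revert l. induction H; intros l Hl; [auto|].
  rewrite <- app_assoc. apply IHhist. econstructor; eauto.
Qed.

Section Tracked.
Variables (ctl : node -> stack) (ch : node -> chst).
Hypothesis ctl_init : forall b, ctl [b] = K0.
Hypothesis ctl_snoc : forall u b, u <> [] -> nexts K0 (ctl u) (t u) = Some (ctl (u ++ [b])).
Hypothesis ch_init : forall b, ch [b] = Chn 0.
Hypothesis ch_snoc : forall u b, u <> [] -> chstep x (ch u) (t u) = Some (ch (u ++ [b])).

Lemma ctl_in u : u <> [] -> In (ctl u) RS.
Proof.
  induction u as [|b u IH] using rev_ind; [congruence|]. intros _.
  destruct u as [|c u]; [simpl; rewrite ctl_init; auto|].
  eapply RS_closed; [apply IH; discriminate|]. apply ctl_snoc. discriminate.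
Qed.

Lemma nexts_end K a K' : nexts K0 K a = Some K' -> a = 4%nat \/ a = 5%nat -> K = [] /\ K' = K0.
Proof.
  intros H Ha. destruct K as [|[[|[]]|p q|p] K]; simpl in H; destruct Ha; subst; try discriminate.
  - inversion H; auto.
  - inversion H; auto.
Qed.

Lemma copy_end u b : u <> [] -> t u = 4%nat \/ t u = 5%nat ->
  ctl u = [] /\ ctl (u ++ [b]) = K0 /\ ch u = Done /\ ch (u ++ [b]) = Chn 0.
Proof.
  intros Hu Ha. destruct (nexts_end _ _ _ (ctl_snoc u b Hu) Ha) as [H1 H2].
  assert (H3 := ch_snoc u b Hu). destruct (ch u); destruct Ha as [E|E]; rewrite E in H3; simpl in H3;
    try discriminate; inversion H3; auto.
Qed.

Lemma ctl_empty u : u <> [] -> ctl u = [] -> t u = 4%nat \/ t u = 5%nat.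
Proof.
  intros Hu E. assert (H := ctl_snoc u false Hu). rewrite E in H. simpl in H.
  letters (t u); try discriminate; auto.
Qed.

Lemma letter_range u : (t u < 6)%nat.
Proof. apply t_lang. Qed.

(** The stake in the current iteration: what credit loses by dying now. *)
Definition crd (m : nat) (u : node) : R := cr m true u - cr m false u.

Lemma crd_nonneg m u : 0 <= crd m u.
Proof. unfold crd. assert (H := cr_alive m u). lra. Qed.

Lemma cr_step_free m u al : t u <> 2%nat -> t u <> 5%nat -> cr (S m) al u = avg (cr m al) u.
Proof. intros H2 H5. cbn [cr]. letters (t u); destruct al; congruence. Qed.

Lemma cr_step_coin m u : t u = 2%nat ->
  cr (S m) false u = avg (cr m false) u /\ crd (S m) u = avg (crd m) u / 2.
Proof. intro H. unfold crd. cbn [cr]. rewrite H. split; auto. unfold avg. lra. Qed.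

Lemma cr_step_end m u : t u = 5%nat -> cr (S m) false u = avg (cr m true) u /\ cr (S m) true u = 1.
Proof. intro H. cbn [cr]. rewrite H. auto. Qed.

(* A guess [j] made at the start of the copy has had probability [2 ^ v j] relative to credit so far;
   summing over all guesses the gain of risk over the dead value [cr m false u] cancels the unknown
   future, since each summand is preserved on average. *)
Definition claims (m : nat) : Prop := forall u, u <> [] ->
  cr m false u <= V m u SR /\
  (forall j, cr m false u <= V m u (SAct j (ctl u))) /\
  cr m false u + crd m u / 2 <= V m u SD /\
  (forall v p, hist (ctl u) v p -> chrun x (Chn 0) p = Some (ch u) ->
     INR J * crd m u <= sumR (fun j => powerRZ 2 (v j) * (V m u (SAct j (ctl u)) - cr m false u)) (seq 0 J)) /\
  (ctl u = K0 -> ch u = Chn 0 -> cr m true u <= V m u SN).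

Lemma sumR_const {A : Type} c (l : list A) : sumR (fun _ => c) l = INR (length l) * c.
Proof.
  induction l as [|a l IH]; [unfold sumR; simpl; lra|].
  unfold sumR in *. simpl length. rewrite S_INR. simpl. rewrite IH. lra.
Qed.

Lemma V_SN_ge m u j : (j < J)%nat -> ctl u = K0 -> V m u (SAct j (ctl u)) <= V m u SN.
Proof.
  intros Hj E. destruct m as [|m]; [simpl; lra|]. rewrite E.
  assert (Hne : outs K0 J x (SAct j K0) (t u) = [] \/ outs K0 J x (SAct j K0) (t u) <> []).
  { destruct (outs K0 J x (SAct j K0) (t u)); [left|right]; congruence. }
  destruct Hne as [E'|Hne].
  - cbn [V]. rewrite E'. simpl. apply (V_bounds (S m) u SN).
  - destruct (V_attained m u (SAct j K0) Hne) as ([s0 s1] & Hp & ->). apply V_ge.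
    cbn [outs] in *. apply in_flat_map. exists j. split; auto. apply in_seq. lia.
Qed.

(** At the start of a copy all weights are 1, and each of the [J] summands is at most the gain of
    [SN], which may guess any counter. Dividing by [J] leaves the whole stake. *)
Lemma claim_start m u : u <> [] -> ctl u = K0 -> ch u = Chn 0 ->
  (forall v p, hist (ctl u) v p -> chrun x (Chn 0) p = Some (ch u) ->
     INR J * crd m u <= sumR (fun j => powerRZ 2 (v j) * (V m u (SAct j (ctl u)) - cr m false u)) (seq 0 J)) ->
  cr m true u <= V m u SN.
Proof.
  intros Hu E1 E2 H. specialize (H (fun _ => 0%Z) []). rewrite E1 in H at 1.
  specialize (H hist_nil). rewrite E2 in H. specialize (H eq_refl).
  assert (H2 : sumR (fun j => powerRZ 2 0 * (V m u (SAct j (ctl u)) - cr m false u)) (seq 0 J) <=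
               sumR (fun _ => V m u SN - cr m false u) (seq 0 J)).
  { apply sumR_le. intros j Hj. apply in_seq in Hj. simpl powerRZ.
    assert (H3 := V_SN_ge m u j). rewrite Rmult_1_l. assert (V m u (SAct j (ctl u)) <= V m u SN) by (apply H3; auto; lia). lra. }
  rewrite sumR_const, length_seq in H2.
  assert (HJ : 0 < INR J) by (apply lt_0_INR; auto).
  assert (INR J * crd m u <= INR J * (V m u SN - cr m false u)) by lra.
  apply Rmult_le_reg_l in H0; auto. unfold crd in H0. lra.
Qed.

Lemma avg_scal k f u : avg (fun c => k * f c) u = k * avg f u.
Proof. unfold avg. lra. Qed.

Lemma avg_sumR (f : nat -> node -> R) l u : avg (fun c => sumR (fun j => f j c) l) u = sumR (fun j => avg (f j) u) l.
Proof.
  induction l as [|a l IH]; unfold sumR in *; simpl; [unfold avg; lra|]. rewrite <- IH. unfold avg. lra.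
Qed.

Lemma pow2Z_upd (v : counters) i j d :
  powerRZ 2 (upd v i (v i + d)%Z j) = if (i =? j)%nat then powerRZ 2 (v j) * powerRZ 2 d else powerRZ 2 (v j).
Proof.
  unfold upd. destruct (Nat.eq_dec j i), (Nat.eqb_spec i j); subst; try congruence; auto.
  apply powerRZ_add. lra.
Qed.

Lemma outs_act_inner j u K' : ctl u <> [] -> nexts K0 (ctl u) (t u) = Some K' ->
  outs K0 J x (SAct j (ctl u)) (t u) =
    match kact (ctl u) with
    | Some (Up i) => if (i =? j)%nat then both (SAct j K') else coin (SAct j K') SR
    | Some (Dn i) => if (i =? j)%nat then coin (SAct j K') SR else both (SAct j K')
    | Some (Chk i) => both (SAct j K') ++ (if (i =? j)%nat then both SD else [])
    | None => both (SAct j K')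
    end.
Proof.
  intros Hne Hn. cbn [outs]. unfold outs_act. rewrite Hn. destruct (ctl u); [congruence|reflexivity].
Qed.

Lemma nexts_letter K a K' : K <> [] -> nexts K0 K a = Some K' ->
  match kact K with Some (Up _) => a = 2%nat | _ => a <> 2%nat end /\ a <> 4%nat /\ a <> 5%nat.
Proof.
  intros Hne H. destruct K as [|[[|[]]|p q|p] K]; simpl in *; [congruence|..];
    letters a; try discriminate; repeat split; discriminate.
Qed.

Lemma act_coin_ge m u j K' : claims m -> u <> [] -> (forall b, ctl (u ++ [b]) = K') ->
  In (SAct j K', SR) (outs K0 J x (SAct j (ctl u)) (t u)) ->
  In (SR, SAct j K') (outs K0 J x (SAct j (ctl u)) (t u)) ->
  (avg (fun c => V m c (SAct j (ctl c))) u + avg (cr m false) u) / 2 <= V (S m) u (SAct j (ctl u)).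
Proof.
  intros IH Hu Hc H1 H2. eapply Rle_trans; [|apply (V_ge_coin m u _ _ _ H1 H2)].
  assert (A : avg (fun c => V m c (SAct j (ctl c))) u = avg (fun c => V m c (SAct j K')) u).
  { unfold avg. rewrite !Hc. auto. }
  assert (B : avg (cr m false) u <= avg (fun c => V m c SR) u).
  { apply avg_mono. intro b. apply IH. apply snoc_not_nil. }
  lra.
Qed.

Lemma act_both_ge m u j K' : (forall b, ctl (u ++ [b]) = K') ->
  In (SAct j K', SAct j K') (outs K0 J x (SAct j (ctl u)) (t u)) ->
  avg (fun c => V m c (SAct j (ctl c))) u <= V (S m) u (SAct j (ctl u)).
Proof.
  intros Hc H1. eapply Rle_trans; [|apply (V_ge_both m u _ _ H1)].
  unfold avg. rewrite !Hc. lra.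
Qed.

(** At [Up i] the stake is halved, and so is the gain of each follower except that of [i], whose
    weight doubles instead. At [Dn i] the follower of [i] pays a coin, and its weight is halved
    accordingly. Other steps change neither stake nor weights, until a check fails. *)
Lemma claim_sum m u v p : claims m -> u <> [] -> ctl u <> [] ->
  (forall j, avg (cr m false) u <= V (S m) u (SAct j (ctl u))) ->
  hist (ctl u) v p -> chrun x (Chn 0) p = Some (ch u) ->
  INR J * crd (S m) u <= sumR (fun j => powerRZ 2 (v j) * (V (S m) u (SAct j (ctl u)) - cr (S m) false u)) (seq 0 J).
Proof.
  intros IH Hu Hne Hlow Hh Hc.
  assert (Hn := ctl_snoc u false Hu). set (K' := ctl (u ++ [false])) in *.
  assert (HK' : forall b, ctl (u ++ [b]) = K').
  { intro b. assert (Hb := ctl_snoc u b Hu). congruence. }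
  assert (Hch : forall b, chrun x (Chn 0) (p ++ [t u]) = Some (ch (u ++ [b]))).
  { intro b. rewrite chrun_app, Hc. simpl. rewrite (ch_snoc u b Hu). auto. }
  destruct (nexts_letter _ _ _ Hne Hn) as (Ha & _ & H5).
  assert (Hout := fun j => outs_act_inner j u K' Hne Hn).
  set (G := fun j => avg (fun c => V m c (SAct j (ctl c))) u - avg (cr m false) u).
  assert (Hcont : forall v', kstep (Z.of_nat g) (kact (ctl u)) v v' ->
     INR J * avg (crd m) u <= sumR (fun j => powerRZ 2 (v' j) * G j) (seq 0 J)).
  { intros v' Hk.
    assert (Hh' : hist K' v' (p ++ [t u])) by (econstructor; eauto).
    assert (Hb : forall b, INR J * crd m (u ++ [b]) <= sumR (fun j => powerRZ 2 (v' j) * (V m (u ++ [b]) (SAct j (ctl (u ++ [b]))) - cr m false (u ++ [b]))) (seq 0 J)).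
    { intro b. destruct (IH (u ++ [b]) (snoc_not_nil u b)) as (_ & _ & _ & Hs & _).
      apply (Hs v' (p ++ [t u])); auto. rewrite HK'. auto. }
    rewrite <- avg_scal.
    apply Rle_trans with (avg (fun c => sumR (fun j => powerRZ 2 (v' j) * (V m c (SAct j (ctl c)) - cr m false c)) (seq 0 J)) u);
      [apply avg_mono; exact Hb|].
    rewrite (avg_sumR (fun j c => powerRZ 2 (v' j) * (V m c (SAct j (ctl c)) - cr m false c))).
    apply sumR_le. intros j _. unfold G, avg. lra. }
  assert (Hpos : forall j, 0 < powerRZ 2 (v j)) by (intro; apply powerRZ_lt; lra).
  destruct (kact (ctl u)) as [[i|i|i]|] eqn:EK.
  - destruct (cr_step_coin m u Ha) as [E1 E2]. rewrite E1, E2.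
    specialize (Hcont _ eq_refl).
    apply Rle_trans with (/ 2 * sumR (fun j => powerRZ 2 (upd v i (v i + 1)%Z j) * G j) (seq 0 J)); [lra|].
    rewrite <- sumR_scal. apply sumR_le. intros j _. rewrite pow2Z_upd. specialize (Hpos j). specialize (Hout j).
    destruct (i =? j)%nat.
    + assert (Hv := act_both_ge m u j K' HK'). rewrite Hout in Hv. specialize (Hv (or_introl eq_refl)).
      replace (powerRZ 2 1) with 2 by (simpl; lra).
      apply Rle_trans with (powerRZ 2 (v j) * G j); [lra|]. apply Rmult_le_compat_l; [lra|]. unfold G. lra.
    + assert (Hv := act_coin_ge m u j K' IH Hu HK'). rewrite Hout in Hv.
      specialize (Hv (or_introl eq_refl) (or_intror (or_introl eq_refl))).
      apply Rle_trans with (powerRZ 2 (v j) * (/ 2 * G j)); [lra|]. apply Rmult_le_compat_l; [lra|]. unfold G. lra.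
  - unfold crd. rewrite !cr_step_free by auto.
    specialize (Hcont _ eq_refl).
    apply Rle_trans with (INR J * avg (crd m) u); [unfold crd, avg; lra|].
    eapply Rle_trans; [exact Hcont|].
    apply sumR_le. intros j _. replace (v i - 1)%Z with (v i + -1)%Z by lia. rewrite pow2Z_upd. specialize (Hpos j). specialize (Hout j).
    destruct (i =? j)%nat.
    + assert (Hv := act_coin_ge m u j K' IH Hu HK'). rewrite Hout in Hv.
      specialize (Hv (or_introl eq_refl) (or_intror (or_introl eq_refl))).
      replace (powerRZ 2 (-1)) with (/ 2) by (simpl; lra). rewrite Rmult_assoc.
      apply Rmult_le_compat_l; [lra|]. unfold G. lra.
    + assert (Hv := act_both_ge m u j K' HK'). rewrite Hout in Hv. specialize (Hv (or_introl eq_refl)).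
      apply Rmult_le_compat_l; [lra|]. unfold G. lra.
  - unfold crd. rewrite !cr_step_free by auto.
    (* A check below [g] extends the history. Otherwise the follower of [i] suffices: it stops with
       a gain of half the stake and weight at least [2^g], so at least [J] times the stake. The
       remaining summands are nonnegative. *)
    destruct (Z.lt_ge_cases (v i) (Z.of_nat g)) as [Hlt|Hge].
    + specialize (Hcont v (conj Hlt eq_refl)).
      apply Rle_trans with (INR J * avg (crd m) u); [unfold crd, avg; lra|].
      eapply Rle_trans; [exact Hcont|]. apply sumR_le. intros j _. specialize (Hpos j). specialize (Hout j).
      assert (Hv := act_both_ge m u j K' HK'). rewrite Hout in Hv. specialize (Hv (or_introl eq_refl)).
      apply Rmult_le_compat_l; [lra|]. unfold G. lra.
    + assert (Hi : (i < J)%nat) by (apply (RS_idx (ctl u) (Chk i)); [apply ctl_in; auto|auto]).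
      apply Rle_trans with (sumR (fun j => powerRZ 2 (v j) * (V (S m) u (SAct j (ctl u)) - avg (cr m false) u)) [i]).
      * unfold sumR. cbn [map fold_right]. rewrite Rplus_0_r.
        assert (HD : avg (cr m false) u + avg (crd m) u / 2 <= V (S m) u (SAct i (ctl u))).
        { eapply Rle_trans; [|apply (V_ge_both m u _ SD)].
          - apply Rle_trans with (avg (fun c => cr m false c + crd m c / 2) u); [unfold avg; lra|].
            apply avg_mono. intro b. apply IH. apply snoc_not_nil.
          - rewrite Hout, Nat.eqb_refl. right; left; auto. }
        assert (Hg : 2 * INR J <= powerRZ 2 (v i)).
        { eapply Rle_trans; [exact J_small|]. rewrite pow_powerRZ.
          replace (v i) with (Z.of_nat g + (v i - Z.of_nat g))%Z by lia. rewrite powerRZ_add by lra.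
          assert (1 <= powerRZ 2 (v i - Z.of_nat g)).
          { destruct (v i - Z.of_nat g)%Z as [|q|q] eqn:Eq; [simpl; lra| |lia]. simpl. apply pow_R1_Rle. lra. }
          rewrite <- (Rmult_1_r (powerRZ 2 (Z.of_nat g))) at 1. apply Rmult_le_compat_l; auto. left. apply powerRZ_lt; lra. }
        assert (Hcr : 0 <= avg (crd m) u).
        { unfold avg. assert (A := crd_nonneg m (u ++ [false])). assert (B := crd_nonneg m (u ++ [true])). lra. }
        apply Rle_trans with (powerRZ 2 (v i) * (avg (crd m) u / 2)).
        -- apply Rle_trans with (2 * INR J * (avg (crd m) u / 2)); [unfold crd, avg; lra|].
           apply Rmult_le_compat_r; lra.
        -- apply Rmult_le_compat_l; [specialize (Hpos i); lra|]. lra.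
      * assert (Hincl := sumR_incl (fun j => powerRZ 2 (v j) * (V (S m) u (SAct j (ctl u)) - avg (cr m false) u)) [i] (seq 0 J)).
        apply Hincl.
        -- intro j. apply Rmult_le_pos; [specialize (Hpos j); lra|]. specialize (Hlow j). lra.
        -- repeat constructor; auto.
        -- intros j [<-|[]]. apply in_seq. lia.
  - unfold crd. rewrite !cr_step_free by auto.
    specialize (Hcont v eq_refl).
    apply Rle_trans with (INR J * avg (crd m) u); [unfold crd, avg; lra|].
    eapply Rle_trans; [exact Hcont|]. apply sumR_le. intros j _. specialize (Hpos j). specialize (Hout j).
    assert (Hv := act_both_ge m u j K' HK'). rewrite Hout in Hv. specialize (Hv (or_introl eq_refl)).
    apply Rmult_le_compat_l; [lra|]. unfold G. lra.
Qed.

(** The induction is on the horizon, which also covers copies and iterations that never end. *)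
Lemma claims_hold m : claims m.
Proof.
  induction m as [|m IH]; intros u Hu.
  - unfold crd. simpl. repeat split; intros; try lra.
    rewrite Rminus_diag, Rmult_0_r. apply sumR_nonneg. intros; lra.
  - assert (Hcu : forall b, u ++ [b] <> []) by (intro; apply snoc_not_nil).
    assert (HR : avg (cr m false) u <= avg (fun c => V m c SR) u) by (apply avg_mono; intro; apply IH; auto).
    assert (HN : t u = 4%nat \/ t u = 5%nat -> avg (cr m true) u <= avg (fun c => V m c SN) u).
    { intro Ha. apply avg_mono; intro b. destruct (copy_end u b Hu Ha) as (_ & E1 & _ & E2). apply IH; auto. }
    assert (Hrange := letter_range u).
    assert (CR : cr (S m) false u <= V (S m) u SR).
    { destruct (Nat.eq_dec (t u) 5) as [E|E].
      - destruct (cr_step_end m u E) as [-> _]. eapply Rle_trans; [apply HN; auto|].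
        apply V_ge_both. cbn [outs]. rewrite E. left; auto.
      - assert (E' : cr (S m) false u = avg (cr m false) u) by (cbn [cr]; letters (t u); congruence).
        rewrite E'. eapply Rle_trans; [exact HR|]. apply V_ge_both. cbn [outs].
        letters (t u); try congruence; left; auto. }
    assert (Hfalse : t u <> 5%nat -> cr (S m) false u = avg (cr m false) u).
    { intro E. cbn [cr]; letters (t u); congruence. }
    assert (Hlow : ctl u <> [] -> forall j, avg (cr m false) u <= V (S m) u (SAct j (ctl u))).
    { intros Hne j. assert (Hn := ctl_snoc u false Hu). set (K' := ctl (u ++ [false])) in *.
      assert (HK' : forall b, ctl (u ++ [b]) = K') by (intro b; assert (Hb := ctl_snoc u b Hu); congruence).
      assert (Hout := outs_act_inner j u K' Hne Hn).
      assert (HA : avg (cr m false) u <= avg (fun c => V m c (SAct j (ctl c))) u) by (apply avg_mono; intro; apply IH; auto).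
      assert (H1 := act_coin_ge m u j K' IH Hu HK'). assert (H2 := act_both_ge m u j K' HK').
      rewrite Hout in H1, H2.
      destruct (kact (ctl u)) as [[i|i|i]|]; try destruct (i =? j)%nat;
        try (eapply Rle_trans; [exact HA|apply H2; left; reflexivity]);
        (eapply Rle_trans; [|apply H1; [left; reflexivity|right; left; reflexivity]]; lra). }
    assert (CA : forall j, cr (S m) false u <= V (S m) u (SAct j (ctl u))).
    { intro j. destruct (ctl u) as [|q K] eqn:EK.
      - assert (Ha := ctl_empty u Hu EK). destruct Ha as [E|E].
        + rewrite Hfalse by lia. eapply Rle_trans; [exact HR|]. apply V_ge_both. cbn [outs]. unfold outs_act.
          rewrite E. simpl. auto.
        + destruct (cr_step_end m u E) as [-> _]. eapply Rle_trans; [apply HN; auto|].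
          apply V_ge_both. cbn [outs]. unfold outs_act. rewrite E. simpl. auto.
      - rewrite <- EK in *.
        assert (Hne : ctl u <> []) by congruence.
        destruct (nexts_letter _ _ _ Hne (ctl_snoc u false Hu)) as (_ & _ & H5).
        rewrite Hfalse by auto. apply Hlow; auto. }
    assert (CS : forall v p, hist (ctl u) v p -> chrun x (Chn 0) p = Some (ch u) ->
       INR J * crd (S m) u <= sumR (fun j => powerRZ 2 (v j) * (V (S m) u (SAct j (ctl u)) - cr (S m) false u)) (seq 0 J)).
    { intros v p Hh Hc. destruct (ctl u) as [|q K] eqn:EK.
      (* A history that reaches the empty stack would be a good word, which is excluded: every
         finished copy has a failed check. *)
      - exfalso. assert (Ha := ctl_empty u Hu EK). destruct (copy_end u false Hu Ha) as (_ & _ & Hd & _).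
        apply (no_good p). split; [|congruence].
        rewrite <- (app_nil_r p). eapply hist_okpath; [exact Hh|constructor].
      - rewrite <- EK in *. assert (Hne : ctl u <> []) by congruence. eapply claim_sum; eauto. }
    split; [|split; [|split; [|split]]]; auto.
    + assert (HD : avg (fun c => cr m false c + crd m c / 2) u <= avg (fun c => V m c SD) u).
      { apply avg_mono; intro b. apply IH; auto. }
      destruct (Nat.eq_dec (t u) 2) as [E2|E2]; [|destruct (Nat.eq_dec (t u) 4) as [E4|E4]; [|destruct (Nat.eq_dec (t u) 5) as [E5|E5]]].
      * destruct (cr_step_coin m u E2) as [-> ->].
        eapply Rle_trans; [|apply (V_ge_coin m u SD SD SR); cbn [outs]; rewrite E2; simpl; auto].
        unfold avg in *. lra.
      (* The coin paid by [SD] at letter 4 is the reason for the half in the claim on [SD]: the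
         average of [SN] and [SR] keeps half of the stake. *)
      * unfold crd. rewrite !cr_step_free by lia.
        eapply Rle_trans; [|apply (V_ge_coin m u SD SN SR); cbn [outs]; rewrite E4; simpl; auto].
        specialize (HN (or_introl E4)). unfold avg in *. lra.
      * assert (H1 : 1 <= V (S m) u SD).
        { eapply Rle_trans; [|apply (V_ge m u SD SRN SRN)].
          - unfold pair_value. simpl. lra.
          - cbn [outs]. rewrite E5. left; auto. }
        assert (B1 := cr_bounds (S m) true u). assert (B2 := cr_alive (S m) u). unfold crd. lra.
      * unfold crd. rewrite !cr_step_free by lia.
        eapply Rle_trans; [|apply (V_ge_both m u SD SD)].
        -- unfold crd, avg in *. lra.
        -- cbn [outs]. letters (t u); try congruence; left; auto.
    + intros E1 E2. apply claim_start; auto.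
Qed.

(** * A run that visits [SRN] infinitely often with positive probability *)

Definition live (u : node) (s : st) : Prop :=
  match s with
  | SN | SRN => ctl u = K0 /\ ch u = Chn 0
  | SR | SD => True
  | SAct j K => K = ctl u /\ (j < J)%nat
  | _ => False
  end.

(** Whatever the state, even [SR], the chance of risk is at least that of credit from a dead state,
    which tends to 1 with the horizon. So a new visit can be sought from anywhere. *)
Lemma live_V m u s : u <> [] -> live u s -> cr m false u <= V m u s.
Proof.
  intros Hu Hs. destruct (claims_hold m u Hu) as (H1 & H2 & H3 & _ & H5).
  assert (Hd := crd_nonneg m u). assert (Ha := cr_alive m u).
  destruct s; simpl in Hs; try contradiction.
  - specialize (H5 (proj1 Hs) (proj2 Hs)). lra.
  - replace (V m u SRN) with (V m u SN) by (destruct m; reflexivity).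
    specialize (H5 (proj1 Hs) (proj2 Hs)). lra.
  - auto.
  - lra.
  - destruct Hs as [-> _]. auto.
Qed.

(** A state without transition would have value 0, against [live_V] and the probability of
    credit. *)
Lemma live_outs u s : u <> [] -> live u s -> outs K0 J x s (t u) <> [].
Proof.
  intros Hu Hs E. destruct (credit_eventually u (/ 2) Hu) as [m Hm]; [lra|].
  assert (H := live_V m u s Hu Hs). destruct m as [|m]; [simpl in Hm; lra|].
  cbn [V] in H. rewrite E in H. cbn [map fold_right] in H. lra.
Qed.

Lemma live_act_step u j s0 s1 : u <> [] -> (j < J)%nat -> In (s0, s1) (outs_act K0 j (ctl u) (t u)) ->
  live (u ++ [false]) s0 /\ live (u ++ [true]) s1.
Proof.
  intros Hu Hj Hin. unfold outs_act in Hin.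
  assert (Hf := ctl_snoc u false Hu). assert (Ht := ctl_snoc u true Hu).
  rewrite Hf in Hin. destruct (ctl u) as [|q K] eqn:EK.
  - assert (Ha := ctl_empty u Hu EK). simpl in Hin. destruct Hin as [Hin|[]].
    destruct (copy_end u false Hu Ha) as (_ & A1 & _ & A2). destruct (copy_end u true Hu Ha) as (_ & B1 & _ & B2).
    destruct (t u =? 5)%nat; inversion Hin; subst; simpl; auto.
  - set (Kf := ctl (u ++ [false])) in *. set (Kt := ctl (u ++ [true])) in *.
    assert (E : Kf = Kt) by congruence.
    destruct (kact (q :: K)) as [[i|i|i]|]; try destruct (i =? j)%nat; simpl in Hin;
      solve_pairs; simpl; auto.
Qed.

Lemma live_step u s s0 s1 : u <> [] -> live u s -> In (s0, s1) (outs K0 J x s (t u)) ->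
  live (u ++ [false]) s0 /\ live (u ++ [true]) s1.
Proof.
  intros Hu Hs Hin. assert (Hr := letter_range u).
  assert (HN : ctl u = K0 -> In (s0, s1) (flat_map (fun j => outs_act K0 j K0 (t u)) (seq 0 J)) ->
     live (u ++ [false]) s0 /\ live (u ++ [true]) s1).
  { intros E Hi. apply in_flat_map in Hi. destruct Hi as (j & Hj & Hi). apply in_seq in Hj.
    apply (live_act_step u j); auto; [lia|]. rewrite E. auto. }
  assert (HE : t u = 4%nat \/ t u = 5%nat -> forall b s, s = SN \/ s = SRN -> live (u ++ [b]) s).
  { intros Ha b s' Hs'. destruct (copy_end u b Hu Ha) as (_ & A1 & _ & A2). destruct Hs' as [-> | ->]; simpl; auto. }
  destruct s; simpl in Hs; try contradiction; cbn [outs] in Hin.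
  - apply HN; tauto.
  - apply HN; tauto.
  - letters (t u); simpl in Hin; solve_pairs; try exact I; auto.
  - letters (t u); simpl in Hin; solve_pairs; try exact I; auto.
  - destruct Hs as [-> Hj]. apply (live_act_step u j); auto.
Qed.

(** Length of stage [i] if it begins at level [n + 1]. The errors [2^-(i + 2)] of all stages add up
    to one half. *)
Definition horizon (i n : nat) : nat :=
  proj1_sig (constructive_indefinite_description _ (credit_uniform n ((/ 2) ^ (i + 2)) (half_pow_pos (i + 2)))).

Lemma horizon_spec i n u : length u = S n -> 1 - (/ 2) ^ (i + 2) <= cr (horizon i n) false u.
Proof. unfold horizon. destruct constructive_indefinite_description as [m Hm]. simpl. apply Hm. Qed.

Lemma quarter i : (/ 2) ^ (i + 2) <= / 4.
Proof. rewrite pow_add. assert (H := half_pow_le1 i). simpl. lra. Qed.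

Lemma horizon_pos i n : horizon i n <> 0%nat.
Proof.
  intro E. assert (H := horizon_spec i n (repeat false (S n)) (repeat_length _ _)). rewrite E in H. simpl in H.
  assert (H1 := quarter i). simpl in *. lra.
Qed.

(* Stage and number of levels left in the stage, for the nodes of length [n + 1]. *)
Fixpoint stage (n : nat) : nat * nat :=
  match n with
  | O => (0, horizon 0 0)%nat
  | S n => let (i, r) := stage n in
           if (r =? 1)%nat then (S i, horizon (S i) (S n)) else (i, pred r)
  end.

Lemma stage_pos n : snd (stage n) <> 0%nat.
Proof.
  induction n as [|n IH]; simpl; [apply horizon_pos|].
  destruct (stage n) as [i r]. simpl in IH. destruct (Nat.eqb_spec r 1); simpl; [apply horizon_pos|lia].
Qed.

Definition pick (m : nat) (u : node) (s : st) : st * st :=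
  epsilon (inhabits (SX, SX)) (fun p => In p (outs K0 J x s (t u)) /\ V (S m) u s = pair_value (V m) u p).

Lemma pick_spec m u s : u <> [] -> live u s ->
  In (pick m u s) (outs K0 J x s (t u)) /\ V (S m) u s = pair_value (V m) u (pick m u s).
Proof. intros Hu Hs. unfold pick. apply epsilon_spec. apply V_attained. apply live_outs; auto. Qed.

Definition is_srn (s : st) : bool := match s with SRN => true | _ => false end.

(** [rs_vis] records a visit to [SRN] in the present stage, and [rs_ok] that no completed stage has
    missed one. *)
Record rstate : Type := mkRS { rs_st : st; rs_vis : bool; rs_ok : bool }.

(** With [r] levels left in the stage, the transition is one that attains [V r]. The last level of a
    stage, [r = 1], takes the verdict and resets [rs_vis]. *)
Definition risk_step (u : node) (b : bool) (z : rstate) : rstate :=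
  match u with
  | [] => mkRS SN false true
  | _ :: u' =>
      let r := snd (stage (length u')) in
      let p := pick (pred r) u (rs_st z) in
      let s := if b then snd p else fst p in
      let vis := (rs_vis z || is_srn s)%bool in
      if (r =? 1)%nat then mkRS s false (rs_ok z && vis) else mkRS s vis (rs_ok z)
  end.

Definition rtrack (u : node) : rstate := track risk_step (mkRS SInit false true) u.

Lemma rtrack_snoc u b : rtrack (u ++ [b]) = risk_step u b (rtrack u).
Proof. apply track_snoc. Qed.

Lemma rs_st_snoc u b n : length u = S n ->
  rs_st (rtrack (u ++ [b])) =
    let p := pick (pred (snd (stage n))) u (rs_st (rtrack u)) in if b then snd p else fst p.
Proof.
  intro H. rewrite rtrack_snoc. destruct u as [|c u]; [discriminate|]. injection H as H.
  unfold risk_step. rewrite H. destruct (snd (stage n) =? 1)%nat; reflexivity.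
Qed.

Lemma rtrack_live u : u <> [] -> live u (rs_st (rtrack u)).
Proof.
  induction u as [|b u IH] using rev_ind; [congruence|]. intros _.
  destruct u as [|c u].
  - unfold rtrack, track. simpl. rewrite ctl_init, ch_init. auto.
  - rewrite (rs_st_snoc _ _ (length u)) by reflexivity. cbv zeta.
    assert (Hne : c :: u <> []) by discriminate. specialize (IH Hne).
    destruct (pick_spec (pred (snd (stage (length u)))) (c :: u) _ Hne IH) as [Hin _].
    destruct (pick (pred (snd (stage (length u)))) (c :: u) (rs_st (rtrack (c :: u)))) as [s0 s1].
    destruct (live_step _ _ _ _ Hne IH Hin). destruct b; auto.
Qed.

Lemma rtrack_run : srun K0 J x t (fun u => rs_st (rtrack u)).
Proof.
  split; [reflexivity|]. intro u. destruct u as [|c u].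
  - unfold rtrack, track. simpl. auto 10.
  - rewrite !(rs_st_snoc _ _ (length u)) by reflexivity. cbv zeta.
    assert (Hne : c :: u <> []) by discriminate.
    destruct (pick_spec (pred (snd (stage (length u)))) (c :: u) _ Hne (rtrack_live _ Hne)) as [Hin _].
    rewrite <- surjective_pairing. auto.
Qed.

(* A submartingale, at least [1/2] at level 1, at most 1, and 0 once a completed stage missed [SRN]. *)
Definition progress (u : node) : R :=
  let z := rtrack u in
  let (i, r) := stage (pred (length u)) in
  if rs_ok z then (if rs_vis z then 1 else V r u (rs_st z)) - (/ 2) ^ (i + 2) else 0.

Lemma stage_start_value i n u : length u = S n -> live u (rs_st (rtrack u)) ->
  1 - (/ 2) ^ (i + 2) <= V (horizon i n) u (rs_st (rtrack u)).
Proof.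
  intros Hl Hs. eapply Rle_trans; [apply (horizon_spec i n u Hl)|]. apply live_V; auto.
  destruct u; discriminate.
Qed.

(** Within a stage optimal transitions preserve the value. A successful stage [i] ends with
    [1 - 2^-(i + 2)], and the next one begins with at least [1 - 2 * 2^-(i + 3)], the same
    number. *)
Lemma progress_submart u : u <> [] -> progress u <= avg progress u.
Proof.
  intro Hu. assert (Hn : exists n, length u = S n) by (destruct u; [congruence|simpl; eauto]).
  destruct Hn as [n Hn]. assert (Hs := rtrack_live u Hu).
  set (z := rtrack u) in *. destruct (stage n) as [i r] eqn:Est.
  assert (Hr := stage_pos n). rewrite Est in Hr. simpl in Hr. destruct r as [|r]; [congruence|].
  destruct (pick_spec r u (rs_st z) Hu Hs) as [_ Hv].
  set (p := pick r u (rs_st z)) in *.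
  assert (Hch : forall b, rtrack (u ++ [b]) =
     let s := if b then snd p else fst p in let vis := (rs_vis z || is_srn s)%bool in
     if (S r =? 1)%nat then mkRS s false (rs_ok z && vis) else mkRS s vis (rs_ok z)).
  { intro b. rewrite rtrack_snoc. destruct u as [|c u']; [congruence|]. simpl in Hn. injection Hn as Hn.
    unfold risk_step. rewrite Hn, Est. reflexivity. }
  assert (Hval : forall b, progress (u ++ [b]) >=
     if rs_ok z then
       (let s := if b then snd p else fst p in
        if rs_vis z then 1 else visit s (V r (u ++ [b]) s)) - (/ 2) ^ (i + 2)
     else 0).
  { intro b. assert (Hlen : length (u ++ [b]) = S (S n)) by (rewrite length_app; simpl; lia).
    assert (Hlive := rtrack_live (u ++ [b]) (snoc_not_nil u b)).
    assert (Hstart := stage_start_value (S i) (S n) (u ++ [b]) Hlen Hlive).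
    unfold progress. rewrite Hlen. simpl pred. cbn [stage]. rewrite Est. rewrite Hch in *. cbv zeta in *.
    set (s := if b then snd p else fst p) in *.
    assert (Hp := half_pow_pos (i + 2)).
    assert (Hhalf : (/ 2) ^ (S i + 2) = (/ 2) ^ (i + 2) / 2) by (simpl; lra).
    rewrite Hhalf in *.
    destruct r as [|r].
    - cbn [Nat.eqb rs_st rs_vis rs_ok] in *. destruct (rs_ok z); simpl; [|lra].
      destruct (rs_vis z); simpl; [lra|]. destruct s; simpl in *; lra.
    - cbn [Nat.eqb rs_st rs_vis rs_ok pred] in *. destruct (rs_ok z); [|lra].
      destruct (rs_vis z); simpl orb; [lra|]. destruct s; cbn [is_srn visit]; lra. }
  assert (H0 := Hval false). assert (H1 := Hval true).
  unfold progress at 1. rewrite Hn. simpl pred. rewrite Est. fold z.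
  unfold avg. destruct (rs_ok z); [|lra].
  cbv zeta in H0, H1. destruct (rs_vis z); [lra|].
  rewrite Hv. unfold pair_value. lra.
Qed.

Lemma progress_mass n : / 2 <= Ex (S n) progress.
Proof.
  induction n as [|n IH].
  - simpl. assert (H : forall b, / 2 <= progress [b]).
    { intro b. assert (Hl := rtrack_live [b]). unfold progress. simpl.
      assert (Hstart := stage_start_value 0 0 [b] eq_refl (Hl ltac:(discriminate))).
      unfold rtrack, track in *. simpl in *. lra. }
    assert (H0 := H false). assert (H1 := H true). lra.
  - eapply Rle_trans; [exact IH|]. rewrite (Ex_snoc (S n)). apply Ex_mono. intros u Hu.
    apply progress_submart. destruct u; discriminate.
Qed.

Lemma ok_snoc u b : rs_ok (rtrack (u ++ [b])) = true -> rs_ok (rtrack u) = true.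
Proof.
  rewrite rtrack_snoc. unfold risk_step. destruct u as [|c u]; [auto|].
  destruct (snd (stage (length u)) =? 1)%nat; simpl; auto. intro H. apply Bool.andb_true_iff in H. tauto.
Qed.

(** Induction on the levels left: if no visit comes earlier, the verdict at the last level of the
    stage requires one there. *)
Lemma visit_within pi : (forall n, rs_ok (rtrack (bprefix pi n)) = true) ->
  forall d n, snd (stage n) = S d -> rs_vis (rtrack (bprefix pi (S n))) = false ->
  exists m, (n <= m)%nat /\ rs_st (rtrack (bprefix pi m)) = SRN.
Proof.
  intro Hok. induction d as [|d IH]; intros n Hr Hv.
  - assert (Ho := Hok (S (S n))). rewrite bprefix_S, rtrack_snoc in Ho.
    assert (Hl := bprefix_length pi (S n)). destruct (bprefix pi (S n)) as [|c u] eqn:E; [discriminate|].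
    injection Hl as Hl. assert (Hst := rs_st_snoc (c :: u) (pi (S n)) n). unfold risk_step in Ho. rewrite Hl, Hr in Ho.
    simpl in Ho. rewrite Hv in Ho. apply Bool.andb_true_iff in Ho. destruct Ho as [_ Ho]. simpl in Ho.
    exists (S (S n)). split; [lia|]. rewrite bprefix_S, E, Hst by (simpl; congruence). rewrite Hr. simpl.
    destruct (if pi (S n) then _ else _); simpl in Ho; congruence.
  - destruct (classic (rs_st (rtrack (bprefix pi (S (S n)))) = SRN)) as [H|H]; [exists (S (S n)); split; auto; lia|].
    destruct (IH (S n)) as (m & Hm & Em).
    + simpl. destruct (stage n) as [i r]. simpl in Hr. subst r. reflexivity.
    + revert H. rewrite bprefix_S.
      assert (Hl := bprefix_length pi (S n)). rewrite (rs_st_snoc _ _ n) by auto.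
      rewrite rtrack_snoc. destruct (bprefix pi (S n)) as [|c u] eqn:E; [discriminate|].
      injection Hl as Hl. unfold risk_step. rewrite Hl, Hr, Hv. simpl. intro H.
      destruct (if pi (S n) then _ else _); simpl; congruence.
    + exists m. split; auto. lia.
Qed.

Lemma stage_restart pi d : forall n, snd (stage n) = S d ->
  exists m, (n <= m)%nat /\ rs_vis (rtrack (bprefix pi (S m))) = false.
Proof.
  induction d as [|d IH]; intros n Hr.
  - exists (S n). split; [lia|]. rewrite bprefix_S, rtrack_snoc.
    assert (Hl := bprefix_length pi (S n)). destruct (bprefix pi (S n)) as [|c u]; [discriminate|].
    injection Hl as Hl. unfold risk_step. rewrite Hl, Hr. reflexivity.
  - destruct (IH (S n)) as (m & Hm & E); [|exists m; split; auto; lia].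
    simpl. destruct (stage n) as [i r]. simpl in Hr. subst r. reflexivity.
Qed.

(** The branches on which no stage fails form a closed set of mass at least one half. On them [SRN],
    of priority 1, recurs, while risk states never have priority 0, so the run is not qualitatively
    accepting. *)
Lemma tracked_contradiction : False.
Proof.
  assert (Hl : mu_null (fun pi => ~ sacc (along (fun u => rs_st (rtrack u)) pi))) by (apply t_lang; apply rtrack_run).
  revert Hl.
  assert (H : ~ mu_null (fun pi => forall n, rs_ok (rtrack (bprefix pi n)) = true)).
  { apply (closed_not_null (fun u => rs_ok (rtrack u) = true) (/ 2)); [lra| |].
    - intros u v [w ->]. induction w as [|b w IH] using rev_ind; [rewrite app_nil_r; auto|].
      rewrite app_assoc. intro H. apply IH. eapply ok_snoc; eauto.
    - intro d. exists (S d). split; [lia|]. eapply Rle_trans; [apply progress_mass|].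
      apply Ex_mono. intros u _. unfold progress, indic. destruct (stage (pred (length u))) as [i r].
      assert (Hv := V_bounds r u (rs_st (rtrack u))). assert (Hp := half_pow_pos (i + 2)).
      destruct (rs_ok (rtrack u)), (em _); try congruence; try lra;
        destruct (rs_vis (rtrack u)); lra. }
  intro Hl. apply H. eapply null_subset; [|exact Hl]. intros pi Hok [Hc|[N Hc]].
  - destruct (Hc 1%nat) as (n & Hn & E). unfold along in E.
    assert (Hlive := rtrack_live (bprefix pi n)).
    assert (Hne : bprefix pi n <> []) by (intro E'; apply (f_equal (@length bool)) in E'; rewrite bprefix_length in E'; simpl in E'; lia).
    specialize (Hlive Hne). destruct (rs_st (rtrack (bprefix pi n))); simpl in *; try discriminate; contradiction.
  - assert (Hr := stage_pos N). destruct (snd (stage N)) as [|d] eqn:E; [congruence|].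
    destruct (stage_restart pi d N E) as (m & Hm & Ev).
    assert (Hr' := stage_pos m). destruct (snd (stage m)) as [|d'] eqn:E'; [congruence|].
    destruct (visit_within pi Hok d' m E' Ev) as (k & Hk & Ek).
    apply (Hc k); [lia|]. unfold along. rewrite Ek. reflexivity.
Qed.
End Tracked.

Theorem no_good_word_contradiction : False.
Proof.
  destruct (deterministic_mode stack SFmt (nexts K0) K0) as (ctl & C1 & C2).
  - intros z a. cbn [outs]. destruct (nexts K0 z a); reflexivity.
  - simpl. auto.
  - destruct (deterministic_mode chst SCh (chstep x) (Chn 0)) as (ch & D1 & D2).
    + intros z a. cbn [outs]. destruct (chstep x z a); reflexivity.
    + simpl. auto.
    + eapply tracked_contradiction; eauto.
Qed.
End Cheat.

Close Scope R_scope.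

(** * Numbering the automaton and diagonalizing *)

Lemma revals_det gs v : Forall (fun f => forall v y y', reval f v y -> reval f v y' -> y = y') gs ->
  forall ys ys', revals gs v ys -> revals gs v ys' -> ys = ys'.
Proof.
  induction 1 as [|g gs Hg Hgs IH]; intros ys ys' H H'; inversion H; inversion H'; subst; auto.
  f_equal; eauto.
Qed.

(** Used to exclude that the final search stops at an argument where the function has value 1. *)
Lemma reval_det f : forall v y y', reval f v y -> reval f v y' -> y = y'.
Proof.
  induction f as [| |i|f gs IHf IHgs|f g IHf IHg|f IHf] using recf_nested_ind; intros v y y' H H'.
  - inversion H; inversion H'; subst; auto.
  - inversion H; subst; inversion H'; subst; auto.
  - inversion H; inversion H'; subst; auto.
  - inversion H; inversion H'; subst. assert (ws = ws0) by (eapply revals_det; eauto). subst. eauto.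
  - destruct v as [|n v]; [inversion H|]. revert y y' H H'. induction n as [|n IHn]; intros y y' H H'.
    + inversion H; inversion H'; subst. eauto.
    + inversion H; inversion H'; subst. assert (r = r0) by eauto. subst. eauto.
  - inversion H as [| | | | | |f1 v1 n1 A1 B1]; inversion H' as [| | | | | |f2 v2 n2 A2 B2]; subst.
    destruct (Nat.lt_trichotomy y y') as [Hlt|[E|Hlt]]; auto.
    + destruct (B2 y Hlt) as [k Hk]. discriminate (IHf _ _ _ A1 Hk).
    + destruct (B1 y' Hlt) as [k Hk]. discriminate (IHf _ _ _ A2 Hk).
Qed.

(** * Computing the automaton from the code of its fixed transitions *)

Fixpoint tri (n : nat) : nat := match n with 0 => 0 | S n => tri n + S n end.

Lemma tri_double n : tri n * 2 = n * (n + 1).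
Proof. induction n as [|n IH]; simpl tri; lia. Qed.

(** Triangular numbers replace the division in [cpair] by a primitive recursion. *)
Lemma cpair_tri a b : cpair a b = tri (a + b) + b.
Proof. unfold cpair. rewrite <- tri_double, Nat.div_mul; auto. Qed.

Lemma tri_ge n : n <= tri n.
Proof. induction n; simpl; lia. Qed.

Lemma cpair_ge a b : a <= cpair a b /\ b <= cpair a b.
Proof. rewrite cpair_tri. assert (H := tri_ge (a + b)). lia. Qed.

(** A code exceeds everything it encodes; this is how [x] bounds the numbers of the states in the
    list it encodes. *)
Lemma enc_list_ge l a : In a l -> a < enc_list l.
Proof.
  induction l as [|b l IH]; intros []; simpl.
  - subst. assert (H := cpair_ge a (enc_list l)). lia.
  - assert (H0 := cpair_ge b (enc_list l)). specialize (IH H). lia.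
Qed.

(** Names in [e_] combine functions of a common argument list, names in [r_] are functions with
    arguments of their own. *)
Definition e_var (i : nat) : recf := rProj i.
Definition e_succ (a : recf) : recf := rComp rSucc [a].
Fixpoint e_const (c : nat) : recf := match c with 0 => rZero | S c => e_succ (e_const c) end.
Definition r_add : recf := rPrim (e_var 0) (e_succ (e_var 1)).
Definition e_add (a b : recf) : recf := rComp r_add [a; b].
Definition r_tri : recf := rPrim rZero (e_add (e_var 1) (e_succ (e_var 0))).
Definition e_pair (a b : recf) : recf := e_add (rComp r_tri [e_add a b]) b.
Definition e_cons (a b : recf) : recf := e_succ (e_pair a b).

Lemma ev_succ1 a v n : reval a v n -> reval (e_succ a) v (S n).
Proof. intro H. econstructor; [|constructor]. repeat econstructor; eauto. Qed.

Lemma ev_const c v : reval (e_const c) v c.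
Proof. induction c; simpl; [constructor|]. apply ev_succ1; auto. Qed.

Lemma ev_var i v n : nth_error v i = Some n -> reval (e_var i) v n.
Proof.
  intro H. assert (E : n = nth i v 0) by (symmetry; apply nth_error_nth; auto). rewrite E.
  constructor. apply nth_error_Some. congruence.
Qed.

Lemma ev_comp1 f a v n y : reval a v n -> reval f [n] y -> reval (rComp f [a]) v y.
Proof. intros. econstructor; eauto. repeat constructor; auto. Qed.

Lemma ev_comp2 f a b v n m y : reval a v n -> reval b v m -> reval f [n; m] y -> reval (rComp f [a; b]) v y.
Proof. intros. econstructor; eauto. repeat constructor; auto. Qed.

Lemma ev_add a b v n m : reval a v n -> reval b v m -> reval (e_add a b) v (n + m).
Proof.
  intros Ha Hb. eapply ev_comp2; eauto. clear Ha Hb.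
  induction n as [|n IH]; simpl.
  - constructor. apply ev_var. auto.
  - econstructor; eauto. apply ev_succ1. apply ev_var. auto.
Qed.

Lemma ev_tri n : reval r_tri [n] (tri n).
Proof.
  induction n as [|n IH]; simpl; [repeat constructor|].
  econstructor; eauto. apply ev_add; [|apply ev_succ1]; apply ev_var; auto.
Qed.

Lemma ev_pair a b v n m : reval a v n -> reval b v m -> reval (e_pair a b) v (cpair n m).
Proof.
  intros Ha Hb. rewrite cpair_tri. apply ev_add; auto.
  eapply ev_comp1; [apply ev_add; eauto|]. apply ev_tri.
Qed.

Lemma ev_cons a b v n m : reval a v n -> reval b v m -> reval (e_cons a b) v (S (cpair n m)).
Proof. intros. apply ev_succ1, ev_pair; auto. Qed.

Definition tr4 : Type := (nat * nat * nat * nat)%type.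

(* Transitions of the counting state [c] ([11 + 2 j] for [Chn j]): letters 0 and 1 lead to [d0] and
   [d1], letters 2 and 3 loop, letters 4 and 5 lead to the sink, numbered 1. *)
Definition block (c d0 d1 : nat) : list tr4 :=
  [(c, 0, d0, d0); (c, 1, d1, d1); (c, 2, c, c); (c, 3, c, c); (c, 4, 1, 1); (c, 5, 1, 1)].

(** Odd numbers from 11 on: they avoid the even numbers from 12 on that [code] gives to stacks and
    followers, whatever [x] is. *)
Definition chain_num (j : nat) : nat := 11 + (j + j).

Fixpoint chain (j : nat) (l : list tr4) : list tr4 :=
  match j with
  | 0 => l
  | S j => block (chain_num j) 1 (chain_num (S j)) ++ chain j l
  end.

Definition fixed_prios : list nat := [2; 1; 2; 1; 1; 0; 2; 1; 2; 2; 2].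

(** When [x] is the code of [l], the states in [l] have numbers below [x] or among the fixed ones,
    and the chain goes up to [11 + 2 x]; so [13 + 2 x] states are enough, and the count is
    computable from [x]. *)
Definition input_pta (x : nat) (l : list tr4) : pta :=
  mkPTA (13 + (x + x)) 6 0 (block (chain_num x) 10 1 ++ chain x l)
    (fixed_prios ++ repeat 2 (2 + (x + x))).

Definition e_tr (q a q0 q1 : recf) : recf := e_pair q (e_pair a (e_pair q0 q1)).

Definition e_block (c d0 d1 rest : recf) : recf :=
  e_cons (e_tr c (e_const 0) d0 d0) (e_cons (e_tr c (e_const 1) d1 d1)
  (e_cons (e_tr c (e_const 2) c c) (e_cons (e_tr c (e_const 3) c c)
  (e_cons (e_tr c (e_const 4) (e_const 1) (e_const 1))
  (e_cons (e_tr c (e_const 5) (e_const 1) (e_const 1)) rest))))).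

Definition e_chain_num (a : recf) : recf := e_add (e_const 11) (e_add a a).

(** In the step function of [rPrim], argument 0 is the index and argument 1 the value obtained so
    far. *)
Definition r_chain : recf :=
  rPrim (e_var 0) (e_block (e_chain_num (e_var 0)) (e_const 1) (e_chain_num (e_succ (e_var 0))) (e_var 1)).

Definition r_rep : recf := rPrim rZero (e_cons (e_const 2) (e_var 1)).

Definition e_list (l : list nat) (rest : recf) : recf :=
  fold_right (fun c e => e_cons (e_const c) e) rest l.

Definition r_pta : recf :=
  e_pair (e_add (e_const 13) (e_add (e_var 0) (e_var 0)))
 (e_pair (e_const 6)
 (e_pair (e_const 0)
 (e_pair (e_block (e_chain_num (e_var 0)) (e_const 10) (e_const 1) (rComp r_chain [e_var 0; e_var 0]))
         (e_list fixed_prios (rComp r_rep [e_add (e_const 2) (e_add (e_var 0) (e_var 0))]))))).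

Definition enc_trs (l : list tr4) : nat := enc_list (map enc_trans l).

Lemma ev_tr q a q0 q1 v n1 n2 n3 n4 : reval q v n1 -> reval a v n2 -> reval q0 v n3 -> reval q1 v n4 ->
  reval (e_tr q a q0 q1) v (enc_trans (n1, n2, n3, n4)).
Proof. intros. simpl. repeat apply ev_pair; auto. Qed.

Lemma ev_block c d0 d1 rest v nc n0 n1 l : reval c v nc -> reval d0 v n0 -> reval d1 v n1 ->
  reval rest v (enc_trs l) -> reval (e_block c d0 d1 rest) v (enc_trs (block nc n0 n1 ++ l)).
Proof.
  intros Hc H0 H1 Hr. unfold e_block, enc_trs, block. cbn [map app enc_list].
  repeat apply ev_cons; try apply ev_tr; auto; apply ev_const.
Qed.

Lemma ev_chain_num a v n : reval a v n -> reval (e_chain_num a) v (chain_num n).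
Proof. intro H. apply ev_add; [apply ev_const|]. apply ev_add; auto. Qed.

Lemma ev_chain j l : reval r_chain [j; enc_trs l] (enc_trs (chain j l)).
Proof.
  induction j as [|j IH]; cbn [chain].
  - constructor. apply ev_var. auto.
  - econstructor; eauto. apply ev_block.
    + apply ev_chain_num, ev_var; auto.
    + apply ev_const.
    + apply ev_chain_num, ev_succ1, ev_var; auto.
    + apply ev_var; auto.
Qed.

Lemma ev_rep n : reval r_rep [n] (enc_list (repeat 2 n)).
Proof.
  induction n as [|n IH]; simpl; [repeat constructor|].
  econstructor; eauto. apply ev_cons; [apply (ev_const 2)|apply ev_var; auto].
Qed.

Lemma ev_list l rest v l' : reval rest v (enc_list l') -> reval (e_list l rest) v (enc_list (l ++ l')).
Proof. intro H. induction l as [|c l IH]; simpl; auto. apply ev_cons; auto. apply ev_const. Qed.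

Lemma ev_pta x l : enc_trs l = x -> reval r_pta [x] (enc_pta (input_pta x l)).
Proof.
  intro Hx. unfold r_pta, enc_pta, input_pta. cbn [pta_nstates pta_nletters pta_init pta_delta pta_prio].
  assert (Hv : reval (e_var 0) [x] x) by (apply ev_var; auto).
  assert (H2 : reval (e_add (e_var 0) (e_var 0)) [x] (x + x)) by (apply ev_add; auto).
  apply ev_pair; [apply ev_add; auto; apply ev_const|].
  apply ev_pair; [apply ev_const|]. apply ev_pair; [apply ev_const|]. apply ev_pair.
  - apply ev_block; [apply ev_chain_num; auto|apply ev_const|apply ev_const|].
    eapply ev_comp2; eauto. rewrite <- Hx at 2. apply ev_chain.
  - apply ev_list. eapply ev_comp1; [|apply ev_rep]. apply ev_add; auto. apply ev_const.
Qed.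

(** * Numbering the states and transferring the language *)

Fixpoint pos {A : Type} (l : list A) (a : A) : nat :=
  match l with
  | [] => 0
  | b :: l' => if em (b = a) then 0 else S (pos l' a)
  end.

Lemma pos_inj {A : Type} (l : list A) a b : In a l -> In b l -> pos l a = pos l b -> a = b.
Proof.
  induction l as [|c l IH]; intros [] []; simpl; subst; auto;
    repeat destruct (em _); subst; try congruence; try discriminate; auto.
Qed.

Lemma pigeonhole M (f : nat -> nat) (P : nat -> Prop) : (forall n, f n < M) ->
  (forall N, exists n, N <= n /\ P n) -> exists q, forall N, exists n, N <= n /\ f n = q /\ P n.
Proof.
  revert P. induction M as [|M IH]; intros P Hf HP; [specialize (Hf 0); lia|].
  assert (Hgen : forall k P, k <= S M -> (forall n, P n -> f n < k) -> (forall N, exists n, N <= n /\ P n) ->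
     exists q, forall N, exists n, N <= n /\ f n = q /\ P n).
  { clear P HP IH. induction k as [|k IH]; intros P Hk Hlt HP.
    - destruct (HP 0) as (n & _ & Hn). apply Hlt in Hn. lia.
    - destruct (classic (forall N, exists n, N <= n /\ f n = k /\ P n)) as [|Hno]; [eauto|].
      apply not_all_ex_not in Hno. destruct Hno as [N0 Hno].
      destruct (IH (fun n => N0 <= n /\ P n)) as [q Hq]; [lia| | |].
      + intros n [Hn1 Hn2]. assert (f n <> k) by (intro; apply Hno; eauto). apply Hlt in Hn2. lia.
      + intro N. destruct (HP (N0 + N)) as (n & Hn & HPn). exists n. repeat split; auto; lia.
      + exists q. intro N. destruct (Hq N) as (n & A & B & C & D). eauto. }
  apply (Hgen (S M) P); auto.
Qed.

Section Coding.
Variables (K0 : stack) (J : nat) (RS : list stack).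
Hypothesis K0_in : In K0 RS.
Hypothesis RS_closed : forall K a K', In K RS -> nexts K0 K a = Some K' -> In K' RS.

(** From 12 on, the position of the stack and a digit, 0 for [SFmt] and [S j] for [SAct j], are
    combined in base [S J], then doubled to leave the odd numbers to the chain. *)
Definition code (s : st) : nat :=
  match s with
  | SInit => 0 | SX => 1 | SBW => 2 | SBA => 3 | SBD => 4 | SBC => 5
  | SN => 6 | SRN => 7 | SR => 8 | SD => 9
  | SCh Done => 10
  | SCh (Chn j) => chain_num j
  | SFmt K => 12 + 2 * (pos RS K * S J)
  | SAct j K => 12 + 2 * (pos RS K * S J + S j)
  end.

Definition core_states : list st :=
  [SInit; SX; SBW; SBA; SBD; SBC; SN; SRN; SR; SD; SCh Done] ++ map SFmt RS ++
  flat_map (fun j => map (SAct j) RS) (seq 0 J).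

(** Computed with input 0, because it must be encoded before [x] exists; by [outs_core] the states
    outside the chain behave alike for every input. *)
Definition core_trans : list tr4 :=
  flat_map (fun s => flat_map (fun a => map (fun p => (code s, a, code (fst p), code (snd p)))
    (outs K0 J 0 s a)) (seq 0 6)) core_states.

Definition valid (x : nat) (s : st) : Prop :=
  match s with
  | SCh (Chn j) => j <= x
  | SFmt K => In K RS
  | SAct j K => In K RS /\ j < J
  | _ => True
  end.

Definition not_chain (s : st) : Prop := match s with SCh (Chn _) => False | _ => True end.

Lemma core_states_spec x s : In s core_states <-> valid x s /\ not_chain s.
Proof.
  unfold core_states. rewrite !in_app_iff, in_map_iff, in_flat_map. split.
  - intros [H|[(K & <- & H)|(j & Hj & H)]].
    + simpl in H. repeat (destruct H as [<-|H]; [simpl; auto|]). destruct H.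
    + simpl; auto.
    + apply in_map_iff in H. destruct H as (K & <- & H). apply in_seq in Hj. simpl. repeat split; auto; lia.
  - intros [Hv Hc]. destruct s as [ | | | | | | | | | |[j|]|K|j K]; simpl in *; try contradiction; auto 20.
    + right; left. eauto.
    + right; right. exists j. split; [apply in_seq; lia|]. apply in_map. tauto.
Qed.

Lemma outs_core x s a : not_chain s -> outs K0 J x s a = outs K0 J 0 s a.
Proof. destruct s as [ | | | | | | | | | |[j|]|K|j K]; simpl; tauto. Qed.

Lemma mix_inj a b r r' : r < S J -> r' < S J -> a * S J + r = b * S J + r' -> a = b /\ r = r'.
Proof.
  intros Hr Hr' H. assert (a = b); [|subst; lia].
  destruct (Nat.lt_trichotomy a b) as [Hlt|[|Hlt]]; auto; nia.
Qed.

Lemma code_inj x s s' : valid x s -> valid x s' -> code s = code s' -> s = s'.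
Proof.
  intros Hv Hv' E.
  destruct s as [ | | | | | | | | | |[j|]|K|j K]; destruct s' as [ | | | | | | | | | |[j'|]|K'|j' K'];
    cbn [code valid] in *; unfold chain_num in *; try reflexivity; try (exfalso; lia).
  - f_equal. f_equal. lia.
  - f_equal. apply (pos_inj RS); auto. apply (mix_inj (pos RS K) (pos RS K') 0 0); lia.
  - destruct (mix_inj (pos RS K) (pos RS K') 0 (S j')); lia.
  - destruct (mix_inj (pos RS K) (pos RS K') (S j) 0); lia.
  - destruct (mix_inj (pos RS K) (pos RS K') (S j) (S j')) as [E1 E2]; try lia.
    f_equal; [lia|]. apply (pos_inj RS); tauto.
Qed.

Lemma core_trans_spec x q a q0 q1 : In (q, a, q0, q1) core_trans <->
  exists s s0 s1, valid x s /\ not_chain s /\ a < 6 /\ In (s0, s1) (outs K0 J x s a) /\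
    q = code s /\ q0 = code s0 /\ q1 = code s1.
Proof.
  unfold core_trans. rewrite in_flat_map. split.
  - intros (s & Hs & H). apply in_flat_map in H. destruct H as (a' & Ha & H). apply in_map_iff in H.
    destruct H as ([s0 s1] & E & H). inversion E; subst. apply (core_states_spec x) in Hs. destruct Hs.
    apply in_seq in Ha. exists s, s0, s1. rewrite outs_core by auto. repeat split; auto; lia.
  - intros (s & s0 & s1 & Hv & Hc & Ha & H & -> & -> & ->). exists s.
    split; [apply (core_states_spec x); auto|]. apply in_flat_map. exists a.
    split; [apply in_seq; lia|]. apply in_map_iff. exists (s0, s1). rewrite outs_core in H by auto. auto.
Qed.

Lemma block_spec c d0 d1 tr : In tr (block c d0 d1) <->
  exists a, a < 6 /\ let d := match a with 0 => d0 | 1 => d1 | 2 | 3 => c | _ => 1 end in tr = (c, a, d, d).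
Proof.
  split.
  - intro H. simpl in H. destruct H as [<-|[<-|[<-|[<-|[<-|[<-|[]]]]]]];
      [exists 0|exists 1|exists 2|exists 3|exists 4|exists 5]; simpl; split; auto; lia.
  - intros (a & Ha & E). cbv zeta in E. subst tr. letters a; simpl; auto 10; lia.
Qed.

Lemma chain_spec n l tr : In tr (chain n l) <->
  (exists j, j < n /\ In tr (block (chain_num j) 1 (chain_num (S j)))) \/ In tr l.
Proof.
  induction n as [|n IH]; cbn [chain].
  - split; auto. intros [(j & Hj & _)|]; auto. lia.
  - rewrite in_app_iff, IH. split.
    + intros [H|[(j & Hj & H)|H]]; auto; left; [exists n|exists j]; auto.
    + intros [(j & Hj & H)|H]; auto. destruct (Nat.eq_dec j n) as [->|]; auto.
      right; left. exists j. split; auto. lia.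
Qed.

Lemma outs_chain x j a : j <= x -> a < 6 ->
  exists s, outs K0 J x (SCh (Chn j)) a = both s /\
    code s = match a with 0 => if j =? x then 10 else 1 | 1 => if j =? x then 1 else chain_num (S j)
                        | 2 | 3 => chain_num j | _ => 1 end.
Proof.
  intros Hj Ha. cbn [outs].
  letters a; [| | | | | |lia]; simpl chstep; cbn [code]; try (eexists; split; reflexivity).
  - destruct (j =? x); eexists; split; reflexivity.
  - destruct (Nat.ltb_spec j x), (Nat.eqb_spec j x); try lia; eexists; split; reflexivity.
Qed.

Lemma delta_spec x q a q0 q1 : In (q, a, q0, q1) (pta_delta (input_pta x core_trans)) <->
  exists s s0 s1, valid x s /\ a < 6 /\ In (s0, s1) (outs K0 J x s a) /\
    q = code s /\ q0 = code s0 /\ q1 = code s1.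
Proof.
  cbn [input_pta pta_delta]. rewrite in_app_iff, chain_spec, (core_trans_spec x). split.
  - intros [H|[(j & Hj & H)|(s & s0 & s1 & H1 & _ & H2)]]; [| |exists s, s0, s1; tauto].
    + apply block_spec in H. destruct H as (a' & Ha & E).
      destruct (outs_chain x x a' (le_n x) Ha) as (s & Es & Ec).
      exists (SCh (Chn x)), s, s. inversion E; subst. rewrite Es, Ec, Nat.eqb_refl.
      repeat split; auto; try (simpl; lia). left; auto.
    + apply block_spec in H. destruct H as (a' & Ha & E).
      destruct (outs_chain x j a' ltac:(lia) Ha) as (s & Es & Ec).
      exists (SCh (Chn j)), s, s. inversion E; subst. rewrite Es, Ec.
      destruct (Nat.eqb_spec j x); [lia|].
      repeat split; auto; try (simpl; lia). left; auto.
  - intros (s & s0 & s1 & Hv & Ha & H & -> & -> & ->).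
    destruct (classic (not_chain s)) as [Hc|Hc]; [right; right; exists s, s0, s1; tauto|].
    destruct s as [ | | | | | | | | | |[j|]|K|j K]; simpl in Hc; try tauto.
    simpl in Hv. destruct (outs_chain x j a Hv Ha) as (s & Es & Ec). rewrite Es in H.
    destruct H as [H|[]]. inversion H; subst s0 s1. cbn [code]. rewrite Ec.
    destruct (Nat.eqb_spec j x) as [->|Hne].
    + left. apply block_spec. exists a. split; auto.
    + right; left. exists j. split; [lia|]. apply block_spec. exists a. split; auto.
Qed.

Lemma valid_act x j K a s0 s1 : In K RS -> j < J -> In (s0, s1) (outs_act K0 j K a) -> valid x s0 /\ valid x s1.
Proof.
  intros HK Hj H. unfold outs_act in H. destruct (nexts K0 K a) as [K'|] eqn:E; [|destruct H].
  assert (HK' : In K' RS) by eauto.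
  destruct K as [|p K]; [destruct H as [H|[]]; destruct (a =? 5); inversion H; simpl; auto|].
  destruct (kact (p :: K)) as [[i|i|i]|]; try destruct (i =? j); simpl in H;
    solve_pairs; simpl; auto.
Qed.

Lemma valid_step x s a s0 s1 : valid x s -> In (s0, s1) (outs K0 J x s a) -> valid x s0 /\ valid x s1.
Proof.
  intros Hv H.
  assert (HN : In (s0, s1) (flat_map (fun j => outs_act K0 j K0 a) (seq 0 J)) -> valid x s0 /\ valid x s1).
  { intro Hi. apply in_flat_map in Hi. destruct Hi as (j & Hj & Hi). apply in_seq in Hj.
    apply (valid_act x j K0 a); auto. lia. }
  destruct s as [ | | | | | | | | | |z|K|j K]; cbn [outs valid] in *; auto.
  - simpl in H. solve_pairs; simpl; auto; lia.
  - simpl in H. solve_pairs; simpl; auto.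
  - simpl in H. solve_pairs; simpl; auto.
  - letters a; simpl in H; solve_pairs; simpl; auto.
  - letters a; simpl in H; solve_pairs; simpl; auto.
  - letters a; simpl in H; solve_pairs; simpl; auto.
  - letters a; simpl in H; solve_pairs; simpl; auto.
  - letters a; simpl in H; solve_pairs; simpl; auto.
  - destruct (chstep x z a) as [z'|] eqn:E; destruct H as [H|[]]; inversion H; subst; simpl; auto.
    destruct z' as [k|]; auto. enough (k <= x) by auto.
    destruct z as [j|]; simpl in E.
    + destruct a as [|[|[|[|]]]]; try discriminate.
      * destruct (j =? x); discriminate.
      * destruct (Nat.ltb_spec j x); inversion E; lia.
      * inversion E; lia.
      * inversion E; lia.
    + letters a; inversion E; lia.
  - destruct (nexts K0 K a) as [K'|] eqn:E; destruct H as [H|[]]; inversion H; subst; simpl; eauto.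
  - apply (valid_act x j K a); tauto.
Qed.

Section WithInput.
Variable x : nat.
Hypothesis x_code : enc_trs core_trans = x.
Let A := input_pta x core_trans.

Lemma core_trans_small q a q0 q1 : In (q, a, q0, q1) core_trans -> q < x /\ q0 < x /\ q1 < x.
Proof.
  intro H. apply (in_map enc_trans) in H. apply enc_list_ge in H. fold (enc_trs core_trans) in H.
  rewrite x_code in H. simpl in H.
  assert (H1 := cpair_ge q (cpair a (cpair q0 q1))). assert (H2 := cpair_ge a (cpair q0 q1)).
  assert (H3 := cpair_ge q0 q1). lia.
Qed.

(** A state with a transition has its number in the encoded list, hence below [x]; this bounds the
    numbers that are not fixed. *)
Lemma outs_some_letter s : In s core_states -> 11 <= code s -> exists a p, a < 6 /\ In p (outs K0 J 0 s a).
Proof.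
  intros Hs Hc. apply (core_states_spec 0) in Hs. destruct Hs as [Hv Hn].
  destruct s as [ | | | | | | | | | |[j|]|K|j K]; cbn [code] in Hc; try lia; try contradiction.
  - exists 0. cbn [outs]. destruct (nexts K0 K 0); eexists; (split; [lia|left; reflexivity]).
  - assert (H : exists a K', a < 6 /\ nexts K0 K a = Some K').
    { destruct K as [|[[|[]]|p q|p] K]; [exists 4|exists 3|exists 2|exists 3|exists 3|exists 3|exists 0];
        eexists; (split; [lia|reflexivity]). }
    destruct H as (a & K' & Ha & E). exists a. cbn [outs]. unfold outs_act. rewrite E.
    destruct K as [|p K]; [eexists; split; [lia|left; reflexivity]|].
    destruct (kact (p :: K)) as [[i|i|i]|]; try destruct (i =? j); eexists; (split; [lia|left; reflexivity]).
Qed.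

Lemma code_bound s : valid x s -> code s < 13 + (x + x).
Proof.
  intro Hv. destruct (Nat.lt_ge_cases (code s) 11); [lia|].
  destruct (classic (not_chain s)) as [Hc|Hc].
  - destruct (outs_some_letter s) as (a & [s0 s1] & Ha & Hin); [apply (core_states_spec x); auto|auto|].
    assert (Ht : In (code s, a, code s0, code s1) core_trans).
    { apply (core_trans_spec x). exists s, s0, s1. rewrite outs_core by auto. repeat split; auto. }
    apply core_trans_small in Ht. lia.
  - destruct s as [ | | | | | | | | | |[j|]|K|j K]; simpl in Hc; try tauto. simpl in *. unfold chain_num. lia.
Qed.

Lemma prio_code s : valid x s -> prio A (code s) = sprio s.
Proof.
  intro Hv. unfold prio, A. cbn [input_pta pta_prio].
  destruct (Nat.lt_ge_cases (code s) 11) as [Hlt|Hge].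
  - rewrite app_nth1 by (simpl; auto).
    destruct s as [ | | | | | | | | | |[j|]|K|j K]; cbn [code] in Hlt |- *; try reflexivity;
      unfold chain_num in *; exfalso; lia.
  - rewrite app_nth2 by (simpl; auto). simpl length. assert (Hb := code_bound s Hv).
    rewrite nth_repeat_lt by lia.
    destruct s as [ | | | | | | | | | |[j|]|K|j K]; cbn [code] in Hge |- *; try reflexivity; exfalso; lia.
Qed.

Lemma input_pta_wf : pta_wf A.
Proof.
  split; [simpl; lia|]. split.
  - unfold A, input_pta. cbn [pta_prio pta_nstates]. rewrite length_app, repeat_length. simpl. lia.
  - intros q a q0 q1 H. apply delta_spec in H. destruct H as (s & s0 & s1 & Hv & Ha & Hin & -> & -> & ->).
    destruct (valid_step x s a s0 s1 Hv Hin) as [H0 H1].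
    unfold A. cbn [input_pta pta_nstates pta_nletters]. repeat split; auto using code_bound.
Qed.

(** There are finitely many numbers, so a priority that recurs belongs to a state that recurs. *)
Lemma parity_sacc (r : nat -> st) : (forall n, valid x (r n)) ->
  (parity_acc A (fun n => code (r n)) <-> sacc r).
Proof.
  intro Hv.
  assert (Hp : forall n, prio A (code (r n)) = sprio (r n)) by (intro; apply prio_code; auto).
  assert (Hb : forall n, code (r n) < 13 + (x + x)) by (intro; apply code_bound; auto).
  assert (H2 : forall s, sprio s = 0 \/ sprio s = 1 \/ sprio s = 2) by (intros []; simpl; auto).
  split.
  - intros (q & Hq & [k Hk] & Hmin). destruct (Hq 0) as (n0 & _ & E0).
    assert (Hq' : prio A q = 0 \/ prio A q = 2).
    { rewrite <- E0, Hp in *. destruct (H2 (r n0)) as [E|[E|E]]; rewrite E in *; auto; lia. }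
    destruct Hq' as [E|E].
    + left. intro N. destruct (Hq N) as (n & Hn & En). exists n. split; auto. rewrite <- Hp, En. auto.
    + right. apply NNPP. intro Hno.
      destruct (pigeonhole (13 + (x + x)) (fun n => code (r n)) (fun n => sprio (r n) = 1) Hb) as [q' Hq'].
      * intro N. apply NNPP. intro Hno'. apply Hno. exists N. intros n Hn E1. apply Hno'. eauto.
      * assert (Hi : inf_often (fun n => code (r n)) q') by (intro N; destruct (Hq' N) as (n & Hn & En & _); eauto).
        apply Hmin in Hi. destruct (Hq' 0) as (n & _ & En & E1). rewrite <- En, Hp, E1 in Hi. lia.
  - intro H. destruct (classic (forall N, exists n, N <= n /\ sprio (r n) = 0)) as [H0|H0].
    + destruct (pigeonhole (13 + (x + x)) (fun n => code (r n)) (fun n => sprio (r n) = 0) Hb H0) as [q Hq].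
      exists q. destruct (Hq 0) as (n & _ & En & E0).
      assert (E : prio A q = 0) by (rewrite <- En, Hp; auto). rewrite E. split; [|split; [exists 0; auto|intros; lia]].
      intro N. destruct (Hq N) as (m & Hm & Em & _). eauto.
    + destruct H as [H|[N1 H1]]; [contradiction|]. apply not_all_ex_not in H0. destruct H0 as [N0 H0].
      assert (Hev : forall n, N0 + N1 <= n -> sprio (r n) = 2).
      { intros n Hn. destruct (H2 (r n)) as [E|[E|E]]; auto.
        - exfalso. apply H0. exists n. split; auto. lia.
        - exfalso. apply (H1 n); auto. lia. }
      destruct (pigeonhole (13 + (x + x)) (fun n => code (r n)) (fun n => True) Hb) as [q Hq]; [intro N; exists N; auto|].
      assert (Hinf : forall q', inf_often (fun n => code (r n)) q' -> prio A q' = 2).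
      { intros q' Hq'. destruct (Hq' (N0 + N1)) as (n & Hn & En). rewrite <- En, Hp. auto. }
      assert (Hi : inf_often (fun n => code (r n)) q) by (intro N; destruct (Hq N) as (n & Hn & En & _); eauto).
      exists q. split; auto. rewrite (Hinf q Hi). split; [exists 1; auto|].
      intros q' Hq'. rewrite (Hinf q' Hq'). auto.
Qed.

Lemma srun_valid t rho : srun K0 J x t rho -> forall u, valid x (rho u).
Proof.
  intros [H0 H1] u. induction u as [|b u IH] using rev_ind; [rewrite H0; exact I|].
  destruct (valid_step x _ _ _ _ IH (H1 u)). destruct b; auto.
Qed.

(** A run of the numbered automaton can be decoded because it takes a transition at every node, so
    each of its labels is the code of a valid state. *)
Lemma lang_symbolic t : in_Lqual_univ A t <-> symbolic_lang K0 J x t.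
Proof.
  split.
  - intros [Ht H]. split; [exact Ht|]. intros rho Hrun.
    assert (Hv := srun_valid t rho Hrun). destruct Hrun as [R0 R1].
    assert (Hr : is_run A t (fun u => code (rho u))).
    { split; [rewrite R0; reflexivity|]. intro u. apply delta_spec.
      exists (rho u), (rho (u ++ [false])), (rho (u ++ [true])). repeat split; auto. }
    specialize (H _ Hr). eapply null_subset; [|exact H]. intros pi Hpi Hacc. apply Hpi.
    apply (parity_sacc (along rho pi)); auto. intro n; apply Hv.
  - intros [Ht H]. split; [exact Ht|]. intros rho [R0 R1].
    set (dec := fun q => epsilon (inhabits SX) (fun s => valid x s /\ code s = q)).
    assert (Hdec : forall s, valid x s -> dec (code s) = s).
    { intros s Hs. assert (E : valid x (dec (code s)) /\ code (dec (code s)) = code s).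
      { unfold dec. apply epsilon_spec. eauto. }
      apply (code_inj x); tauto. }
    assert (Hu : forall u, valid x (dec (rho u)) /\ code (dec (rho u)) = rho u).
    { intro u. specialize (R1 u). apply delta_spec in R1. destruct R1 as (s & s0 & s1 & Hv & _ & _ & E & _).
      rewrite E, Hdec; auto. }
    assert (Hrun : srun K0 J x t (fun u => dec (rho u))).
    { split.
      - rewrite R0. apply (Hdec SInit). exact I.
      - intro u. specialize (R1 u). apply delta_spec in R1.
        destruct R1 as (s & s0 & s1 & Hv & Ha & Hin & -> & -> & ->).
        destruct (valid_step x _ _ _ _ Hv Hin). rewrite !Hdec; auto. }
    specialize (H _ Hrun). eapply null_subset; [|exact H]. intros pi Hpi Hacc. apply Hpi.
    apply (parity_sacc (along (fun u => dec (rho u)) pi)) in Hacc; [|intro n; apply Hu].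
    replace (along rho pi) with (fun n => code (along (fun u => dec (rho u)) pi n)); auto.
    apply functional_extensionality. intro n. unfold along. apply Hu.
Qed.
End WithInput.
End Coding.

(** * The diagonal argument *)

Lemma pta_of_program (R : prog rop) : exists l : list tr4,
  let x := enc_trs l in
  pta_wf (input_pta x l) /\
  ((exists t, in_Lqual_univ (input_pta x l) t) <-> exists s', rsem R (upd (fun _ => 0) 0 x) s').
Proof.
  (* [d] is positive since loading uses register 0; each register has two counters, hence [J]; and
     [g = 2 * J] gives [2 * J <= 2^g]. *)
  destruct (regs_bounded R) as [d0 Hd0]. set (d := S d0). set (J := 2 * d). set (g := 2 * J).
  assert (Hd : pall (fun o => rop_reg o < d) R) by (eapply pall_mono; [|exact Hd0]; simpl; intros; lia).
  destruct (stacks_finite g R d ltac:(lia) Hd) as (RS & HK0 & Hcl & Hidx).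
  set (K0 := load g R) in *. exists (core_trans K0 J RS). cbv zeta. set (x := enc_trs (core_trans K0 J RS)).
  assert (Hth1 : (1 <= 1 <= Z.of_nat g)%Z) by (unfold g, J, d; lia).
  assert (Hthg : (1 <= Z.of_nat g <= Z.of_nat g)%Z) by (unfold g, J, d; lia).
  assert (Hx : 0 < x).
  { assert (Hin : In (enc_trans (code J RS SX, 0, code J RS SX, code J RS SX)) (map enc_trans (core_trans K0 J RS))).
    { apply in_map. apply (core_trans_spec K0 J RS 0). exists SX, SX, SX. simpl. repeat split; auto. lia. }
    apply enc_list_ge in Hin. unfold x, enc_trs. lia. }
  split; [apply input_pta_wf; auto|]. split.
  - intros [t Ht]. apply lang_symbolic in Ht; auto. apply NNPP. intro Hno.
    apply (no_good_word_contradiction K0 J x g RS t); auto.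
    + lia.
    + assert (E : INR (2 ^ g) = (2 ^ g)%R) by (rewrite pow_INR; reflexivity). rewrite <- E. replace (2 * INR J)%R with (INR g) by (unfold g; rewrite mult_INR; reflexivity).
      apply le_INR. apply Nat.lt_le_incl, Nat.pow_gt_lin_r. lia.
    + intros w Hw. apply Hno. eapply (good_word_sound g R); eauto.
  - intros [s' Hs']. destruct (good_word_complete g R 1 x s' Hth1 Hx Hs') as (w & [W1 W2] & W3 & W4).
    exists (honest K0 x w). apply lang_symbolic; auto. apply honest_in_lang; auto.
Qed.

(** Maps 0 to 1 and every successor to 0, so a search for a zero succeeds after answer 1 and fails
    after answer 0. *)
Definition r_not_one : recf := rPrim (e_const 1) rZero.

Theorem theorem3p11 : ~ exists f : recf, decides_Lqual_univ_emptiness f.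
Proof.
  intros [f Hf].
  (* The search variable is argument 0, so the input is argument 1. The function searched is
     constant in the search variable: [h] stops at 0 if [f] answers 1 on the automaton of [x], and
     diverges if it answers 0. *)
  set (h := rMu (rComp r_not_one [rComp f [rComp r_pta [rProj 1]]])).
  destruct (pta_of_program (compile h [0] 1 2)) as [l [Hwf Hl]]. set (x := enc_trs l) in *.
  set (A := input_pta x l) in *.
  assert (Hhalt : (exists s', rsem (compile h [0] 1 2) (upd (fun _ => 0) 0 x) s') <-> exists y, reval h [x] y).
  { assert (Hc := comp_spec h [0] 1 2 (upd (fun _ => 0) 0 x)). split.
    - intros [s' Hs]. apply Hc in Hs; try (simpl; intros; lia); try reflexivity.
      + destruct Hs as (y & Hy & _). exists y. exact Hy.
      + intros r Hr. apply upd_other. lia.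
    - intros [y Hy]. eexists. apply Hc; try (simpl; intros; lia); try reflexivity.
      + intros r Hr. apply upd_other. lia.
      + exists y. split; [exact Hy|reflexivity]. }
  assert (Hpta : forall n, reval (rComp r_pta [rProj 1]) [n; x] (enc_pta A)).
  { intro n. eapply ev_comp1; [apply (ev_var 1); reflexivity|]. apply ev_pta. reflexivity. }
  destruct (Hf A Hwf) as [[H1 He]|[H0 He]].
  - apply He. apply Hl, Hhalt. exists 0. constructor; [|intros; lia].
    eapply ev_comp1; [eapply ev_comp1; [apply Hpta|exact H1]|].
    econstructor; [constructor; apply (ev_const 1)|constructor].
  - assert (Hne : exists t, in_Lqual_univ A t) by (apply NNPP; exact He).
    apply Hl, Hhalt in Hne. destruct Hne as [y Hy]. inversion Hy as [| | | | | |f' v' n' Hy0 Hlt]; subst.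
    assert (H1 : reval (rComp r_not_one [rComp f [rComp r_pta [rProj 1]]]) [y; x] 1).
    { eapply ev_comp1; [eapply ev_comp1; [apply Hpta|exact H0]|]. constructor. apply (ev_const 1). }
    assert (E := reval_det _ _ _ _ Hy0 H1). discriminate.
Qed.
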